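(* Let $s>\frac72$ and $f\in C^{[s]+1}(\mathbb{R})$ with $f(0)=0$. Let $\beta\in W^{1,1}(\mathbb{R})$ and let $\beta''=\nu$ be a finite measure on $\mathbb{R}$. Let $u\in C^1([0,T],H^s(\mathbb{R}))$ be the solution of the initial-value problem $$u_t+(\beta\ast f(u))_x=0,\quad x\in\mathbb{R},\ t>0,\qquad u(x,0)=\varphi(x),\quad x\in\mathbb{R},$$ with $\varphi\in H^s(\mathbb{R})$. Then for sufficiently small $h>0$ and $\epsilon>0$ there is an $N$ so that the solution $\mathbf{u}_h^N=((\mathbf{u}_h^N)_i)_{-N\le i\le N}$ of the finite system $$\frac{dv_i^N}{dt}=-\sum_{j=-N}^{N}h\,D\beta(x_i-x_j)\,f(v_j^N),\qquad -N\le i\le N,$$ with initial values $(\mathbf{u}_h^N)_i(0)=\varphi(ih)$, $-N\le i\le N$, exists for times $t\in[0,T]$ and $$\big|u(ih,t)-(\mathbf{u}_h^N)_i(t)\big|=\mathcal{O}(h^2+\epsilon),\qquad t\in[0,T],$$ for all $-N\le i\le N$.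
   Context: All functions are real-valued. $(\beta\ast v)(x)=\int_{\mathbb{R}}\beta(x-y)v(y)\,dy$. $W^{1,1}(\mathbb{R})$ is the space of $L^1$ functions with distributional derivative in $L^1$; point values of $\beta$ are those of its continuous representative. $\nu$ is a finite signed Borel measure and $\beta''$ is the distributional second derivative. $H^s(\mathbb{R})$ is the usual $L^2$-based Sobolev space of index $s$ on $\mathbb{R}$ (elements are identified with their continuous representatives), and $[s]$ is the largest integer less than or equal to $s$. Grid points are $x_i=ih$, $i\in\mathbb{Z}$, and $D\beta(x_i-x_j)=\frac{1}{2h}\big(\beta(x_{i-j+1})-\beta(x_{i-j-1})\big)$. The conclusion is read as: there are $h_0,\epsilon_0,C>0$ such that for all $0<h\le h_0$ and $0<\epsilon\le\epsilon_0$ there is a positive integer $N$ (depending on $h$ and $\epsilon$) for which the solution exists on $[0,T]$ and the error is at most $C(h^2+\epsilon)$, with $C$ independent of $h$, $\epsilon$, $N$, $i$, $t$. *)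

(* Defs.v *)
From HB Require Import structures.
From mathcomp Require Import all_boot all_order all_algebra.
From mathcomp Require Import all_classical all_reals all_analysis.

Set Implicit Arguments.
Unset Strict Implicit.
Unset Printing Implicit Defensive.

Import Order.TTheory GRing.Theory Num.Theory.
Import numFieldNormedType.Exports.

Local Open Scope ring_scope.
Local Open Scope classical_set_scope.

(* C^n: f is n times differentiable and f^(n) is continuous. *)
Definition class_C (R : realType) (n : nat) (f : R -> R) : Prop :=
  (forall k, (k < n)%N -> forall x, derivable f^`(k) x 1) /\
  continuous f^`(n).

Definition test_function (R : realType) (phi : R -> R) : Prop :=
  (forall n, class_C n phi) /\ exists A : R, forall x, A < `|x| -> phi x = 0.

Definition weak_derivative (R : realType) (v w : R -> R) : Prop :=
  forall phi : R -> R, test_function phi ->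
    \int[lebesgue_measure]_x (v x * phi^`()%classic x) =
    - \int[lebesgue_measure]_x (w x * phi x).

(* Continuity selects the continuous representative. *)
Definition W11 (R : realType) (beta : R -> R) : Prop :=
  [/\ continuous beta, beta \in Lfun lebesgue_measure 1 &
      exists2 w : R -> R, w \in Lfun lebesgue_measure 1 &
                          weak_derivative beta w].

(* beta'' = nu as distributions, the integral against the signed measure nu
   being the difference of the integrals against its Jordan parts (which do
   not depend on the Hahn decomposition P, N). *)
Definition second_derivative_measure (R : realType) (beta : R -> R)
    (nu : {charge set (measurableTypeR R) -> \bar R}) : Prop :=
  exists P N (nuPN : hahn_decomposition nu P N),
    forall phi : R -> R, test_function phi ->
      \int[lebesgue_measure]_x (beta x * phi^`(2)%classic x) =
      \int[jordan_pos nuPN]_x phi x - \int[jordan_neg nuPN]_x phi x.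

Definition convolution (R : realType) (beta v : R -> R) (x : R) : R :=
  \int[lebesgue_measure]_y (beta (x - y) * v y).

(* Real and imaginary parts of \int_{-n}^n v(x) e^{-i x xi} dx. *)
Definition fourier_re (R : realType) (v : R -> R) (n : nat) (xi : R) : R :=
  \int[lebesgue_measure]_(x in `[- n%:R, n%:R]) (v x * cos (x * xi)).
Definition fourier_im (R : realType) (v : R -> R) (n : nat) (xi : R) : R :=
  - \int[lebesgue_measure]_(x in `[- n%:R, n%:R]) (v x * sin (x * xi)).

(* a + i b is the Fourier(-Plancherel) transform of v in L^2: the L^2 limit of
   the truncated Fourier integrals. *)
Definition is_fourier (R : realType) (v a b : R -> R) : Prop :=
  [/\ a \in Lfun lebesgue_measure 2%:E,
      b \in Lfun lebesgue_measure 2%:E &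
      (\int[lebesgue_measure]_xi
         (((a xi - fourier_re v n xi) ^+ 2
           + (b xi - fourier_im v n xi) ^+ 2)%:E))%E @[n --> \oo] --> 0%E].

(* The norm (\int (1 + xi^2)^s |v^(xi)|^2 dxi)^(1/2). The transform is unique up
   to null sets, so that the infimum is over at most one value; it is +oo when v
   has no transform in L^2. *)
Definition Hs_norm (R : realType) (s : R) (v : R -> R) : \bar R :=
  (ereal_inf [set z : \bar R | exists a b : R -> R, is_fourier v a b /\
     z = \int[lebesgue_measure]_xi
           (((1 + xi ^+ 2) `^ s * (a xi ^+ 2 + b xi ^+ 2))%:E)] `^ 2^-1)%E.

(* H^s for s > 1/2, elements being identified with their continuous
   representatives. *)
Definition Hs (R : realType) (s : R) (v : R -> R) : Prop :=
  [/\ continuous v, v \in Lfun lebesgue_measure 2%:E &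
      (Hs_norm s v < +oo)%E].

(* d -> 0, d != 0, with t + d in [0, T]: derivatives at the endpoints of [0, T]
   are one-sided. *)
Definition increments (R : realType) (T t : R) : set_system R :=
  within [set d | 0 <= t + d <= T] 0^'.

(* u in C^1([0,T], H^s) with derivative ut; u t is the function x |-> u(x,t). *)
Definition C1_Hs (R : realType) (s T : R) (u ut : R -> R -> R) : Prop :=
  forall t, 0 <= t <= T ->
    [/\ Hs s (u t), Hs s (ut t),
        Hs_norm s (fun x => d^-1 * (u (t + d) x - u t x) - ut t x)
          @[d --> increments T t] --> 0%E &
        Hs_norm s (fun x => ut (t + d) x - ut t x)
          @[d --> increments T t] --> 0%E].

Definition ivp_solution (R : realType) (s T : R) (beta f phi : R -> R)
    (u : R -> R -> R) : Prop :=
  exists ut : R -> R -> R,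
    [/\ C1_Hs s T u ut,
        forall t x, 0 < t <= T ->
          derivable (convolution beta (f \o u t)) x 1 /\
          ut t x + (convolution beta (f \o u t))^`()%classic x = 0 &
        forall x, u 0 x = phi x].

Definition grid (R : realType) (h : R) (i : int) : R := i%:~R * h.

(* D beta (x_i - x_j), with k = i - j. *)
Definition Dgrid (R : realType) (h : R) (beta : R -> R) (k : int) : R :=
  (2 * h)^-1 * (beta (grid h (k + 1)) - beta (grid h (k - 1))).

(* The indices -N <= i <= N are enumerated by 'I_(2N+1). *)
Definition cidx (N : nat) (k : 'I_(N.*2.+1)) : int := k%:Z - N%:Z.

Definition lattice_solution (R : realType) (T h : R) (beta f phi : R -> R)
    (N : nat) (v : 'I_(N.*2.+1) -> R -> R) : Prop :=
  (forall i, v i 0 = phi (grid h (cidx i))) /\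
  forall i t, 0 <= t <= T ->
    d^-1 * (v i (t + d) - v i t) @[d --> increments T t] -->
      - \sum_(j < N.*2.+1) h * Dgrid h beta (cidx i - cidx j) * f (v j t).

(* Main.v *)
Require Import Defs.
From HB Require Import structures.
From mathcomp Require Import all_boot all_order all_algebra.
From mathcomp Require Import all_classical all_reals all_analysis.
From mathcomp Require Import measurable_realfun ring lra zify.

Set Implicit Arguments.
Unset Strict Implicit.
Unset Printing Implicit Defensive.

Import Order.TTheory GRing.Theory Num.Theory.
Import numFieldNormedType.Exports.

Local Open Scope ring_scope.
Local Open Scope classical_set_scope.

(** The errors at the grid points satisfy a system of differential equations, and they
stay small because the scheme is stable and consistent.

Consistency is delicate, since the kernel beta has only a derivative of bounded
variation and cannot be expanded.  Instead, the increments of beta over the cells of a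
lattice of step h sum to at most the L^1 norm of beta' (lattice_variation), and the
second differences beta(y) + beta(y+h) - beta(y+r) - beta(y+h-r) sum to at most r times
the total mass of nu (lattice_second_variation).  Both bounds are read off the weak
formulation: the test function is a signed sum of smoothed indicator functions,
respectively of smoothed trapezoids of height r, one in each cell.  For w with bounded
derivatives up to order three, summation by parts moves the centered difference from
beta to w, where Taylor's formula applies; what remains is a Riemann sum for the integral
of beta w', and the trapezoid rule is exact up to O(h^2) because the second differences
of beta w' sum to O(h) (scheme_consistency).  Restricting the sum to |j| <= N adds at most
the variation of beta times the supremum of |w| outside [-N h, N h]
(truncated_scheme_consistency).

This is applied to w = f(u(t)), which needs three bounded derivatives of u(t).  For
s > 7/2 the Fourier transform of a function in H^s has absolute moments up to order three, by the
Cauchy-Schwarz inequality.  Fourier inversion, proved by inserting the Abel factor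
e^(-d |xi|) and letting the Poisson kernel concentrate, writes the function as a
trigonometric integral which can be differentiated three times (sobolev_embedding).
Applied to difference quotients in time, the embedding turns u in C^1([0,T], H^s) into
pointwise time derivatives and local bounds (C1_Hs_local); compactness of [0,T] makes the
bounds uniform (uniform_on_segment), and so is the decay of u at infinity, a consequence
of square integrability (L2_decay).  Thus N can be chosen with |u| <= eps outside
[-N h, N h], where |f(u)| is then at most a multiple of eps because f(0) = 0.

Stability holds in the maximum norm because the weights h |D beta| of a row sum to at most
the variation of beta.  As f is only locally Lipschitz, its argument is first clamped to
an interval [-r, r] where r exceeds a bound for |u| by 1.  The clamped system
has a solution on all of [0,T] (picard_lindelof), and gronwall_max bounds its error by
C (h^2 + eps).  For small h and eps this is at most 1, so the clamping is never active
and the original system has been solved.  By lattice_solution_unique it has no other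
solution. *)

(** * Integrable functions on the line *)

Notation L1 f := (lebesgue_measure.-integrable [set: _] (EFin \o f)).

Section integrals.
Context {R : realType}.
Notation mu := (@lebesgue_measure R).
Implicit Types f g : R -> R.

Lemma L1_measurable f : L1 f -> measurable_fun setT f.
Proof. by move=> /(measurable_int mu)/measurable_EFinP. Qed.

Lemma L1_dominated f g : measurable_fun setT f -> L1 g ->
  (forall x, `|f x| <= g x) -> L1 f.
Proof.
move=> mf ig fg; apply: le_integrable ig => //.
- exact/measurable_EFinP.
- move=> x _ /=; rewrite lee_fin (le_trans (fg x))//.
  exact: ler_norm.
Qed.

Lemma L1D f g : L1 f -> L1 g -> L1 (fun x => f x + g x).
Proof. by move=> ? ?; rewrite /comp; under eq_fun do rewrite EFinD; exact: integrableD. Qed.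

Lemma L1B f g : L1 f -> L1 g -> L1 (fun x => f x - g x).
Proof. by move=> ? ?; rewrite /comp; under eq_fun do rewrite EFinB; exact: integrableB. Qed.

Lemma L1Z c f : L1 f -> L1 (fun x => c * f x).
Proof. by move=> ?; rewrite /comp; under eq_fun do rewrite EFinM; exact: integrableZl. Qed.

Lemma L1_norm f : L1 f -> L1 (fun x => `|f x|).
Proof. by move=> h; exact: integrable_norm. Qed.

Lemma le_int f g : L1 f -> L1 g -> (forall x, f x <= g x) ->
  \int[mu]_x f x <= \int[mu]_x g x.
Proof. by move=> f1 g1 fg; apply: le_Rintegral. Qed.

Lemma norm_int_le f g : measurable_fun setT f -> L1 g ->
  (forall x, `|f x| <= g x) -> `|\int[mu]_x f x| <= \int[mu]_x g x.
Proof.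
move=> mf g1 fg; have f1 := L1_dominated mf g1 fg.
by apply: (le_trans (le_normr_Rintegral _ _)) => //; apply: le_int => //; exact: L1_norm.
Qed.

Lemma EFin_int f : L1 f -> (\int[mu]_x f x)%:E = (\int[mu]_x (f x)%:E)%E.
Proof. by move=> h; rewrite fineK//; exact: integrable_fin_num. Qed.

Lemma Lfun1_L1 f : f \in Lfun mu 1 -> L1 f.
Proof. by move=> /Lfun1_integrable. Qed.

Lemma Lfun_measurable p f : f \in Lfun mu p -> measurable_fun setT f.
Proof. by rewrite inE => /andP[mf _]; move: mf; rewrite inE. Qed.

Lemma Lfun2_L1 f : f \in Lfun mu 2%:E -> L1 (fun x => f x ^+ 2).
Proof. exact: Lfun2_integrable_sqr. Qed.

Lemma continuous_measurable f : continuous f -> measurable_fun setT f.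
Proof. exact: continuous_measurable_fun. Qed.

Lemma cvge0_near_lt T (F : set_system T) (FF : Filter F) (f : T -> \bar R) (e : R) :
  f @ F --> 0%E -> 0 < e -> \forall x \near F, (f x < e%:E)%E.
Proof.
move=> cf e0; apply: (cf [set y | (y < e%:E)%E]).
by apply: open_ereal_lt'; rewrite lte_fin.
Qed.

End integrals.

(** * Differentiable functions on the line *)

Section C3.
Context {R : realType}.
Implicit Types (w : R -> R) (K : R).

(** The derivatives are explicit witnesses, so that linear combinations, reflections and
compositions are treated by the chain rule alone. *)
Definition C3_bounded w K := exists w1 w2 w3 : R -> R,
  [/\ forall x : R, is_derive x 1 w (w1 x),
      forall x : R, is_derive x 1 w1 (w2 x),
      forall x : R, is_derive x 1 w2 (w3 x) &
      forall x, [/\ `|w x| <= K, `|w1 x| <= K, `|w2 x| <= K & `|w3 x| <= K]].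

Lemma is_derive_cont (w w1 : R -> R) : (forall x : R, is_derive x 1 w (w1 x)) -> continuous w.
Proof. by move=> h x; apply: differentiable_continuous; apply/derivable1_diffP; have [] := h x. Qed.

Lemma mvt_on w w1 (a b : R) : (forall x : R, a <= x <= b -> is_derive x 1 w (w1 x)) ->
  a <= b -> exists2 c, a <= c <= b & w b - w a = w1 c * (b - a).
Proof.
move=> dw ab; have [||c cab e] := @MVT_segment _ w w1 a b ab.
- by move=> x; rewrite in_itv /= => /andP[ax xb]; apply: dw; rewrite !ltW.
- apply: derivable_within_continuous => x; rewrite in_itv /= => xab.
  by have [] := dw x xab.
by exists c => //; move: cab; rewrite in_itv.
Qed.

Lemma mvt w w1 (a b : R) : (forall x : R, is_derive x 1 w (w1 x)) -> a <= b ->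
  exists2 c, a <= c <= b & w b - w a = w1 c * (b - a).
Proof. by move=> dw; exact: mvt_on. Qed.

Lemma mvt_bound w w1 K (a b : R) : (forall x : R, is_derive x 1 w (w1 x)) ->
  (forall x, `|w1 x| <= K) -> `|w b - w a| <= K * `|b - a|.
Proof.
move=> dw wK; wlog ab : a b / a <= b.
  move=> H; have [ab|ba] := leP a b; first exact: H.
  by rewrite distrC (distrC b); apply: H; exact: ltW.
have [c _ ->] := mvt dw ab.
by rewrite normrM ler_wpM2r.
Qed.

Lemma derive_ge0_nondecreasing w w1 (a b : R) : (forall x : R, is_derive x 1 w (w1 x)) ->
  (forall x, 0 <= w1 x) -> a <= b -> w a <= w b.
Proof.
move=> dw w0 ab; have [c _ e] := mvt dw ab.
by rewrite -subr_ge0 e mulr_ge0// subr_ge0.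
Qed.

(** Two applications of the mean value theorem, at the price of the factor 1/2. *)
Lemma taylor2 w w1 w2 K (a b : R) : (forall x : R, is_derive x 1 w (w1 x)) ->
  (forall x : R, is_derive x 1 w1 (w2 x)) -> (forall x, `|w2 x| <= K) ->
  `|w b - w a - w1 a * (b - a)| <= K * (b - a) ^+ 2.
Proof.
move=> dw dw1 wK.
have [c [cab e]] : exists c, `|c - a| <= `|b - a| /\ w b - w a = w1 c * (b - a).
  have [ab|/ltW ba] := leP a b.
    have [c /andP[c1 c2] e] := mvt dw ab; exists c; split => //.
    by rewrite !ger0_norm ?subr_ge0// lerD2r.
  have [c /andP[c1 c2] e] := mvt dw ba; exists c; split.
    by rewrite !ler0_norm ?subr_le0// lerN2 lerD2r.
  by rewrite -opprB e -mulrN opprB.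
rewrite e -mulrBl normrM -(real_normK (num_real (b - a))) expr2 mulrA.
apply: ler_wpM2r => //; apply: (le_trans (mvt_bound _ _ dw1 wK)).
by apply: ler_wpM2l => //; exact: le_trans (wK 0).
Qed.

(** For derivatives that no rule computes: flat functions at the origin, and integrals
depending on a parameter. *)
Lemma is_derive_quadratic w (l C x : R) :
  (forall d, `|w (x + d) - w x - d * l| <= C * d ^+ 2) -> is_derive x 1 w l.
Proof.
move=> H.
have cv : (fun h => h^-1 *: (w (h *: (1 : R) + x) - w x)) @ 0^' --> l.
  apply/cvgrPdist_le => e e0; near=> h.
  have h0 : h != 0 by near: h; exact: nbhs_dnbhs_neq.
  rewrite /GRing.scale /= mulr1 (addrC h).
  rewrite (_ : l - _ = - (h^-1 * (w (x + h) - w x - h * l))); last by field.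
  rewrite normrN normrM (le_trans (ler_wpM2l _ (H h)))//.
  rewrite -(real_normK (num_real h)) normfV mulrCA expr2 mulKf ?normr_eq0//.
  have : `|h| <= (`|C| + 1)^-1 * e.
    by near: h; apply: dnbhs0_le; rewrite mulr_gt0// invr_gt0 ltr_wpDl.
  rewrite ler_pdivlMl ?ltr_wpDl// => hC.
  have := ler_norm C; have := normr_ge0 h; nra.
apply: DeriveDef; first by apply/cvg_ex; exists l.
exact/cvg_lim.
Unshelve. all: by end_near. Qed.

Lemma continuous_integrable_itv (g : R -> R) (a b : R) : continuous g ->
  lebesgue_measure.-integrable `[a, b] (EFin \o g).
Proof.
move=> cg; apply: continuous_compact_integrable; first exact: segment_compact.
exact: continuous_subspaceT.
Qed.

(** G vanishes to the left of a, hence need not be differentiable at a itself; in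
applications the base point is chosen one unit to the left of the region of interest. *)
Lemma primitive_right (g : R -> R) (a : R) : continuous g ->
  let G x := \int[lebesgue_measure]_(t in `[a, x]) g t in
  forall x : R, a < x -> is_derive x 1 G (g x).
Proof.
move=> cg G x ax.
have [|//|d e] := @continuous_FTC1_closed _ g a x (x + 1) _ (continuous_integrable_itv a (x + 1) cg) ax.
- by rewrite ltrDl.
- exact: cg.
by apply: DeriveDef; [exact: d|rewrite -derive1E; exact: e].
Qed.

Lemma primitive_of_vanishing_left (g : R -> R) (a : R) : continuous g ->
  (forall x, x <= a -> g x = 0) ->
  exists2 G : R -> R, (forall x : R, is_derive x 1 G (g x)) & forall x, x <= a -> G x = 0.
Proof.
move=> cg g0; exists (fun x => \int[lebesgue_measure]_(t in `[a - 1, x]) g t); last first.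
  move=> x xa.
  transitivity (\int[lebesgue_measure]_(t in `[a - 1, x]) (0 : R)).
    apply: eq_Rintegral => t; rewrite inE /= in_itv /= => /andP[_ tx].
    by apply: g0; exact: le_trans tx xa.
  by rewrite Rintegral_cst// mul0r.
move=> x; have [xa|ax] := ltP x a; last first.
  by apply: primitive_right => //; lra.
rewrite (g0 x (ltW xa)); apply: (@near_eq_is_derive _ _ _ (cst 0)).
near=> y; have ya : y <= a by apply: ltW; near: y; exact: lt_nbhsl.
transitivity (\int[lebesgue_measure]_(t in `[a - 1, y]) (0 : R)).
  by rewrite Rintegral_cst// mul0r.
apply: eq_Rintegral => t; rewrite inE /= in_itv /= => /andP[_ ty].
by rewrite g0//; exact: le_trans ty ya.
Unshelve. all: by end_near. Qed.

End C3.

(** * Poisson and exponential kernels *)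

Section kernels.
Context {R : realType}.
Notation mu := (@lebesgue_measure R).
Implicit Types f F : R -> R.

(** Nonnegativity lets the limit of the primitive decide integrability as well. *)
Lemma even_integral f F (l : R) : (forall x, 0 <= f x) -> continuous f ->
  (forall x, f (- x) = f x) -> continuous F ->
  (forall x : R, 0 < x -> is_derive x 1 F (f x)) ->
  F x @[x --> +oo] --> l ->
  L1 f /\ \int[mu]_x f x = 2 * (l - F 0).
Proof.
move=> f0 cf fe cF dF Fl.
have E : (\int[mu]_x (f x)%:E = (2 * (l - F 0))%:E)%E.
  rewrite ge0_symfun_integralT//; last by move=> x /=; rewrite fe.
  rewrite -set_itvcy (@ge0_continuous_FTC2y _ f F 0 l)//.
  - exact: continuous_subspaceT.
  - by move=> x /dF [].
  - by apply: cvg_at_right_filter; exact: cF.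
  - move=> x; rewrite in_itv/= andbT => x0.
    by rewrite derive1E; have [_ ->] := dF _ x0.
split; last by rewrite /Rintegral E.
apply/integrableP; split; first by apply/measurable_EFinP; exact: continuous_measurable_fun.
under eq_integral do rewrite /= ger0_norm//.
by rewrite E ltry.
Qed.

Lemma expR_Nabs_cont (d : R) : continuous (fun x : R => expR (- (d * `|x|))).
Proof.
move=> x; apply: continuous_comp; last exact: continuous_expR.
by apply: cvgN; apply: cvgMl_tmp; exact: norm_continuous.
Qed.

Lemma cvgy_le_div F (l C : R) : (forall x : R, 0 < x -> `|F x - l| <= C / x) ->
  F x @[x --> +oo] --> l.
Proof.
move=> FC; apply/cvgrPdist_le => /= e e0.
near=> x; have x0 : 0 < x by near: x; exact: nbhs_pinfty_gt.
rewrite distrC (le_trans (FC _ x0))// ler_pdivrMr// mulrC -ler_pdivrMr//.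
Unshelve. all: by end_near. Qed.

Lemma expRN_le_inv (x : R) : 0 < x -> expR (- x) <= x^-1.
Proof.
move=> x0; rewrite expRN lef_pV2 ?posrE ?expR_gt0//.
by rewrite (le_trans _ (expR_ge1Dx x))// lerDr.
Qed.

Section poisson.
Variables (d z : R).
Hypothesis d0 : 0 < d.

Let d_neq0 : d != 0. Proof. by rewrite gt_eqF. Qed.
Let dz0 : 0 < d ^+ 2 + z ^+ 2.
Proof. by rewrite ltr_wpDr ?sqr_ge0// exprn_gt0. Qed.
Let dz_neq0 : d ^+ 2 + z ^+ 2 != 0. Proof. by rewrite gt_eqF. Qed.

Lemma expRNabs_integral : L1 (fun x => expR (- (d * `|x|))) /\
  \int[mu]_x expR (- (d * `|x|)) = 2 / d.
Proof.
have [] := @even_integral (fun x => expR (- (d * `|x|)))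
    (fun x => - d^-1 * expR (- (d * x))) 0.
- by move=> x; exact: expR_ge0.
- exact: expR_Nabs_cont.
- by move=> x; rewrite normrN.
- move=> x; apply: differentiable_continuous.
  by apply/derivable1_diffP.
- move=> x x0; rewrite gtr0_norm//; apply: is_derive_eq.
  by rewrite /GRing.scale /=; field.
- apply: (@cvgy_le_div _ _ (d^-1 * d^-1)) => x x0.
  rewrite subr0 normrM normrN (ger0_norm (expR_ge0 _)) gtr0_norm ?invr_gt0//.
  rewrite -mulrA ler_pM2l ?invr_gt0//.
  by rewrite -invfM; apply: expRN_le_inv; exact: mulr_gt0.
move=> ? ->; split => //; rewrite mulr0 oppr0 expR0; field.
exact: d_neq0.
Qed.

(** The integrand changes sign, so the primitive is taken for the nonnegative factor
1 + cos and the exponential integral is subtracted. *)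
Lemma expRNabs_cos_integral : L1 (fun x => expR (- (d * `|x|)) * cos (x * z)) /\
  \int[mu]_x (expR (- (d * `|x|)) * cos (x * z)) = 2 * d / (d ^+ 2 + z ^+ 2).
Proof.
have [i1 e1] := expRNabs_integral.
have [] := @even_integral (fun x => expR (- (d * `|x|)) * (1 + cos (x * z)))
    (fun x => expR (- (d * x)) * (- d^-1 + (z * sin (x * z) - d * cos (x * z)) / (d ^+ 2 + z ^+ 2))) 0.
- by move=> x; rewrite mulr_ge0 ?expR_ge0// -lerBlDl sub0r cos_geN1.
- move=> x; apply: cvgM; first exact: expR_Nabs_cont.
  apply: cvgD; first exact: cvg_cst.
  apply: continuous_comp; last exact: continuous_cos.
  exact: mulrr_continuous.
- by move=> x; rewrite normrN mulNr cosN.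
- move=> x; apply: differentiable_continuous.
  by apply/derivable1_diffP.
- move=> x x0; rewrite gtr0_norm//; apply: is_derive_eq.
  rewrite /GRing.scale /=; field.
  by rewrite d_neq0 dz_neq0.
- apply: (@cvgy_le_div _ _ ((d^-1 + (`|z| + d) / (d ^+ 2 + z ^+ 2)) * d^-1)) => x x0.
  rewrite subr0 normrM mulrC -mulrA.
  rewrite ler_pM ?normr_ge0//.
    rewrite (le_trans (ler_normD _ _))// lerD//.
      by rewrite normrN ger0_norm ?invr_ge0// ltW.
    rewrite normrM (gtr0_norm (x := _^-1)) ?invr_gt0// ler_pM2r ?invr_gt0//.
    rewrite (le_trans (ler_normB _ _))// !normrM (gtr0_norm d0) lerD//.
      by rewrite ler_piMr// ler_norml sin_geN1 sin_le1.
    by rewrite ler_piMr ?(ltW d0)// ler_norml cos_geN1 cos_le1.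
  rewrite (ger0_norm (expR_ge0 _)).
  by rewrite -invfM; apply: expRN_le_inv; exact: mulr_gt0.
move=> i2 e2.
have E x : expR (- (d * `|x|)) * cos (x * z) =
   expR (- (d * `|x|)) * (1 + cos (x * z)) - expR (- (d * `|x|)).
  by rewrite mulrDr mulr1 addrC addKr.
split; first by under eq_fun do rewrite E; exact: L1B.
under eq_Rintegral do rewrite E.
rewrite RintegralB// e1 e2 !(mulr0, mul0r, oppr0, expR0, sin0, cos0).
by field; rewrite d_neq0 dz_neq0.
Qed.

End poisson.

Lemma poisson_integral (d : R) : 0 < d -> L1 (fun x => 2 * d / (d ^+ 2 + x ^+ 2)) /\
  \int[mu]_x (2 * d / (d ^+ 2 + x ^+ 2)) = 2 * pi.
Proof.
move=> d0; have dx x : 0 < d ^+ 2 + x ^+ 2.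
  by rewrite ltr_wpDr ?sqr_ge0// exprn_gt0.
have [] := @even_integral (fun x => 2 * d / (d ^+ 2 + x ^+ 2))
    (fun x => 2 * atan (d^-1 * x)) pi.
- by move=> x; rewrite divr_ge0 ?(ltW (dx _))// mulr_ge0// ltW.
- move=> x; apply: cvgM; first exact: cvg_cst.
  apply: cvgV; first by rewrite gt_eqF.
  apply: cvgD; first exact: cvg_cst.
  exact: exprn_continuous.
- by move=> x; rewrite sqrrN.
- move=> x; apply: cvgM; first exact: cvg_cst.
  apply: continuous_comp; last exact: continuous_atan.
  exact: mulrl_continuous.
- move=> x x0; apply: is_derive_eq.
  rewrite /GRing.scale /=; field.
  by rewrite !gt_eqF//= ltr_wpDr ?sqr_ge0// exprn_gt0.
- rewrite -[X in _ --> X](_ : 2 * (pi / 2) = pi); last by field.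
  apply: cvgM; first exact: cvg_cst.
  suff dy : d^-1 * x @[x --> +oo] --> +oo by apply: cvg_comp; [exact: dy | exact: cvgy_atan].
  apply/cvgryPge => A; near=> x.
  by rewrite mulrC ler_pdivlMr.
by move=> ? ->; rewrite mulr0 atan0 mulr0 subr0.
Unshelve. all: by end_near. Qed.

End kernels.

(** * Reflections of the line *)

Section reflection.
Context {R : realType}.
Notation mu := (@lebesgue_measure R).

Lemma measurable_reflection (x : R) : measurable_fun [set: R] (fun y : R => x - y).
Proof. exact: measurable_funB. Qed.

Definition reflected_measure (x : R) : {measure set (measurableTypeR R) -> \bar R} :=
  @measure_function_pushforward__canonical__measure_function_Measure _ _
    (measurableTypeR R) (measurableTypeR R) R mu (fun y => x - y) (measurable_reflection x).

(** Reflection turns half-open intervals into intervals of the same length open at the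
other end; the measure is determined by these lengths. *)
Lemma lebesgue_measure_reflection (x : R) (A : set (measurableTypeR R)) :
  measurable A -> mu A = pushforward mu (fun y : measurableTypeR R => x - y : measurableTypeR R) A.
Proof.
move=> mA; have := @lebesgue_measure_unique R (reflected_measure x).
apply => // X [[a b] _ <-].
rewrite /=/pushforward [X in mu X = mu _](_ : _ = `]a, b]%classic) //.
have -> : (fun y : R => x - y) @^-1` `]a, b] = `[x - b, x - a[%classic.
  by apply/seteqP; split => y /=; rewrite !in_itv/= => /andP[? ?]; apply/andP; split; lra.
rewrite !lebesgue_measure_itv /= !lte_fin ltrD2l ltrN2.
by case: ifPn => // _; rewrite -!EFinB; congr (_%:E); ring.
Qed.

Lemma integral_reflection (x : R) (f : R -> R) : L1 f ->
  L1 (fun y => f (x - y)) /\ \int[mu]_y f (x - y) = \int[mu]_y f y.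
Proof.
move=> f1.
have mx := measurable_reflection x.
have mf := L1_measurable f1.
have mfx : measurable_fun [set: R] (fun y : R => f (x - y)) by exact: measurableT_comp.
have E (g : measurableTypeR R -> \bar R) :
    (\int[reflected_measure x]_y g y = \int[mu]_y g y)%E.
  symmetry; apply: eq_measure_integral => A mA _.
  exact: lebesgue_measure_reflection.
have f2 : L1 (fun y => f (x - y)).
  apply/integrableP; split; first by apply/measurable_EFinP.
  have : (\int[reflected_measure x]_y `|f y|%:E = \int[mu]_y `|f (x - y)|%:E)%E.
    apply: (@ge0_integral_pushforward _ _ (measurableTypeR R) (measurableTypeR R) R _ mx mu setT (fun y => `|f y|%:E)) => //.
    by apply/measurable_EFinP; exact: measurableT_comp.
  rewrite E => <-.
  by have /integrableP[] := f1.
split => //.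
rewrite /Rintegral; congr fine; rewrite -[RHS]E; symmetry.
have mEf : measurable_fun [set: measurableTypeR R] (EFin \o f) by apply/measurable_EFinP.
exact: (@integral_pushforward _ _ (measurableTypeR R) (measurableTypeR R) R _ mx mu setT _ mEf f2 measurableT).
Qed.
End reflection.

(** * Exchanging integrals against a bounded kernel *)

Section fubini_kernel.
Context {R : realType}.
Notation mu := (@lebesgue_measure R).
Variables (V G : R -> R) (k : R -> R -> R).
Hypotheses (V1 : L1 V) (G1 : L1 G).
Hypothesis mk : measurable_fun [set: R * R] (fun p : R * R => k p.1 p.2).
Hypothesis k1 : forall y x, `|k y x| <= 1.

(* |F| is at most |G x| |V y|, which is integrable on the plane. *)
Let F (p : R * R) : R := G p.1 * (V p.2 * k p.2 p.1).

Let mkl x : measurable_fun [set: R] (fun y : R => k y x).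
Proof. exact: (measurableT_comp (f := fun p : R * R => k p.1 p.2) mk (measurable_fun_pair (@measurable_id _ _ _) (measurable_cst x))). Qed.

Let mkr y : measurable_fun [set: R] (fun x : R => k y x).
Proof. exact: (measurableT_comp (f := fun p : R * R => k p.1 p.2) mk (measurable_fun_pair (measurable_cst y) (@measurable_id _ _ _))). Qed.

Lemma kernel_L1l x : L1 (fun y => V y * k y x).
Proof.
apply: (L1_dominated _ (L1_norm V1)); last first.
  by move=> y; rewrite normrM ler_piMr.
by apply: measurable_funM => //; exact: L1_measurable.
Qed.

Lemma kernel_L1r y : L1 (fun x => G x * k y x).
Proof.
apply: (L1_dominated _ (L1_norm G1)); last first.
  by move=> x; rewrite normrM ler_piMr.
by apply: measurable_funM => //; exact: L1_measurable.
Qed.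

Let mF : measurable_fun [set: R * R] F.
Proof.
apply: measurable_funM.
  by apply: (measurableT_comp (L1_measurable G1)); exact: measurable_fst.
apply: measurable_funM.
  by apply: (measurableT_comp (L1_measurable V1)); exact: measurable_snd.
have sw : measurable_fun [set: R * R] (fun p : R * R => (p.2, p.1)).
  by apply: measurable_fun_pair; [exact: measurable_snd|exact: measurable_fst].
exact: (measurableT_comp mk sw).
Qed.

Let mFr x : measurable_fun [set: R] (fun y : R => F (x, y)).
Proof.
rewrite [X in measurable_fun _ X](_ : _ = (fun y => G x * (V y * k y x))) //.
by apply: measurable_funM => //; exact: L1_measurable (kernel_L1l x).
Qed.

Let iF : (mu \x mu)%E.-integrable setT (EFin \o F).
Proof.
apply/integrable12ltyP; first by apply/measurable_EFinP.
apply: (@le_lt_trans _ _ (\int[mu]_x (`|G x| * \int[mu]_y `|V y|)%:E)%E).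
  apply: ge0_le_integral => //.
  - by move=> x _; apply: integral_ge0.
    have F0 (p : measurableTypeR R * measurableTypeR R) : (0 <= `|F p|%:E)%E by rewrite lee_fin.
    have mFq : measurable_fun [set: measurableTypeR R * measurableTypeR R] (fun p => `|F p|%:E).
      by apply/measurable_EFinP; apply: measurableT_comp.
    exact: (measurable_fun_fubini_tonelli_F (m2 := mu) _ mFq F0).
  - apply/measurable_EFinP; apply: measurable_funM => //.
    by apply: measurableT_comp => //; exact: L1_measurable.
  - move=> x _; rewrite EFinM EFin_int; last exact: L1_norm.
    rewrite -ge0_integralZl//; last first.
      by apply/measurable_EFinP; apply: measurableT_comp => //; exact: L1_measurable.
    apply: ge0_le_integral => //.
    + by apply/measurable_EFinP; apply: measurableT_comp => //; exact: mFr.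
    + by apply/measurable_EFinP; apply: measurable_funM => //; apply: measurableT_comp => //; exact: L1_measurable.
    + move=> y _; rewrite -EFinM lee_fin /F /= normrM ler_wpM2l// normrM ler_piMr//.
have : L1 (fun x => `|G x| * \int[mu]_y `|V y|).
  by under eq_fun do rewrite mulrC; apply: L1Z; exact: L1_norm.
move=> /integrableP[_]; apply: le_lt_trans; apply: ge0_le_integral => //.
- by move=> x _; rewrite lee_fin mulr_ge0// Rintegral_ge0.
- by apply/measurable_EFinP; apply: measurable_funM => //; apply: measurableT_comp => //; exact: L1_measurable.
- by apply/measurable_EFinP; apply: measurableT_comp => //; apply: measurable_funM => //; apply: measurableT_comp => //; exact: L1_measurable.
- by move=> x _ /=; rewrite lee_fin ler_norm.
Qed.

Lemma kernel_FE x :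
  (\int[mu]_y (EFin \o F) (x, y) = (G x * \int[mu]_y (V y * k y x))%:E)%E.
Proof.
rewrite -RintegralZl//; last exact: kernel_L1l.
by rewrite EFin_int//; apply: L1Z; exact: kernel_L1l.
Qed.

Lemma kernel_GE y :
  (\int[mu]_x (EFin \o F) (x, y) = (V y * \int[mu]_x (G x * k y x))%:E)%E.
Proof.
rewrite -RintegralZl//; last exact: kernel_L1r.
rewrite EFin_int//; last by apply: L1Z; exact: kernel_L1r.
by apply: eq_integral => x _ /=; rewrite /F /= mulrCA.
Qed.

Lemma kernel_integrable_l : L1 (fun x => G x * \int[mu]_y (V y * k y x)).
Proof.
have := integrable_fubini_F iF; congr (_.-integrable _ _).
by apply/funext => x; rewrite /fubini_F kernel_FE.
Qed.

Lemma kernel_fubini : \int[mu]_x (G x * \int[mu]_y (V y * k y x)) =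
  \int[mu]_y (V y * \int[mu]_x (G x * k y x)).
Proof.
have := Fubini iF.
under eq_integral do rewrite kernel_FE.
under [X in _ = X]eq_integral do rewrite kernel_GE.
by rewrite /Rintegral => ->.
Qed.

End fubini_kernel.

(** * Fourier inversion by Abel summation *)

Section inversion.
Context {R : realType}.
Notation mu := (@lebesgue_measure R).
Variables (v a b : R -> R).
Hypotheses (cv : continuous v) (v2 : L1 (fun x => v x ^+ 2)).
Hypothesis Fab : is_fourier v a b.

(* v is only square integrable, its truncations are integrable. *)
Let trunc (n : nat) : R -> R := v \_ `[- n%:R, n%:R].

Lemma trunc_L1 n : L1 (trunc n).
Proof.
have : mu.-integrable `[- n%:R, n%:R] (EFin \o v).
  apply: continuous_compact_integrable; first exact: segment_compact.
  exact: continuous_subspaceT.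
move=> /integrable_mkcond => /(_ (measurable_itv _)).
by rewrite restrict_EFin.
Qed.

(* For g = cos, sin: real and imaginary part of e^(i (y - c) xi). *)
Let phase (c : R) (g : R -> R) (y xi : R) : R := g ((y - c) * xi).

Let m_phase c g : continuous g ->
  measurable_fun [set: R * R] (fun p : R * R => phase c g p.1 p.2).
Proof.
move=> cg; apply: (measurableT_comp (continuous_measurable cg)).
apply: measurable_funM; last exact: measurable_snd.
by apply: measurable_funB; [exact: measurable_fst|exact: measurable_cst].
Qed.

Let cos1 c y x : `|phase c cos y x| <= 1.
Proof. by rewrite ler_norml cos_geN1 cos_le1. Qed.
Let sin1 c y x : `|phase c sin y x| <= 1.
Proof. by rewrite ler_norml sin_geN1 sin_le1. Qed.
Let mcos c := m_phase c (@continuous_cos R).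
Let msin c := m_phase c (@continuous_sin R).

Lemma fourier_reE n xi : fourier_re v n xi = \int[mu]_y (trunc n y * phase 0 cos y xi).
Proof.
rewrite /fourier_re Rintegral_mkcond; apply: eq_Rintegral => y _.
by rewrite /trunc /phase !patchE subr0; case: ifP => // _; rewrite mul0r.
Qed.

Lemma fourier_imE n xi : fourier_im v n xi = - \int[mu]_y (trunc n y * phase 0 sin y xi).
Proof.
rewrite /fourier_im Rintegral_mkcond; congr (- _); apply: eq_Rintegral => y _.
by rewrite /trunc /phase !patchE subr0; case: ifP => // _; rewrite mul0r.
Qed.

(** The real part of e^(i x xi) times the truncated transform, with the two phases merged by
the addition formula. *)
Lemma fourier_phase n x xi :
  cos (x * xi) * fourier_re v n xi - sin (x * xi) * fourier_im v n xi =
  \int[mu]_y (trunc n y * phase x cos y xi).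
Proof.
have Lc := kernel_L1l (trunc_L1 n) (mcos 0) (cos1 0) xi.
have Ls := kernel_L1l (trunc_L1 n) (msin 0) (sin1 0) xi.
rewrite fourier_reE fourier_imE mulrN opprK -!RintegralZl// -RintegralD//; try exact: L1Z.
apply: eq_Rintegral => y _; rewrite /phase subr0 mulrBl cosB; ring.
Qed.

(* Measurability of parameter integrals is read off Fubini's theorem, which needs an
integrable weight in xi; the weight e^(-|xi|) is divided out afterwards. *)
Let measurable_param (k : R -> R -> R) n :
  measurable_fun [set: R * R] (fun p : R * R => k p.1 p.2) ->
  (forall y x, `|k y x| <= 1) ->
  measurable_fun [set: R] (fun xi : R => \int[mu]_y (trunc n y * k y xi)).
Proof.
move=> mk k1.
have [G1 _] := expRNabs_integral (@ltr01 R).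
have := L1_measurable (kernel_integrable_l (trunc_L1 n) G1 mk k1).
set g := fun xi => _ => mg.
have -> : (fun xi => \int[mu]_y (trunc n y * k y xi)) = (fun xi => (expR (- (1 * `|xi|)))^-1 * g xi).
  by apply/funext => xi; rewrite /g mulKf// gt_eqF// expR_gt0.
apply: measurable_funM => //; apply: continuous_measurable => x.
by apply: cvgV; [rewrite gt_eqF// expR_gt0|exact: expR_Nabs_cont].
Qed.

Lemma measurable_fourier_re n : measurable_fun [set: R] (fourier_re v n).
Proof.
have := measurable_param n (mcos 0) (cos1 0).
by congr measurable_fun; apply/funext => xi; rewrite fourier_reE.
Qed.

Lemma measurable_fourier_im n : measurable_fun [set: R] (fourier_im v n).
Proof.
have := measurable_funN (measurable_param n (msin 0) (sin1 0)).
by congr measurable_fun; apply/funext => xi; rewrite fourier_imE.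
Qed.

Let ma : measurable_fun setT a. Proof. by have [/Lfun_measurable] := Fab. Qed.
Let mb : measurable_fun setT b. Proof. by have [_ /Lfun_measurable] := Fab. Qed.

Let err n (xi : R) : R := (a xi - fourier_re v n xi) ^+ 2 + (b xi - fourier_im v n xi) ^+ 2.

Let err_small (e : R) : 0 < e -> \forall n \near \oo, L1 (err n) /\ \int[mu]_xi err n xi <= e.
Proof.
move=> e0; have [_ _ cE] := Fab.
have : \forall n \near \oo, (\int[mu]_xi (err n xi)%:E < e%:E)%E.
  exact: cvge0_near_lt cE e0.
apply: filterS => n ltn.
have err1 : L1 (err n).
  apply/integrableP; split.
    apply/measurable_EFinP; apply: measurable_funD; apply: measurable_funX; apply: measurable_funB => //.
    - exact: measurable_fourier_re.
    - exact: measurable_fourier_im.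
  under eq_integral do rewrite /= ger0_norm ?addr_ge0 ?sqr_ge0//.
  by rewrite (lt_trans ltn)// ltry.
by split => //; rewrite -lee_fin EFin_int// ltW.
Qed.

Let kernel_bounded (d c : R) : 0 < d -> forall y,
  0 <= 2 * d / (d ^+ 2 + (y - c) ^+ 2) <= 2 / d.
Proof.
move=> d0 y; have dx : 0 < d ^+ 2 + (y - c) ^+ 2 by rewrite ltr_wpDr ?sqr_ge0// exprn_gt0.
rewrite divr_ge0 ?(ltW dx) ?mulr_ge0 ?(ltW d0)//=.
rewrite ler_pdivrMr// mulrAC ler_pdivlMr// -mulrA ler_pM2l// -expr2.
by rewrite lerDl sqr_ge0.
Qed.

Let kernelN (d c y : R) : 2 * d / (d ^+ 2 + (y - c) ^+ 2) = 2 * d / (d ^+ 2 + (c - y) ^+ 2).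
Proof. by rewrite -(sqrrN (y - c)) opprB. Qed.

Let kernel_L1 (d c : R) : 0 < d -> L1 (fun y => 2 * d / (d ^+ 2 + (y - c) ^+ 2)) /\
  \int[mu]_y (2 * d / (d ^+ 2 + (y - c) ^+ 2)) = 2 * pi.
Proof.
move=> d0; have [p1 p2] := poisson_integral d0.
have [q1 q2] := integral_reflection c p1.
by split; [under eq_fun do rewrite kernelN | under eq_Rintegral do rewrite kernelN; rewrite q2].
Qed.

(* The Poisson kernel k satisfies k^2 <= (2 / d) k, so it is square integrable and |v k| is
at most v^2 + k^2. *)
Let v_kernel_L1 (d c : R) : 0 < d -> L1 (fun y => v y ^+ 2 + 2 / d * (2 * d / (d ^+ 2 + (y - c) ^+ 2))) /\
  forall y, `|v y * (2 * d / (d ^+ 2 + (y - c) ^+ 2))| <= v y ^+ 2 + 2 / d * (2 * d / (d ^+ 2 + (y - c) ^+ 2)).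
Proof.
move=> d0; have [p1 _] := kernel_L1 c d0.
split; first by apply: L1D => //; exact: L1Z.
move=> y; have /andP[k0 k1] := kernel_bounded c d0 y.
set k := 2 * d / _ in k0 k1 *.
have : k * k <= 2 / d * k by rewrite ler_wpM2r.
rewrite ler_norml; have := sqr_ge0 (v y - k); have := sqr_ge0 (v y + k).
by have := sqr_ge0 (v y); have := sqr_ge0 k; rewrite !expr2 => ? ? ? ? ?; apply/andP; split; nra.
Qed.

(** Both sides are limits of the Abel means S n of the truncated transforms.  For the right
side, Fubini's theorem replaces the Abel factor by its transform, the Poisson kernel,
and v_kernel_L1 dominates.  For the left side, the truncated transforms converge to
a + i b in L^2 while the Abel factor is square integrable. *)
Lemma poisson_representation (d x : R) : 0 < d ->
  \int[mu]_xi (expR (- (d * `|xi|)) * (cos (x * xi) * a xi - sin (x * xi) * b xi)) =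
  \int[mu]_y (v y * (2 * d / (d ^+ 2 + (y - x) ^+ 2))).
Proof.
move=> d0.
pose P (y : R) := 2 * d / (d ^+ 2 + (y - x) ^+ 2).
pose G (xi : R) := expR (- (d * `|xi|)).
have [G1 _] := expRNabs_integral d0.
pose S (n : nat) := \int[mu]_xi (G xi * \int[mu]_y (trunc n y * phase x cos y xi)).
have [vP1 vP2] := v_kernel_L1 x d0.
have mP : measurable_fun setT P by apply: L1_measurable; have [] := kernel_L1 x d0.
have SE n : S n = \int[mu]_y (trunc n y * P y).
  rewrite /S (kernel_fubini (trunc_L1 n) G1 (mcos x) (cos1 x)).
  apply: eq_Rintegral => y _; congr (_ * _).
  have [_ E] := expRNabs_cos_integral (y - x) d0; rewrite /P -E.
  by apply: eq_Rintegral => xi _; rewrite /phase [xi * _]mulrC.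
have mtP n : measurable_fun setT (fun y => trunc n y * P y).
  by apply: measurable_funM => //; exact: L1_measurable (trunc_L1 n).
have Sr : S n @[n --> \oo] --> \int[mu]_y (v y * P y).
  have [|||||i1 _ c1] := @dominated_convergence _ _ _ mu setT measurableT
      (fun n y => (trunc n y * P y)%:E) (fun y => (v y * P y)%:E)
      (fun y => (v y ^+ 2 + 2 / d * P y)%:E).
  - by move=> n; apply/measurable_EFinP; exact: mtP.
  - by apply/measurable_EFinP; apply: measurable_funM => //; exact: continuous_measurable.
  - apply: aeW => y _; apply: cvg_EFin; first exact: nearW.
    apply: cvgM; last exact: cvg_cst.
    apply: cvg_near_cst; near=> n.
    rewrite /trunc patchE ifT// inE /= in_itv /= -ler_norml.
    by near: n; exact: nbhs_infty_ger.
  - exact: vP1.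
  - apply: aeW => y n _; rewrite lee_fin /trunc patchE; case: ifP => _ //.
    by rewrite mul0r normr0 (le_trans _ (vP2 y)).
  have -> : S = fun n => fine (\int[mu]_y (trunc n y * P y)%:E)%E by apply/funext.
  apply: fine_cvg; rewrite EFin_int; first exact: c1.
  exact: i1.
have [a2 b2] : L1 (fun xi => a xi ^+ 2) /\ L1 (fun xi => b xi ^+ 2).
  by have [/Lfun2_L1 ? /Lfun2_L1 ? _] := Fab.
have GG (xi : R) : expR (- (2 * d * `|xi|)) = G xi ^+ 2.
  by rewrite /G expr2 -expRD; congr expR; ring.
have GG1 : L1 (fun xi => G xi ^+ 2).
  by under eq_fun do rewrite -GG; have [] := expRNabs_integral (mulr_gt0 (ltr0n R 2) d0).
have G0 xi : 0 <= G xi by exact: expR_ge0.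
have cos1' (t : R) : `|cos t| <= 1 :> R by rewrite ler_norml cos_geN1 cos_le1.
have sin1' (t : R) : `|sin t| <= 1 :> R by rewrite ler_norml sin_geN1 sin_le1.
have mc (g : R -> R) : continuous g -> measurable_fun [set: R] (fun xi : R => g (x * xi)).
  by move=> cg; apply: (measurableT_comp (continuous_measurable cg)); exact: measurable_funM.
have mG : measurable_fun setT G by exact: L1_measurable G1.
pose I (xi : R) := G xi * (cos (x * xi) * a xi - sin (x * xi) * b xi).
(* The free weight l is 1 for integrability and large for convergence. *)
have weighted (l : R) (p q g s c : R) : 0 < l -> 0 <= g -> `|c| <= 1 -> `|s| <= 1 ->
    `|g * (c * p - s * q)| <= l * (p ^+ 2 + q ^+ 2) + l^-1 * g ^+ 2.
  move=> l0 g0 c1 s1.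
  have H : `|g * (c * p - s * q)| <= g * (`|p| + `|q|).
    rewrite normrM ger0_norm// ler_wpM2l// (le_trans (ler_normB _ _))// !normrM.
    by apply: lerD; rewrite ler_piMl.
  apply: (le_trans H).
  rewrite -(real_normK (num_real p)) -(real_normK (num_real q)) -subr_ge0.
  (* Completing the squares in |p| and |q| leaves l^-1 g^2 / 2. *)
  rewrite (_ : _ - _ = l * (`|p| - l^-1 * g / 2) ^+ 2 + l * (`|q| - l^-1 * g / 2) ^+ 2
    + l^-1 * g ^+ 2 / 2); last by field; rewrite gt_eqF.
  have l0' := ltW l0.
  have l0i : 0 <= l^-1 by rewrite invr_ge0.
  have H1 z : 0 <= l * z ^+ 2 by apply: mulr_ge0 => //; exact: sqr_ge0.
  have H2 : 0 <= l^-1 * g ^+ 2 / 2 by rewrite divr_ge0//; apply: mulr_ge0 => //; exact: sqr_ge0.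
  by rewrite addr_ge0// addr_ge0.
have I1 : L1 I.
  apply: (@L1_dominated _ _ (fun xi => 1 * (a xi ^+ 2 + b xi ^+ 2) + 1^-1 * G xi ^+ 2)).
  - apply: measurable_funM => //; apply: measurable_funB; apply: measurable_funM => //.
    + by apply: mc; exact: continuous_cos.
    + by apply: mc; exact: continuous_sin.
  - by apply: L1D; apply: L1Z => //; exact: L1D.
  - by move=> xi; exact: weighted.
have Sl : S n @[n --> \oo] --> \int[mu]_xi I xi.
  pose K := \int[mu]_xi G xi ^+ 2.
  have K0 : 0 <= K by apply: Rintegral_ge0 => xi _; exact: sqr_ge0.
  apply/cvgrPdist_le => /= e e0.
  (* With this l the term l^-1 K is at most e / 2; n then makes l times the error small. *)
  pose l := (2 * K + 1) / e.
  have l0 : 0 < l by rewrite divr_gt0// ltr_wpDl// mulr_ge0.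
  have h0 : 0 < e / (2 * l) by rewrite divr_gt0// mulr_gt0.
  near=> n.
  have [err1 errle] : L1 (err n) /\ \int[mu]_xi err n xi <= e / (2 * l).
    by near: n; exact: err_small.
  have GP1 : L1 (fun xi => G xi * \int[mu]_y (trunc n y * phase x cos y xi)).
    exact: kernel_integrable_l (trunc_L1 n) G1 (mcos x) (cos1 x).
  rewrite /S -RintegralB//.
  apply: (le_trans (@norm_int_le _ _ (fun xi => l * err n xi + l^-1 * G xi ^+ 2) _ _ _)).
  - by apply: measurable_funB; exact: L1_measurable.
  - by apply: L1D; exact: L1Z.
  - move=> xi; rewrite /I -fourier_phase -mulrBr.
    rewrite (_ : _ - _ = cos (x * xi) * (a xi - fourier_re v n xi) - sin (x * xi) * (b xi - fourier_im v n xi)); last by ring.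
    exact: weighted.
  rewrite RintegralD//; try exact: L1Z.
  rewrite !RintegralZl// -/K.
  have : l * (\int[mu]_xi err n xi) <= e / 2.
    by rewrite (le_trans (ler_wpM2l (ltW l0) errle))// invfM mulrCA [l * _]mulrCA divff ?mulr1// gt_eqF.
  have : l^-1 * K <= e / 2.
    rewrite ler_pdivrMl// (_ : l * (e / 2) = K + 2^-1); first lra.
    by rewrite /l; field; rewrite gt_eqF.
  lra.
exact: (cvg_unique _ Sl Sr).
Unshelve. all: by end_near. Qed.

(** Let d tend to 0 in poisson_representation.  Near x the Poisson kernel averages the
continuous function v; at distance r or more it is at most d (1 + r^-2) times the kernel
of width 1, against which v is integrable.  The Abel factor differs from 1 by at most
d |xi|, whence the assumption of a first moment. *)
Lemma fourier_inversion (x : R) :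
  L1 (fun xi => (1 + `|xi|) * (`|a xi| + `|b xi|)) ->
  2 * pi * v x = \int[mu]_xi (cos (x * xi) * a xi - sin (x * xi) * b xi).
Proof.
move=> m1.
pose J (xi : R) := cos (x * xi) * a xi - sin (x * xi) * b xi.
pose C1 := \int[mu]_xi ((1 + `|xi|) * (`|a xi| + `|b xi|)).
have C10 : 0 <= C1.
  by apply: Rintegral_ge0 => xi _; rewrite mulr_ge0// addr_ge0.
have cos1' (t : R) : `|cos t| <= 1 :> R by rewrite ler_norml cos_geN1 cos_le1.
have sin1' (t : R) : `|sin t| <= 1 :> R by rewrite ler_norml sin_geN1 sin_le1.
have mc (g : R -> R) : continuous g -> measurable_fun [set: R] (fun xi : R => g (x * xi)).
  by move=> cg; apply: (measurableT_comp (continuous_measurable cg)); exact: measurable_funM.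
have mJ : measurable_fun setT J.
  apply: measurable_funB; apply: measurable_funM => //.
  - by apply: mc; exact: continuous_cos.
  - by apply: mc; exact: continuous_sin.
have Jle xi : `|J xi| <= `|a xi| + `|b xi|.
  rewrite (le_trans (ler_normB _ _))// !normrM.
  by apply: lerD; rewrite ler_piMl.
have J1 : L1 J.
  apply: L1_dominated m1 _ => // xi; apply: (le_trans (Jle xi)).
  by rewrite ler_peMl// ?addr_ge0// lerDl.
have [p1 p2] := @kernel_L1 1 x ltr01.
have [q1 q2] := @v_kernel_L1 1 x ltr01.
have pi0 : 0 < pi :> R := pi_gt0 R.
have step (e : R) : 0 < e -> `|2 * pi * v x - \int[mu]_xi J xi| <= e.
  move=> e0; pose eta := e / (4 * pi).
  have eta0 : 0 < eta by rewrite divr_gt0// mulr_gt0.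
  have [r r0 rv] : exists2 r : R, 0 < r & forall y, `|x - y| < r -> `|v x - v y| <= eta.
    have /cvgrPdist_le /(_ eta eta0) /nbhs_ballP [r /= r0 H] := @cv x.
    by exists r => // y xy; apply: H.
  have Cr0 : 0 <= 1 + r ^- 2 by rewrite addr_ge0// invr_ge0 sqr_ge0.
  (* Dominates |v y - v x| times the Poisson kernel of width 1. *)
  pose tail (y : R) := v y ^+ 2 + 2 / 1 * (2 * 1 / (1 ^+ 2 + (y - x) ^+ 2)) +
    `|v x| * (2 * 1 / (1 ^+ 2 + (y - x) ^+ 2)).
  have tail1 : L1 tail by apply: L1D => //; exact: L1Z.
  have tail0 y : 0 <= tail y.
    have /andP[? _] := @kernel_bounded 1 x ltr01 y.
    by apply: addr_ge0; [exact: le_trans (normr_ge0 _) (q2 y) | exact: mulr_ge0].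
  pose C2 := (1 + r ^- 2) * \int[mu]_y tail y.
  have C20 : 0 <= C2 by rewrite mulr_ge0// Rintegral_ge0.
  pose d := e / (2 * (C1 + C2 + 1)).
  have d0 : 0 < d by rewrite divr_gt0// mulr_gt0// ltr_wpDl// addr_ge0.
  have [k1 k2] := kernel_L1 x d0.
  have [w1 w2] := v_kernel_L1 x d0.
  pose P (y : R) := 2 * d / (d ^+ 2 + (y - x) ^+ 2).
  have mP : measurable_fun setT P by exact: L1_measurable k1.
  have P0 y : 0 <= P y by have /andP[] := kernel_bounded x d0 y.
  have vP1 : L1 (fun y => v y * P y).
    apply: L1_dominated w1 w2; apply: measurable_funM => //; exact: continuous_measurable.
  have near_part : `|\int[mu]_y (v y * P y) - 2 * pi * v x| <= e / 2 + d * C2.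
    have -> : 2 * pi * v x = \int[mu]_y (v x * P y) by rewrite RintegralZl// k2 mulrC.
    rewrite -RintegralB//; last exact: L1Z.
    have b1 : L1 (fun y => eta * P y + d * (1 + r ^- 2) * tail y).
      by apply: L1D; exact: L1Z.
    apply: (le_trans (norm_int_le _ b1 _)).
    - by apply: measurable_funB; apply: measurable_funM => //; exact: continuous_measurable.
    - move=> y; rewrite -mulrBl normrM (ger0_norm (P0 y)).
      have [yr|yr] := ltP `|x - y| r.
        have H : `|v y - v x| <= eta by rewrite distrC; apply: rv.
        apply: (le_trans (ler_wpM2r (P0 y) H)); rewrite lerDl.
        by rewrite mulr_ge0// mulr_ge0// ltW.
      apply: (@le_trans _ _ (d * (1 + r ^- 2) * tail y)); last first.
        by rewrite lerDr mulr_ge0// ltW.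
      have /andP[Q0 _] := @kernel_bounded 1 x ltr01 y.
      apply: (@le_trans _ _ (`|v y - v x| * (d * (1 + r ^- 2) * (2 * 1 / (1 ^+ 2 + (y - x) ^+ 2))))).
        apply: ler_wpM2l => //.
        have ry : r ^+ 2 <= (y - x) ^+ 2.
          rewrite -(real_normK (num_real (y - x))) distrC.
          by rewrite ler_sqr// ?nnegrE// ltW.
        have yx0 : 0 < (y - x) ^+ 2 by rewrite (lt_le_trans _ ry)// exprn_gt0.
        have rr0 : 0 < r ^+ 2 by rewrite exprn_gt0.
        have H : 1 <= r ^- 2 * (y - x) ^+ 2 by rewrite ler_pdivlMl// mulr1.
        have D0 : 0 < d ^+ 2 + (y - x) ^+ 2 by rewrite ltr_wpDl// sqr_ge0.
        have E0 : 0 < 1 + (y - x) ^+ 2 by rewrite ltr_wpDl.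
        rewrite /P ler_pdivrMr// expr1n mulr1.
        rewrite [leRHS](_ : _ = 2 * d * ((1 + r ^- 2) * (d ^+ 2 + (y - x) ^+ 2) / (1 + (y - x) ^+ 2))); last first.
          by field; rewrite !gt_eqF.
        rewrite ler_peMr//; first by rewrite mulr_ge0// ltW.
        rewrite ler_pdivlMr// mul1r mulrDl mul1r !mulrDr.
        have := sqr_ge0 d; have : 0 <= r ^- 2 by rewrite invr_ge0 ltW.
        by move=> H1 H2; have := mulr_ge0 H1 H2; lra.
      rewrite mulrCA ler_wpM2l//; first by rewrite mulr_ge0// ltW.
      apply: (le_trans (ler_wpM2r Q0 (ler_normB _ _))).
      rewrite mulrDl lerD// (le_trans _ (q2 y))// normrM (ger0_norm Q0).
      exact: lexx.
    rewrite RintegralD//; try exact: L1Z.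
    rewrite (RintegralZl _ _ k1)// (RintegralZl _ _ tail1)// k2 -mulrA -/C2 lerD2r /eta.
    have -> : e / (4 * pi) * (2 * pi) = e / 2 by move: (pi : R) pi0 => p p0; field; rewrite gt_eqF.
    exact: lexx.
  have far_part : `|\int[mu]_xi (expR (- (d * `|xi|)) * J xi) - \int[mu]_xi J xi| <= d * C1.
    have E01 (xi : R) : 0 <= expR (- (d * `|xi|)) <= 1.
      by rewrite expR_ge0 expR_le1 oppr_le0 mulr_ge0// ltW.
    have mE : measurable_fun [set: R] (fun xi : R => expR (- (d * `|xi|))).
      by apply: continuous_measurable; exact: expR_Nabs_cont.
    have EJ1 : L1 (fun xi => expR (- (d * `|xi|)) * J xi).
      apply: (L1_dominated _ (L1_norm J1)); first exact: measurable_funM.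
      move=> xi; have /andP[? ?] := E01 xi.
      by rewrite normrM ger0_norm// ler_piMl.
    rewrite -RintegralB// /C1 -RintegralZl//.
    apply: norm_int_le; [by apply: measurable_funB => //; exact: measurable_funM | exact: L1Z |].
    move=> xi; have /andP[? ?] := E01 xi.
    rewrite /= -{2}[J xi]mul1r -mulrBl normrM distrC [X in X * _]ger0_norm ?subr_ge0//. rewrite mulrA.
    apply: ler_pM => //; first by rewrite subr_ge0.
    have := expR_ge1Dx (- (d * `|xi|)); lra.
  have dC : d * (C1 + C2) <= e / 2.
    rewrite /d mulrAC ler_pdivrMr; last by rewrite mulr_gt0// ltr_wpDl// addr_ge0.
    rewrite -mulrA; apply: ler_wpM2l; first exact: ltW.
    lra.
  have := poisson_representation x d0; rewrite -/P => E.
  rewrite -/(J _) in E.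
  have -> : 2 * pi * v x - \int[mu]_xi J xi = (\int[mu]_xi (expR (- (d * `|xi|)) * J xi) - \int[mu]_xi J xi)
     - (\int[mu]_y (v y * P y) - 2 * pi * v x) by rewrite E; ring.
  apply: (le_trans (ler_normB _ _)); lra.
apply/eqP; rewrite -subr_eq0 -normr_le0; apply/ler_addgt0Pl => e e0.
by rewrite addr0; exact: step.
Qed.

End inversion.

(** * Trigonometric integrals *)

Section trig_integral.
Context {R : realType}.
Notation mu := (@lebesgue_measure R).
Implicit Types p q : R -> R.

Definition trig_integral p q (x : R) : R :=
  \int[mu]_xi (cos (x * xi) * p xi + sin (x * xi) * q xi).

Let integrand p q (x xi : R) : R := cos (x * xi) * p xi + sin (x * xi) * q xi.

Let integrand_le p q x xi : `|integrand p q x xi| <= `|p xi| + `|q xi|.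
Proof.
rewrite (le_trans (ler_normD _ _))// !normrM.
by apply: lerD; rewrite ler_piMl// ler_norml ?cos_geN1 ?cos_le1 ?sin_geN1 ?sin_le1.
Qed.

Let integrand_measurable p q x : measurable_fun setT p -> measurable_fun setT q ->
  measurable_fun setT (integrand p q x).
Proof.
have mc (g : R -> R) : continuous g -> measurable_fun [set: R] (fun xi : R => g (x * xi)).
  by move=> cg; apply: (measurableT_comp (continuous_measurable cg)); exact: measurable_funM.
move=> mp mq; apply: measurable_funD; apply: measurable_funM => //.
- by apply: mc; exact: continuous_cos.
- by apply: mc; exact: continuous_sin.
Qed.

Lemma trig_integral_le p q x : measurable_fun setT p -> measurable_fun setT q ->
  L1 (fun xi => `|p xi| + `|q xi|) ->
  `|trig_integral p q x| <= \int[mu]_xi (`|p xi| + `|q xi|).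
Proof. by move=> mp mq pq1; apply: norm_int_le => //; [exact: (integrand_measurable x mp mq)|exact: (integrand_le p q x)]. Qed.

Lemma is_derive_trig_integral p q (x : R) :
  measurable_fun setT p -> measurable_fun setT q ->
  L1 (fun xi => (1 + `|xi|) * (`|p xi| + `|q xi|)) ->
  is_derive x 1 (trig_integral p q)
    (trig_integral (fun xi => xi * q xi) (fun xi => - (xi * p xi)) x).
Proof.
move=> mp mq pq1.
have mpq : measurable_fun setT (fun xi => `|p xi| + `|q xi|).
  by apply: measurable_funD; exact: measurableT_comp.
have pq0 : L1 (fun xi => `|p xi| + `|q xi|).
  apply: L1_dominated mpq pq1 _ => xi; rewrite ger0_norm ?addr_ge0//.
  by rewrite ler_peMl ?addr_ge0// lerDl.
have D (y xi : R) : is_derive y 1 (fun t => integrand p q t xi)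
    (integrand (fun xi => xi * q xi) (fun xi => - (xi * p xi)) y xi).
  apply: is_derive_eq; rewrite /integrand /GRing.scale /=; ring.
have xI : `]x - 1, x + 1[%classic x by rewrite /= in_itv /=; apply/andP; split; lra.
pose G (xi : R) := (1 + `|xi|) * (`|p xi| + `|q xi|).
have intf (y : R) : `]x - 1, x + 1[%classic y -> mu.-integrable setT (EFin \o integrand p q y).
  by move=> _; apply: L1_dominated pq0 _ => //; exact: integrand_measurable.
have derf (y xi : R) : `]x - 1, x + 1[%classic y -> [set: R] xi -> derivable (integrand p q ^~ xi) y 1.
  by move=> _ _; have [] := D y xi.
have G0 xi : 0 <= G xi by rewrite mulr_ge0// addr_ge0.
have GE (y xi : R) : partial1of2 (integrand p q) y xi = integrand (fun xi => xi * q xi) (fun xi => - (xi * p xi)) y xi.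
  by rewrite partial1of2E; have [_ ->] := D y xi.
have Gub (y xi : R) : `]x - 1, x + 1[%classic y -> [set: R] xi -> `|partial1of2 (integrand p q) y xi| <= G xi.
  move=> _ _; rewrite GE (le_trans (integrand_le _ _ _ _))//.
  by rewrite normrN !normrM -mulrDr addrC ler_wpM2r ?addr_ge0// lerDr.
apply: DeriveDef.
  exact: (derivable_under_integral measurableT xI intf derf G0 pq1 Gub).
rewrite -derive1E (differentiation_under_integral measurableT xI intf derf G0 pq1 Gub).
by apply: eq_Rintegral => xi _; rewrite GE.
Qed.

(** A derivative in x replaces the amplitudes (p, q) by (xi q, - xi p), so the amplitudes of
the j-th derivative add up to |xi|^j (|p| + |q|), at most (1 + |xi|)^3 (|p| + |q|). *)
Lemma trig_integral_C3 p q : measurable_fun setT p -> measurable_fun setT q ->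
  L1 (fun xi => (1 + `|xi|) ^+ 3 * (`|p xi| + `|q xi|)) ->
  C3_bounded (trig_integral p q) (\int[mu]_xi ((1 + `|xi|) ^+ 3 * (`|p xi| + `|q xi|))).
Proof.
move=> mp mq pq3; set K := \int[mu]_xi _.
pose T (p q : R -> R) := (fun xi => xi * q xi, fun xi => - (xi * p xi)).
pose g j := iter j (fun pq => T pq.1 pq.2) (p, q).
have mg j : measurable_fun setT (g j).1 /\ measurable_fun setT (g j).2.
  elim: j => [//|j [m1 m2]]; rewrite /g /= -/(g j); split.
    by apply: measurable_funM.
  by apply: measurable_funN; apply: measurable_funM.
have gE j xi : `|(g j).1 xi| + `|(g j).2 xi| = `|xi| ^+ j * (`|p xi| + `|q xi|).
  elim: j => [|j IH]; first by rewrite mul1r.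
  by rewrite /g /= -/(g j) normrN !normrM -mulrDr addrC IH exprS mulrA.
have gle j xi : (j <= 3)%N -> `|xi| ^+ j <= (1 + `|xi|) ^+ 3.
  move=> j3; apply: (@le_trans _ _ ((1 + `|xi|) ^+ j)).
    by apply: lerXn2r; rewrite ?nnegrE// ?addr_ge0// lerDr.
  by apply: ler_weXn2l => //; rewrite lerDl.
have g1 j : (j <= 3)%N -> L1 (fun xi => `|(g j).1 xi| + `|(g j).2 xi|).
  move=> j3; apply: L1_dominated pq3 _.
    by have [? ?] := mg j; apply: measurable_funD; apply: measurableT_comp.
  move=> xi; rewrite ger0_norm ?addr_ge0// gE ler_wpM2r ?addr_ge0//; exact: gle.
have g1' j : (j < 3)%N -> L1 (fun xi => (1 + `|xi|) * (`|(g j).1 xi| + `|(g j).2 xi|)).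
  move=> j3; have := L1D (g1 j (ltnW j3)) (g1 j.+1 j3).
  congr (_.-integrable _ (EFin \o _)); apply/funext => xi.
  by rewrite !gE exprS; ring.
have gK j x : (j <= 3)%N -> `|trig_integral (g j).1 (g j).2 x| <= K.
  move=> j3; have [? ?] := mg j; apply: (le_trans (trig_integral_le _ _ _ (g1 j j3))) => //.
  apply: le_int => // [|xi]; first exact: g1.
  by rewrite gE ler_wpM2r ?addr_ge0// gle.
have gD j : (j < 3)%N -> forall x : R, is_derive x 1 (trig_integral (g j).1 (g j).2) (trig_integral (g j.+1).1 (g j.+1).2 x).
  by move=> j3 x; have [? ?] := mg j; apply: is_derive_trig_integral => //; exact: g1'.
exists (trig_integral (g 1%N).1 (g 1%N).2), (trig_integral (g 2%N).1 (g 2%N).2), (trig_integral (g 3%N).1 (g 3%N).2).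
split; [exact: gD 0%N isT|exact: gD 1%N isT|exact: gD 2%N isT|move=> x].
by split; [exact: gK 0%N x isT|exact: gK 1%N x isT|exact: gK 2%N x isT|exact: gK 3%N x isT].
Qed.

End trig_integral.

(** * Sobolev embedding *)

Section sobolev.
Context {R : realType}.
Notation mu := (@lebesgue_measure R).

Lemma L1_power_weight (r : R) : 1 < r -> L1 (fun x => (1 + `|x|) `^ (- r)).
Proof.
move=> r1; have r10 : 1 - r != 0 by rewrite subr_eq0 lt_eqF.
have pos (x : R) : 0 < 1 + `|x| by rewrite ltr_wpDr.
have cpow (c : R) : continuous (fun x : R => (1 + `|x|) `^ c).
  move=> x; have -> : (fun x : R => (1 + `|x|) `^ c) = (fun x : R => expR (c * ln (1 + `|x|))).
    by apply/funext => t; rewrite /powR gt_eqF.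
  apply: continuous_comp; last exact: continuous_expR.
  apply: cvgMl_tmp; apply: continuous_comp; last exact: continuous_ln.
  by apply: cvgD; [exact: cvg_cst|exact: norm_continuous].
have [] // := @even_integral _ (fun x => (1 + `|x|) `^ (- r)) (fun x => (1 - r)^-1 * (1 + `|x|) `^ (1 - r)) 0.
- by move=> x; rewrite normrN.
- by move=> x; apply: cvgMl_tmp; exact: cpow.
- move=> x x0.
  apply: (@near_eq_is_derive _ _ _ (fun x : R => (1 - r)^-1 * (1 + x) `^ (1 - r))).
  + near=> y; rewrite gtr0_norm//; near: y; exact: lt_nbhsr.
  + have x10 : 0 < 1 + x by rewrite addr_gt0.
    have P : is_derive (1 + x) 1 (fun y : R => y `^ (1 - r)) ((1 - r) * (1 + x) `^ (1 - r - 1)).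
      exact: is_derive1_powR.
    have A : is_derive x 1 (fun y : R => 1 + y) 1.
      by apply: is_derive_eq; rewrite add0r mulr1.
    have C : is_derive x 1 (fun y : R => (1 + y) `^ (1 - r)) ((1 - r) * (1 + x) `^ (1 - r - 1) * 1).
      exact: (is_derive1_comp P A).
    apply: is_derive_eq; rewrite /GRing.scale /= (gtr0_norm x0).
    by rewrite (_ : 1 - r - 1 = - r); [field|ring].
- rewrite -[X in _ --> X](mulr0 (1 - r)^-1); apply: cvgMl_tmp.
  apply/cvgrPdist_le => /= e e0.
  pose A := (e^-1) `^ ((r - 1)^-1).
  near=> x.
  have Ax : A <= x by [].
  have x0 : 0 < x by [].
  rewrite sub0r normrN ger0_norm ?powR_ge0// -[1 - r]opprB powRN.
  rewrite invf_ple ?posrE ?powR_gt0//.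
  apply: (@le_trans _ _ (A `^ (r - 1))).
    by rewrite /A -powRrM mulVf ?powRr1 ?invr_ge0 ?(ltW e0)// subr_eq0 gt_eqF.
  apply: ge0_ler_powR; rewrite ?nnegrE ?powR_ge0//; first by rewrite subr_ge0 ltW.
  by rewrite (le_trans Ax)// gtr0_norm// lerDr.
Unshelve. all: by end_near. Qed.

Lemma continuous_japanese_powR (s : R) : continuous (fun x : R => (1 + x ^+ 2) `^ s).
Proof.
have pos (x : R) : 0 < 1 + x ^+ 2 by rewrite ltr_wpDr ?sqr_ge0.
move=> x; have -> : (fun x : R => (1 + x ^+ 2) `^ s) = (fun x : R => expR (s * ln (1 + x ^+ 2))).
  by apply/funext => t; rewrite /powR gt_eqF.
apply: continuous_comp; last exact: continuous_expR.
apply: cvgMl_tmp; apply: continuous_comp; last exact: continuous_ln.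
by apply: cvgD; [exact: cvg_cst|exact: exprn_continuous].
Qed.

(** Since (1 + |x|)^2 <= 2 (1 + x^2), the weight is at most a multiple of
(1 + |x|)^-(2 s - 6), and 2 s - 6 > 1. *)
Lemma sobolev_weight_L1 (s : R) : 7 / 2 < s ->
  L1 (fun x => (1 + `|x|) ^+ 6 / (1 + x ^+ 2) `^ s).
Proof.
move=> s72.
have r1 : 1 < 2 * s - 6 by lra.
have pos (x : R) : 0 < 1 + x ^+ 2 by rewrite ltr_wpDr ?sqr_ge0.
apply: (L1_dominated _ (L1Z (2 `^ s) (L1_power_weight r1))).
  apply: measurable_funM.
    by apply: measurable_funX; apply: measurable_funD => //; exact: measurable_normr.
  apply: continuous_measurable => x; apply: cvgV; first by rewrite gt_eqF// powR_gt0.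
  exact: continuous_japanese_powR.
move=> x; set t := 1 + `|x|.
have t0 : 0 < t by rewrite /t ltr_wpDr.
rewrite ger0_norm; last by rewrite divr_ge0 ?powR_ge0// exprn_ge0// ltW.
rewrite ler_pdivrMr ?powR_gt0// mulrAC -powRM// ?(ltW (pos _))//.
have H : t `^ (2 * s) <= (2 * (1 + x ^+ 2)) `^ s.
  rewrite powRrM; apply: ge0_ler_powR; rewrite ?nnegrE ?powR_ge0//.
  - lra.
  - by rewrite mulr_ge0// ltW.
  - rewrite (_ : t `^ 2 = t ^+ 2); last by rewrite -[RHS]powR_mulrn// ltW.
    have := sqr_ge0 (1 - `|x|); rewrite /t => h.
    have -> : x ^+ 2 = `|x| ^+ 2 by rewrite real_normK ?num_real.
    nra.
apply: (le_trans _ (ler_wpM2r (powR_ge0 _ _) H)).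
rewrite -powRD; last by apply/implyP => _; rewrite gt_eqF.
rewrite (_ : 2 * s + - (2 * s - 6) = 6%:R); last by ring.
by rewrite powR_mulrn// ltW.
Qed.

(** Replaces the infimum in the norm by one transform of v. *)
Lemma Hs_norm_lt (s eta : R) (v : R -> R) : 0 < eta -> (Hs_norm s v < eta%:E)%E ->
  exists a b, is_fourier v a b /\
    (\int[mu]_xi (((1 + xi ^+ 2) `^ s * (a xi ^+ 2 + b xi ^+ 2))%:E) < (eta ^+ 2)%:E)%E.
Proof.
move=> eta0; rewrite /Hs_norm; set S := [set _ | _] => H.
have S0 : (0 <= ereal_inf S)%E.
  apply: le_ereal_inf_tmp => _ [a [b [_ ->]]]; apply: integral_ge0 => xi _.
  by rewrite lee_fin mulr_ge0 ?powR_ge0// addr_ge0// sqr_ge0.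
have : (ereal_inf S < (eta ^+ 2)%:E)%E.
  rewrite ltNge; apply/negP => h; move: H; rewrite ltNge => /negP; apply.
  have -> : eta%:E = ((eta ^+ 2)%:E `^ 2^-1)%E.
    by rewrite poweR_EFin powR12_sqrt ?sqr_ge0// sqrtr_sqr gtr0_norm.
  by apply: gt0_ler_poweR => //; rewrite in_itv /= leey andbT// lee_fin sqr_ge0.
move=> /ereal_inf_lt [_ [a [b [ab ->]]] h]; by exists a, b.
Qed.

(** By the Cauchy-Schwarz inequality the transform has absolute moments up to order
three; by fourier_inversion v is a trigonometric integral, and trig_integral_C3 differentiates it.
The bound is linear in the norm, as needed for families that tend to 0. *)
Theorem sobolev_embedding (s : R) : 7 / 2 < s ->
  exists2 A : R, 0 < A & forall v : R -> R, continuous v -> L1 (fun x => v x ^+ 2) ->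
    forall eta, 0 < eta -> (Hs_norm s v < eta%:E)%E -> C3_bounded v (A * eta).
Proof.
move=> s72; have w1 := sobolev_weight_L1 s72.
pose W := \int[mu]_x ((1 + `|x|) ^+ 6 / (1 + x ^+ 2) `^ s).
have W0 : 0 <= W.
  by apply: Rintegral_ge0 => x _; rewrite divr_ge0 ?powR_ge0// exprn_ge0// addr_ge0.
have pi0 : 0 < pi :> R := pi_gt0 R.
exists ((2 * pi)^-1 * (2 * W + 1)).
  by rewrite mulr_gt0// ?invr_gt0 ?mulr_gt0// ltr_wpDl// mulr_ge0.
move=> v cv v2 eta eta0 /(Hs_norm_lt eta0) [a [b [Fab abs]]].
have [/Lfun_measurable ma /Lfun_measurable mb _] := Fab.
pose om (x : R) := (1 + x ^+ 2) `^ s.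
have om0 x : 0 < om x by rewrite powR_gt0// ltr_wpDr ?sqr_ge0.
have mom : measurable_fun setT om by apply: continuous_measurable; exact: continuous_japanese_powR.
pose E (xi : R) := om xi * (a xi ^+ 2 + b xi ^+ 2).
have E0 xi : 0 <= E xi by rewrite mulr_ge0 ?powR_ge0// addr_ge0// sqr_ge0.
have E1 : L1 E.
  apply/integrableP; split.
    by apply/measurable_EFinP; apply: measurable_funM => //; apply: measurable_funD; exact: measurable_funX.
  under eq_integral do rewrite /= ger0_norm//.
  by rewrite (lt_trans abs)// ltry.
have Eint : \int[mu]_xi E xi <= eta ^+ 2 by rewrite -lee_fin EFin_int// ltW.
pose M (xi : R) := (1 + `|xi|) ^+ 3 * (`|a xi| + `|- b xi|).
(* Cauchy-Schwarz in additive form; the weight eta makes both terms of order eta. *)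
have amgm (c o p : R) : 0 < o -> c * `|p| <= eta * (c ^+ 2 / o) + eta^-1 * (o * p ^+ 2).
  move=> o0; rewrite -subr_ge0 -(real_normK (num_real p)).
  rewrite (_ : _ - _ = eta / o * (c - o / eta * `|p| / 2) ^+ 2 + eta^-1 * (o * (`|p| ^+ 2 * (3 / 4)))); last first.
    by field; rewrite !gt_eqF.
  apply: addr_ge0; apply: mulr_ge0; rewrite ?sqr_ge0 ?invr_ge0 ?(ltW eta0)//.
    by rewrite divr_ge0 ?ltW.
  by rewrite mulr_ge0 ?(ltW o0)// mulr_ge0// sqr_ge0.
have Mle xi : `|M xi| <= 2 * eta * ((1 + `|xi|) ^+ 6 / om xi) + eta^-1 * E xi.
  rewrite ger0_norm; last by rewrite mulr_ge0 ?addr_ge0// exprn_ge0// addr_ge0.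
  rewrite /M normrN mulrDr.
  have := amgm ((1 + `|xi|) ^+ 3) (om xi) (a xi) (om0 xi).
  have := amgm ((1 + `|xi|) ^+ 3) (om xi) (b xi) (om0 xi).
  by rewrite -exprM /E; lra.
have bnd1 : L1 (fun xi => 2 * eta * ((1 + `|xi|) ^+ 6 / om xi) + eta^-1 * E xi).
  by apply: L1D; exact: L1Z.
have mM : measurable_fun setT M.
  apply: measurable_funM.
    by apply: measurable_funX; apply: measurable_funD => //; exact: measurable_normr.
  by apply: measurable_funD; apply: measurableT_comp => //; exact: measurable_funN.
have M1 : L1 M by exact: L1_dominated bnd1 Mle.
have Mint : \int[mu]_xi M xi <= (2 * W + 1) * eta.
  apply: (@le_trans _ _ (\int[mu]_xi (2 * eta * ((1 + `|xi|) ^+ 6 / om xi) + eta^-1 * E xi))).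
    by apply: le_int => // xi; exact: le_trans (ler_norm _) (Mle xi).
  rewrite RintegralD//; try exact: L1Z.
  rewrite (RintegralZl _ _ w1)// (RintegralZl _ _ E1)// -/W.
  have : eta^-1 * \int[mu]_xi E xi <= eta.
    by rewrite ler_pdivrMl// -expr2.
  lra.
have [T1 [T2 [T3 [d1 d2 d3 bd]]]] := trig_integral_C3 ma (measurable_funN mb) M1.
have vE x : v x = (2 * pi)^-1 * trig_integral a (fun xi => - b xi) x.
  have m1 : L1 (fun xi => (1 + `|xi|) * (`|a xi| + `|b xi|)).
    apply: L1_dominated M1 _.
      apply: measurable_funM; first by apply: measurable_funD => //; exact: measurable_normr.
      by apply: measurable_funD; exact: measurableT_comp.
    move=> xi; rewrite /M normrN ger0_norm ?mulr_ge0 ?addr_ge0//.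
    rewrite ler_wpM2r ?addr_ge0// -[leLHS]expr1; apply: ler_weXn2l => //.
    by rewrite lerDl.
  have pi20 : 2 * pi != 0 :> R by rewrite gt_eqF// mulr_gt0.
  apply: (mulfI pi20); rewrite mulrA divff// mul1r (fourier_inversion cv v2 Fab x m1).
  by apply: eq_Rintegral => xi _; rewrite mulrN.
have bnd t : `|t| <= \int[mu]_xi M xi -> `|(2 * pi)^-1 * t| <= (2 * pi)^-1 * (2 * W + 1) * eta.
  move=> h; rewrite normrM ger0_norm ?invr_ge0 ?mulr_ge0 ?(ltW pi0)// -mulrA ler_wpM2l//.
    by rewrite invr_ge0 mulr_ge0// ltW.
  exact: le_trans h Mint.
exists (fun x => (2 * pi)^-1 * T1 x), (fun x => (2 * pi)^-1 * T2 x), (fun x => (2 * pi)^-1 * T3 x).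
split.
- move=> x; rewrite (_ : v = fun x => (2 * pi)^-1 * trig_integral a (fun xi => - b xi) x).
    exact: is_deriveZ.
  exact/funext.
- by move=> x; exact: is_deriveZ.
- by move=> x; exact: is_deriveZ.
- by move=> x; have [? ? ? ?] := bd x; split; rewrite ?vE; exact: bnd.
Qed.

End sobolev.

(** * A smooth bump and its antiderivatives *)

Section bump.
Context {R : realType}.
Implicit Types (p q : {poly R}) (x : R).

(** The functions p(1/x) e^(-1/x) for x > 0: a family that contains e^(-1/x) and is closed
under differentiation. *)
Definition flat p x : R := if 0 < x then p.[x^-1] * expR (- x^-1) else 0.

Lemma poly_le_expR p : exists2 C, 0 <= C & forall y, 0 <= y -> `|p.[y]| <= C * expR y.
Proof.
exists (\sum_(i < size p) `|p`_i| * i`!%:R).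
  by apply: sumr_ge0 => i _; rewrite mulr_ge0.
move=> y y0.
rewrite horner_coef (le_trans (ler_norm_sum _ _ _))// mulr_suml.
apply: ler_sum => i _; rewrite normrM -mulrA ler_wpM2l// ger0_norm ?exprn_ge0//.
have [->|i0] := eqVneq (nat_of_ord i) 0%N.
  by rewrite expr0 fact0 mul1r; apply: le_trans (expR_ge1Dx y); rewrite lerDl.
have := expR_ge1Dxn i.-1 y0; rewrite prednK ?lt0n// => h.
have f0 : 0 < i`!%:R :> R by rewrite ltr0n fact_gt0.
rewrite mulrC -ler_pdivrMr//; apply: le_trans h; by rewrite lerDr.
Qed.

(** At the origin the exponential beats the polynomial X^2 p, so flat p is O(x^2). *)
Lemma is_derive_flat p x : is_derive x 1 (flat p) (flat ('X^2 * (p - p^`())) x).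
Proof.
have [x0|x0|->] := ltgtP x 0.
- rewrite {2}/flat ltNge (ltW x0) /=.
  apply: (@near_eq_is_derive _ _ _ (cst 0)).
  by near=> y; rewrite /flat ltNge ifN// negbK; apply: ltW; near: y; exact: lt_nbhsl.
- rewrite {2}/flat x0.
  apply: (@near_eq_is_derive _ _ _ (fun y : R => p.[y^-1] * expR (- y^-1))).
    by near=> y; rewrite /flat ifT//; near: y; exact: lt_nbhsr.
  have xn : x != 0 by rewrite gt_eqF.
  have dV : is_derive x 1 (fun y : R => y^-1) (- x ^- 2).
    apply: DeriveDef; first exact: derivableV.
    by rewrite deriveV// derive_id /GRing.scale /= mulr1.
  have dp : is_derive x 1 (fun y : R => p.[y^-1]) (p^`().[x^-1] * (- x ^- 2)).
    exact: (@is_derive1_comp _ (horner p) (fun y : R => y^-1)).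
  have de : is_derive x 1 (fun y : R => expR (- y^-1)) (expR (- x^-1) * x ^- 2).
    have dN : is_derive x 1 (fun y : R => - y^-1) (x ^- 2).
      by apply: is_derive_eq; rewrite opprK.
    exact: (@is_derive1_comp _ expR (fun y : R => - y^-1)).
  apply: is_derive_eq.
  by rewrite /GRing.scale /= !hornerE /=; field.
- rewrite {2}/flat ltxx.
  have [C C0 HC] := poly_le_expR ('X^2 * p).
  apply: (@is_derive_quadratic _ _ _ C) => d.
  rewrite add0r mulr0 subr0 /flat ltxx subr0.
  case: ifP => d0; last by rewrite normr0 mulr_ge0// sqr_ge0.
  have := HC d^-1; rewrite invr_ge0 (ltW d0) => /(_ isT).
  rewrite !hornerE normrM ger0_norm ?exprn_ge0 ?invr_ge0 ?(ltW d0)// => h.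
  rewrite normrM (ger0_norm (expR_ge0 _)) expRN ler_pdivrMr ?expR_gt0//.
  rewrite exprVn ler_pdivrMl ?exprn_gt0// in h.
  by apply: (le_trans h); rewrite mulrA (mulrC (d ^+ 2)) expr2 mulrA.
Unshelve. all: by end_near. Qed.

(** Each product vanishes outside ]-1, 1[, and derivatives of products are sums of such
products. *)
Inductive flat_sum : (R -> R) -> Prop :=
| flat_prod p q : flat_sum (fun x => flat p (1 + x) * flat q (1 - x))
| flat_add f g : flat_sum f -> flat_sum g -> flat_sum (fun x => f x + g x).

Lemma flatN p x : flat (- p) x = - flat p x.
Proof. by rewrite /flat hornerN; case: ifP => _; rewrite ?mulNr ?oppr0. Qed.

Lemma flat_sum_derive f : flat_sum f ->
  exists2 f' : R -> R, flat_sum f' & forall x : R, is_derive x 1 f (f' x).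
Proof.
elim => [p q|g h _ [g' sg' dg] _ [h' sh' dh]]; last first.
  by exists (fun x => g' x + h' x); [exact: flat_add|move=> x; exact: is_deriveD].
pose D r : {poly R} := 'X^2 * (r - r^`()).
exists (fun x => flat (D p) (1 + x) * flat q (1 - x) + flat p (1 + x) * flat (- D q) (1 - x)).
  by apply: flat_add; exact: flat_prod.
move=> x.
have d1 : is_derive x 1 (fun y : R => 1 + y) 1.
  by apply: is_derive_eq; rewrite ?add0r ?mulr1.
have d2 : is_derive x 1 (fun y : R => 1 - y) (- 1).
  by apply: is_derive_eq; rewrite ?add0r ?mulrN ?mulr1.
have c1 : is_derive x 1 (fun y : R => flat p (1 + y)) (flat (D p) (1 + x) * 1).
  exact: (is_derive1_comp (is_derive_flat p (1 + x)) d1).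
have c2 : is_derive x 1 (fun y : R => flat q (1 - y)) (flat (D q) (1 - x) * - 1).
  exact: (@is_derive1_comp _ (flat q) (fun y : R => 1 - y) x _ _ (is_derive_flat q (1 - x)) d2).
apply: is_derive_eq; rewrite /GRing.scale /= flatN; ring.
Qed.

(** A smooth function is carried together with all of its derivatives. *)
Definition derivation_chain (g : nat -> R -> R) := forall n (x : R), is_derive x 1 (g n) (g n.+1 x).

Lemma flat_sum_chain f : flat_sum f -> exists2 g, g 0%N = f & derivation_chain g.
Proof.
move=> sf.
have /choice[D HD] : forall h, exists k, flat_sum h ->
    flat_sum k /\ forall x : R, is_derive x 1 h (k x).
  move=> h.
  have [sh|nsh] := pselect (flat_sum h); last by exists h.
  by have [k ? ?] := flat_sum_derive sh; exists k.
have si n : flat_sum (iter n D f) by elim: n => //= n /HD [].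
exists (fun n => iter n D f) => // n x.
by have [_] := HD _ (si n); exact.
Qed.

(** The second antiderivative of a normalised bump: a ramp, whose derivative is a smoothed
Heaviside step. *)
Lemma smooth_ramp : exists g : nat -> R -> R, [/\ derivation_chain g,
  forall x, 0 <= g 2%N x, forall x, 1 <= `|x| -> g 2%N x = 0,
  forall x, x <= -1 -> g 1%N x = 0 /\ g 0%N x = 0 & forall x, 1 <= x -> g 1%N x = 1].
Proof.
have [r r0 dr] := flat_sum_chain (flat_prod 1 1).
have r0E x : r 0%N x = flat 1 (1 + x) * flat 1 (1 - x) by rewrite r0.
have flat_ge0 x : 0 <= flat 1 x.
  by rewrite /flat; case: ifP => // _; rewrite hornerC mul1r expR_ge0.
have rp x : 0 <= r 0%N x by rewrite r0E mulr_ge0.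
have rz x : 1 <= `|x| -> r 0%N x = 0.
  rewrite r0E /flat ler_normr => /orP[h|h].
    by rewrite [X in _ * X]ifF ?mulr0// subr_gt0 ltNge h.
  by rewrite [X in X * _]ifF ?mul0r//; apply/negbTE; rewrite -leNgt; lra.
have r00 : 0 < r 0%N 0.
  by rewrite r0E addr0 subr0 /flat ltr01 hornerC mul1r mulr_gt0 ?expR_gt0.
have [G dG G0] : exists2 G : R -> R, (forall x : R, is_derive x 1 G (r 0%N x)) & forall x, x <= -1 -> G x = 0.
  apply: primitive_of_vanishing_left; first exact: is_derive_cont (dr 0%N).
  by move=> x x1; apply: rz; rewrite ler_normr; apply/orP; right; lra.
have Gmono x y : x <= y -> G x <= G y by exact: derive_ge0_nondecreasing.
have G1 x : 1 <= x -> G x = G 1.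
  move=> x1; have [c /andP[c1 _] e] := mvt dG x1.
  by apply/eqP; rewrite -subr_eq0 e rz ?mul0r// ger0_norm// (le_trans _ c1).
have G10 : 0 < G 1.
  rewrite lt_neqAle -[X in X <= _](G0 (-1))// Gmono ?andbT; last by lra.
  apply/eqP => G1z.
  have Gz x : -1 < x < 1 -> G x = 0.
    move=> /andP[x1 x2]; apply/eqP; rewrite eq_le {1}G1z Gmono ?(ltW x2)//=.
    by rewrite -(G0 (-1))// Gmono// ltW.
  have : r 0%N 0 = 0.
    have [_ <-] := dG 0.
    rewrite (@near_eq_derive _ _ _ _ (cst 0)) ?derive_cst//.
    by near=> x; apply: Gz; apply/andP; split; near: x; [apply: lt_nbhsr|apply: lt_nbhsl]; lra.
  by move/eqP; rewrite gt_eqF.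
have [S dS S0] : exists2 S : R -> R, (forall x : R, is_derive x 1 S ((G 1)^-1 * G x)) & forall x, x <= -1 -> S x = 0.
  apply: primitive_of_vanishing_left; last by move=> x /G0 ->; rewrite mulr0.
  by move=> x; apply: cvgMl_tmp; exact: is_derive_cont dG x.
exists (fun n => if n is m.+1 then if m is k.+1 then fun x => (G 1)^-1 * r k x else fun x => (G 1)^-1 * G x else S).
split => /=.
- case => [|[|n]] x; [exact: dS | | ]; exact: is_deriveZ.
- by move=> x; rewrite mulr_ge0// invr_ge0 ltW.
- by move=> x /rz ->; rewrite mulr0.
- by move=> x x1; rewrite (S0 x)// (G0 x)// mulr0.
- by move=> x /G1 ->; rewrite mulVf// gt_eqF.
Unshelve. all: by end_near. Qed.
End bump.

(** * Mollified point evaluations *)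

Section ramps.
Context {R : realType}.
Notation mu := (@lebesgue_measure R).
Implicit Types (g : nat -> R -> R) (x d : R).

Lemma chain_shift g c : derivation_chain g -> derivation_chain (fun n x => g n (x - c)).
Proof.
move=> dg n x.
have d1 : is_derive x 1 (fun y : R => y - c) 1 by apply: is_derive_eq; rewrite ?addr0 ?subr0.
have := @is_derive1_comp _ (g n) (fun y : R => y - c) x _ _ (dg n (x - c)) d1.
by rewrite mulr1.
Qed.

Lemma chain_scale g c : derivation_chain g -> derivation_chain (fun n x => c * g n x).
Proof. by move=> dg n x; have := dg n x => ?; exact: is_deriveZ. Qed.

Lemma chain_add g k : derivation_chain g -> derivation_chain k ->
  derivation_chain (fun n x => g n x + k n x).
Proof. by move=> dg dk n x; have := dg n x; have := dk n x => ? ?; exact: is_deriveD. Qed.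

Lemma chain_sub g k : derivation_chain g -> derivation_chain k ->
  derivation_chain (fun n x => g n x - k n x).
Proof. by move=> dg dk n x; have := dg n x; have := dk n x => ? ?; exact: is_deriveB. Qed.

Lemma chain_sum m (G : nat -> nat -> R -> R) : (forall j, derivation_chain (G j)) ->
  derivation_chain (fun n x => \sum_(j < m) G j n x).
Proof.
move=> dG; elim: m => [|m IH] n x.
  rewrite (_ : (fun _ => _) = cst 0); last by apply/funext => y; rewrite big_ord0.
  by rewrite big_ord0; exact: is_derive_cst.
rewrite (_ : (fun _ => _) = fun x => \sum_(j < m) G j n x + G m n x); last first.
  by apply/funext => y; rewrite big_ord_recr.
by rewrite big_ord_recr; exact: (chain_add IH (dG m)).
Qed.

Lemma chain_derive1n g n : derivation_chain g -> (g 0%N)^`(n)%classic = g n.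
Proof.
move=> dg; elim: n => [//|n IH]; rewrite derive1nS IH.
by apply/funext => x; rewrite derive1E; have [_ ->] := dg n x.
Qed.

Lemma chain_test_function g : derivation_chain g ->
  (exists A, forall x, A < `|x| -> g 0%N x = 0) -> test_function (g 0%N).
Proof.
move=> dg supp; split => // n; split => [k _ x|].
  by rewrite chain_derive1n//; have [] := dg k x.
by rewrite chain_derive1n//; exact: is_derive_cont (dg n).
Qed.

(** At scale d, g 0 is the smoothed ramp, g 1 the smoothed step and g 2 the mollifier. *)
Definition ramp d g := [/\ derivation_chain g,
  forall x, 0 <= g 2%N x, forall x, d <= `|x| -> g 2%N x = 0,
  forall x, x <= - d -> g 1%N x = 0 /\ g 0%N x = 0 &
  forall x, d <= x -> g 1%N x = 1 /\ g 0%N x = g 0%N d + (x - d)].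

Lemma ramp_exists d : 0 < d -> exists g, ramp d g.
Proof.
move=> d0; have [g [dg g2 gz gl gr]] := @smooth_ramp R.
have dn0 : d != 0 by rewrite gt_eqF.
exists (fun n x => d * d^-1 ^+ n * g n (d^-1 * x)).
have chain : derivation_chain (fun n x => d * d^-1 ^+ n * g n (d^-1 * x)).
  move=> n x.
  have d1 : is_derive x 1 (fun y : R => d^-1 * y) d^-1.
    by apply: is_derive_eq; rewrite /GRing.scale /= mulr1.
  have c1 : is_derive x 1 (fun y : R => g n (d^-1 * y)) (g n.+1 (d^-1 * x) * d^-1).
    exact: (@is_derive1_comp _ (g n) (fun y : R => d^-1 * y) x _ _ (dg n (d^-1 * x)) d1).
  apply: is_derive_eq; rewrite /GRing.scale /= exprS; ring.
have r1 x : d <= x -> d * d^-1 ^+ 1 * g 1%N (d^-1 * x) = 1.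
  by move=> dx; rewrite expr1 divff// mul1r gr// ler_pdivlMl// mulr1.
split => //.
- by move=> x; rewrite mulr_ge0// mulr_ge0 ?ltW// exprn_gt0// invr_gt0.
- move=> x dx; rewrite gz ?mulr0// normrM gtr0_norm ?invr_gt0//.
  by rewrite ler_pdivlMl// mulr1.
- move=> x dx; have [|-> ->] := gl (d^-1 * x); last by rewrite !mulr0.
  by rewrite ler_pdivrMl// mulrN1.
- move=> x dx; split; first exact: r1.
  have [c /andP[c1 _] e] := mvt (chain 0%N) dx.
  by move: e; rewrite /= r1// mul1r => <-; rewrite addrC subrK.
Qed.

Lemma ramp_mono d g x y : ramp d g -> x <= y -> g 1%N x <= g 1%N y.
Proof. by move=> [dg g2 _ _ _]; exact: derive_ge0_nondecreasing (dg 1%N) g2. Qed.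

Lemma ramp_step01 d g x : ramp d g -> 0 <= g 1%N x <= 1.
Proof.
move=> rg; have [_ _ _ gl gr] := rg.
have hl : Num.min x (- d) <= - d by rewrite ge_min lexx orbT.
have hr : d <= Num.max x d by rewrite le_max lexx orbT.
have [<- _] := gl _ hl; have [<- _] := gr _ hr.
by rewrite !(ramp_mono rg)// ?ge_min ?le_max lexx.
Qed.

Lemma compact_support_integral (f : R -> R) (a b : R) : continuous f ->
  (forall x, x < a -> f x = 0) -> (forall x, b < x -> f x = 0) ->
  L1 f /\ \int[mu]_x f x = \int[mu]_(x in `[a, b]) f x.
Proof.
move=> cf fa fb.
have E : f \_ `[a, b] = f.
  apply/funext => x; rewrite patchE; case: ifPn => //.
  rewrite notin_setE /= in_itv /= => /negP; rewrite negb_and -!ltNge => /orP[xa|bx].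
    by rewrite fa.
  by rewrite fb.
split; last by rewrite [RHS]Rintegral_mkcond E.
have /integrable_mkcond := continuous_integrable_itv a b cf.
by move=> /(_ (measurable_itv _)); rewrite restrict_EFin E.
Qed.

Lemma mollifier_integral d g y : 0 < d -> ramp d g ->
  L1 (fun x => g 2%N (x - y)) /\ \int[mu]_x g 2%N (x - y) = 1.
Proof.
move=> d0 [dg g2 gz gl gr].
have ch := chain_shift y dg.
have [|||i1 ->] := @compact_support_integral (fun x => g 2%N (x - y)) (y - d) (y + d).
- exact: is_derive_cont (ch 2%N).
- by move=> x xd; rewrite gz// ler_normr; apply/orP; right; lra.
- by move=> x xd; rewrite gz// ler_normr; apply/orP; left; lra.
split => //.
rewrite /Rintegral (@continuous_FTC2 _ (fun x => g 2%N (x - y)) (fun x => g 1%N (x - y)) (y - d) (y + d)).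
- have [|-> _] := gl (y - d - y); first by lra.
  have [|-> _] := gr (y + d - y); first by lra.
  by rewrite oppe0 adde0.
- lra.
- apply: continuous_subspaceT; exact: is_derive_cont (ch 2%N).
- have cg := is_derive_cont (ch 1%N).
  split; first by move=> x _; have [] := ch 1%N x.
    by apply: cvg_at_right_filter; exact: cg.
  by apply: cvg_at_left_filter; exact: cg.
- by move=> x _; rewrite derive1E; have [_ ->] := ch 1%N x.
Qed.

Lemma mollify (beta : R -> R) y (e : R) : continuous beta -> 0 < e ->
  exists2 d0, 0 < d0 & forall d g, 0 < d <= d0 -> ramp d g ->
    L1 (fun x => beta x * g 2%N (x - y)) /\
    `|\int[mu]_x (beta x * g 2%N (x - y)) - beta y| <= e.
Proof.
move=> cb e0.
have /cvgrPdist_le /(_ e e0) /nbhs_ballP [r /= r0 H] := @cb y.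
exists (r / 2); first by rewrite divr_gt0.
move=> d g /andP[d0 dr] rg; have [dg g2 gz gl gr] := rg.
have [m1 mI] := mollifier_integral y d0 rg.
have cg : continuous (fun x => g 2%N (x - y)) := is_derive_cont (chain_shift y dg 2%N).
have [|||i1 _] := @compact_support_integral (fun x => beta x * g 2%N (x - y)) (y - d) (y + d).
- by move=> x; apply: cvgM; [exact: cb|exact: cg].
- by move=> x xd; rewrite gz ?mulr0// ler_normr; apply/orP; right; lra.
- by move=> x xd; rewrite gz ?mulr0// ler_normr; apply/orP; left; lra.
split => //.
rewrite -[X in _ - X]mulr1 -mI -RintegralZl// -RintegralB//; last exact: L1Z.
apply: (@le_trans _ _ (\int[mu]_x (e * g 2%N (x - y)))); last first.
  by rewrite RintegralZl// mI mulr1.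
apply: norm_int_le; last 2 first.
- exact: L1Z.
- move=> x; rewrite -mulrBl normrM (ger0_norm (g2 _)).
  have [xy|xy] := ltP `|x - y| d; last by rewrite gz// !mulr0.
  apply: ler_wpM2r => //; rewrite distrC; apply: H.
  by rewrite /ball /= distrC (lt_le_trans xy)//; lra.
- by apply: measurable_funB; [exact: L1_measurable i1 | apply: measurable_funM => //; exact: L1_measurable m1].
Qed.

(** The threshold for d does not depend on the ramp, so that one ramp serves several sums. *)
Lemma mollify_sum (beta : R -> R) (e : R) m (c y : 'I_m -> R) : continuous beta -> 0 < e ->
  exists2 d0, 0 < d0 & forall d g, 0 < d <= d0 -> ramp d g ->
    L1 (fun x => beta x * \sum_(j < m) c j * g 2%N (x - y j)) /\
    `|\int[mu]_x (beta x * \sum_(j < m) c j * g 2%N (x - y j)) - \sum_(j < m) c j * beta (y j)| <= e.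
Proof.
move=> cb; elim: m c y e => [|m IH] c y e e0.
  exists 1 => // d g _ _.
  have -> : (fun x => beta x * \sum_(j < 0) c j * g 2%N (x - y j)) = cst 0.
    by apply/funext => x; rewrite big_ord0 mulr0.
  split; first exact: integrable0.
  by rewrite Rintegral_cst// mul0r big_ord0 subrr normr0 ltW.
have e20 : 0 < e / 2 by rewrite divr_gt0.
have [d1 d10 H1] := IH (fun j => c (widen_ord (leqnSn m) j)) (fun j => y (widen_ord (leqnSn m) j)) _ e20.
have e30 : 0 < e / (2 * (`|c ord_max| + 1)) by rewrite divr_gt0// mulr_gt0// ltr_wpDl.
have [d2 d20 H2] := mollify (y ord_max) cb e30.
exists (Num.min d1 d2); first by rewrite lt_min d10.
move=> d g; rewrite le_min => /and3P[d0 dd1 dd2] rg.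
have [|i1 h1] := H1 d g _ rg; first by rewrite d0.
have [|i2 h2] := H2 d g _ rg; first by rewrite d0.
have E x : beta x * (\sum_(j < m.+1) c j * g 2%N (x - y j)) =
  beta x * (\sum_(j < m) c (widen_ord (leqnSn m) j) * g 2%N (x - y (widen_ord (leqnSn m) j))) +
   c ord_max * (beta x * g 2%N (x - y ord_max)).
  by rewrite big_ord_recr /= mulrDr; congr (_ + _); rewrite mulrCA.
split; first by under eq_fun do rewrite E; apply: L1D => //; exact: L1Z.
under eq_Rintegral do rewrite E.
rewrite RintegralD//; last exact: L1Z.
rewrite RintegralZl// big_ord_recr /= opprD addrACA -mulrBr.
apply: (le_trans (ler_normD _ _)).
have : `|c ord_max * (\int[mu]_x (beta x * g 2%N (x - y ord_max)) - beta (y ord_max))| <= e / 2.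
  rewrite normrM (le_trans (ler_wpM2l _ h2))//.
  rewrite mulrA ler_pdivrMr ?mulr_gt0 ?ltr_wpDl//; lra.
lra.
Qed.

End ramps.

(** * Variation along lattices of weakly differentiable functions *)

Section lattice.
Context {R : realType}.
Notation mu := (@lebesgue_measure R).
Implicit Types (g : nat -> R -> R) (x d : R).

Lemma telescope_le1 d g (s h x : R) n : ramp d g ->
  \sum_(j < n) (g 1%N (x - (s + j%:R * h)) - g 1%N (x - (s + j.+1%:R * h))) <= 1.
Proof.
move=> rg; rewrite -(big_mkord xpredT (fun j => g 1%N (x - (s + j%:R * h)) - g 1%N (x - (s + j.+1%:R * h)))).
under eq_bigr do rewrite -opprB.
rewrite sumrN telescope_sumr// opprB.
have /andP[_ h1] := ramp_step01 (x - (s + 0%:R * h)) rg.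
have /andP[h2 _] := ramp_step01 (x - (s + n%:R * h)) rg.
lra.
Qed.

(** Far from the lattice all arguments in a cell are on the same side of the transition
zone of a ramp, where it is affine and the step is constant. *)
Lemma lattice_support (s h d x : R) n (j : 'I_n) : 0 <= h ->
  `|s| + n%:R * h + d < `|x| ->
  (forall r, 0 <= r <= h -> x - (s + j%:R * h + r) <= - d) \/
  (forall r, 0 <= r <= h -> d <= x - (s + j%:R * h + r)).
Proof.
move=> h0 xA.
have jn : j%:R * h + h <= n%:R * h.
  by rewrite -[X in _ + X]mul1r -mulrDl ler_wpM2r// natr1 ler_nat.
have j0 : 0 <= j%:R * h by rewrite mulr_ge0.
have [x0|x0] := leP 0 x.
  right => r /andP[r0 rh]; move: xA; rewrite (ger0_norm x0); have := ler_norm s; lra.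
left => r /andP[r0 rh].
move: xA; rewrite (ltr0_norm x0); have := ler_norm (- s); rewrite normrN; lra.
Qed.

Lemma sum_mollified_diff (beta : R -> R) m (c y z : 'I_m -> R) (g : nat -> R -> R) :
  L1 (fun x => beta x * \sum_(j < m) c j * g 2%N (x - y j)) ->
  L1 (fun x => beta x * \sum_(j < m) c j * g 2%N (x - z j)) ->
  \int[mu]_x (beta x * \sum_(j < m) c j * (g 2%N (x - y j) - g 2%N (x - z j))) =
  \int[mu]_x (beta x * \sum_(j < m) c j * g 2%N (x - y j)) -
  \int[mu]_x (beta x * \sum_(j < m) c j * g 2%N (x - z j)).
Proof.
move=> i1 i2; rewrite -RintegralB//; apply: eq_Rintegral => x _.
rewrite -mulrBr; congr (_ * _); rewrite -sumrB.
by apply: eq_bigr => j _; rewrite mulrBr.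
Qed.

(** The test function is a sum of smoothed indicator functions of the intervals between
s + j h and s + j h + t j, with the signs of the increments of beta.  The intervals do not
overlap, so that its values stay in [-1, 1]; its derivative evaluates beta at the ends of
the intervals, up to mollification. *)
Lemma lattice_variation (beta w : R -> R) : continuous beta -> L1 w ->
  weak_derivative beta w -> forall n (s h : R) (t : nat -> R), 0 < h ->
  (forall j, 0 <= t j <= h) ->
  \sum_(j < n) `|beta (s + j%:R * h + t j) - beta (s + j%:R * h)| <= \int[mu]_x `|w x|.
Proof.
move=> cb w1 wd n s h t h0 th.
pose Y (j : 'I_n) := s + j%:R * h; pose Z (j : 'I_n) := s + j%:R * h + t j.
pose eps (j : 'I_n) := Num.sg (beta (Z j) - beta (Y j)).
have eps1 j : `|eps j| <= 1 by rewrite normr_sg; case: (_ != 0).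
apply/ler_addgt0Pr => e e0.
have e20 : 0 < e / 2 by rewrite divr_gt0.
have [d1 d10 H1] := mollify_sum eps Y cb e20.
have [d2 d20 H2] := mollify_sum eps Z cb e20.
pose d := Num.min d1 d2.
have d0 : 0 < d by rewrite lt_min d10.
have [g rg] := ramp_exists d0; have [dg g2 gz gl gr] := rg.
have [|i1 h1] := H1 d g _ rg; first by rewrite d0 ge_min lexx.
have [|i2 h2] := H2 d g _ rg; first by rewrite d0 ge_min lexx orbT.
pose G m x := \sum_(j < n) eps j * (g m.+1 (x - Y j) - g m.+1 (x - Z j)).
have chainG : derivation_chain G.
  have dg1 : derivation_chain (fun m => g m.+1) by move=> m; exact: dg.
  (* chain_sum runs over families indexed by all of nat: extend the signs by 0. *)
  pose K (j : nat) m x := (if insub j is Some k then eps k else 0) *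
    (g m.+1 (x - (s + j%:R * h)) - g m.+1 (x - (s + j%:R * h + t j))).
  have -> : G = fun m x => \sum_(j < n) K j m x.
    by apply/funext => m; apply/funext => x; apply: eq_bigr => j _; rewrite /K valK.
  by apply: chain_sum => j; apply: chain_scale; apply: chain_sub; exact: (chain_shift _ dg1).
have suppG : exists A, forall x, A < `|x| -> G 0%N x = 0.
  exists (`|s| + n%:R * h + d) => x xA; apply: big1 => j _.
  have rt := th j.
  have r0 : 0 <= (0 : R) <= h by rewrite lexx ltW.
  rewrite /Y /Z; have [xl|xr] := lattice_support j (ltW h0) xA.
    have := xl _ r0; rewrite addr0 => xl0.
    by have [-> _] := gl _ (xl _ rt); have [-> _] := gl _ xl0; rewrite subrr mulr0.
  have := xr _ r0; rewrite addr0 => xr0.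
  by have [-> _] := gr _ (xr _ rt); have [-> _] := gr _ xr0; rewrite subrr mulr0.
have tG := chain_test_function chainG suppG.
have := wd _ tG; rewrite -derive1n1 (chain_derive1n 1 chainG) /G => E.
have G1 x : `|G 0%N x| <= 1.
  apply: le_trans (telescope_le1 s h x n rg).
  apply: (le_trans (ler_norm_sum _ _ _)); apply: ler_sum => j _.
  have /andP[t0 t1] := th j.
  have m1 : g 1%N (x - Z j) <= g 1%N (x - Y j).
    by apply: (ramp_mono rg); rewrite /Z /Y; lra.
  have m2 : g 1%N (x - (s + j.+1%:R * h)) <= g 1%N (x - Z j).
    by apply: (ramp_mono rg); rewrite /Z -natr1; lra.
  rewrite normrM (ger0_norm (x := _ - _)) ?subr_ge0//.
  apply: (@le_trans _ _ (1 * (g 1%N (x - Y j) - g 1%N (x - Z j)))).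
    by rewrite ler_wpM2r// subr_ge0.
  by rewrite mul1r lerD2l lerN2.
have wG : `|\int[mu]_x (w x * G 0%N x)| <= \int[mu]_x `|w x|.
  apply: norm_int_le; last 2 first.
  - exact: L1_norm.
  - by move=> x; rewrite normrM ler_piMr.
  - apply: measurable_funM; first exact: L1_measurable.
    exact: continuous_measurable (is_derive_cont (chainG 0%N)).
rewrite (sum_mollified_diff i1 i2) in E.
have S : \sum_(j < n) `|beta (s + j%:R * h + t j) - beta (s + j%:R * h)| =
    \sum_(j < n) eps j * beta (Z j) - \sum_(j < n) eps j * beta (Y j).
  rewrite -sumrB; apply: eq_bigr => j _.
  by rewrite -mulrBr /eps -normrEsg.
rewrite S; move: E h1 h2 wG.
rewrite !ler_norml => E /andP[? ?] /andP[? ?] /andP[? ?].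
rewrite /G in E *; lra.
Qed.

Lemma ramp_difference d g x (r : R) : ramp d g -> 0 <= r ->
  r * g 1%N (x - r) <= g 0%N x - g 0%N (x - r) <= r * g 1%N x.
Proof.
move=> rg r0; have [dg _ _ _ _] := rg.
have [|c /andP[c1 c2] ->] := mvt (a := x - r) (b := x) (dg 0%N); first by lra.
rewrite (_ : x - (x - r) = r); last by ring.
by rewrite (mulrC _ r) !ler_wpM2l//=; apply: (ramp_mono rg).
Qed.

Lemma jordan_integral_le (nu : {charge set (measurableTypeR R) -> \bar R}) P N
    (nuPN : hahn_decomposition nu P N) (f : R -> R) (K : R) : continuous f ->
  (forall x, `|f x| <= K) ->
  `|\int[jordan_pos nuPN]_x f x - \int[jordan_neg nuPN]_x f x| <=
  K * (fine (jordan_pos nuPN setT) + fine (jordan_neg nuPN setT)).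
Proof.
move=> cf fK.
have bound (m : {finite_measure set (measurableTypeR R) -> \bar R}) :
    `|\int[m]_x f x| <= K * fine (m setT).
  have mf : measurable_fun [set: measurableTypeR R] f by exact: continuous_measurable_fun.
  have cK : m.-integrable setT (EFin \o cst K).
    by apply: finite_measure_integrable_cst.
  have fi : m.-integrable setT (EFin \o f).
    apply: le_integrable cK => //; first by apply/measurable_EFinP.
    by move=> x _ /=; rewrite lee_fin (le_trans (fK x))// ler_norm.
  rewrite -Rintegral_cst//; apply: (le_trans (le_normr_Rintegral _ _)) => //.
  apply: le_Rintegral => //; first exact: integrable_norm.
rewrite mulrDr; apply: (le_trans (ler_normB _ _)).
by apply: lerD; exact: bound.
Qed.

(** The test function is a signed sum of smoothed trapezoids, one in each cell, which rise
from s + j h to s + j h + r and fall symmetrically at the other end.  Their height is r,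
and their second derivative evaluates beta at the four corners.  As the trapezoids of
different cells do not overlap, the sum is bounded by r. *)
Lemma lattice_second_variation (beta : R -> R)
    (nu : {charge set (measurableTypeR R) -> \bar R}) : continuous beta ->
  second_derivative_measure beta nu ->
  exists2 M, 0 <= M & forall n (s h r : R), 0 < h -> 0 <= r -> 2 * r <= h ->
  \sum_(j < n) `|beta (s + j%:R * h) + beta (s + j%:R * h + h) -
      beta (s + j%:R * h + r) - beta (s + j%:R * h + (h - r))| <= r * M.
Proof.
move=> cb [P [N [nuPN sd]]].
exists (fine (jordan_pos nuPN setT) + fine (jordan_neg nuPN setT)).
  by rewrite addr_ge0// fine_ge0.
move=> n s h r h0 r0 rh.
pose Y (t : R) (j : 'I_n) := s + j%:R * h + t.
pose delta (j : 'I_n) := beta (s + j%:R * h) + beta (s + j%:R * h + h) -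
      beta (s + j%:R * h + r) - beta (s + j%:R * h + (h - r)).
pose eps (j : 'I_n) := Num.sg (delta j).
have eps1 j : `|eps j| <= 1 by rewrite normr_sg; case: (_ != 0).
apply/ler_addgt0Pr => e e0.
have e40 : 0 < e / 4 by rewrite divr_gt0.
have [d1 d10 H1] := mollify_sum eps (Y 0) cb e40.
have [d2 d20 H2] := mollify_sum eps (Y r) cb e40.
have [d3 d30 H3] := mollify_sum eps (Y (h - r)) cb e40.
have [d4 d40 H4] := mollify_sum eps (Y h) cb e40.
pose d := Num.min (Num.min d1 d2) (Num.min d3 d4).
have d0 : 0 < d by rewrite !lt_min d10 d20 d30.
have [g rg] := ramp_exists d0; have [dg g2 gz gl gr] := rg.
have [|i1 h1] := H1 d g _ rg; first by rewrite d0 !ge_min lexx.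
have [|i2 h2] := H2 d g _ rg; first by rewrite d0 !ge_min lexx !orbT.
have [|i3 h3] := H3 d g _ rg; first by rewrite d0 !ge_min lexx !orbT.
have [|i4 h4] := H4 d g _ rg; first by rewrite d0 !ge_min lexx !orbT.
(* For m = 0 the trapezoid of cell j, for m = 2 its four mollified corners. *)
pose T j m x := (g m (x - Y 0 j) - g m (x - Y r j)) - (g m (x - Y (h - r) j) - g m (x - Y h j)).
pose G m x := \sum_(j < n) eps j * T j m x.
have chainG : derivation_chain G.
  pose y (t : R) (j : nat) := s + j%:R * h + t.
  pose K (j : nat) m x := (if insub j is Some k then eps k else 0) *
    ((g m (x - y 0 j) - g m (x - y r j)) - (g m (x - y (h - r) j) - g m (x - y h j))).
  have -> : G = fun m x => \sum_(j < n) K j m x.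
    by apply/funext => m; apply/funext => x; apply: eq_bigr => j _; rewrite /K valK.
  apply: chain_sum => j; apply: chain_scale.
  by apply: chain_sub; apply: chain_sub; exact: chain_shift.
have suppG : exists A, forall x, A < `|x| -> G 0%N x = 0.
  exists (`|s| + n%:R * h + d) => x xA; apply: big1 => j _.
  have t1 : 0 <= (0 : R) <= h by rewrite lexx ltW.
  have t2 : 0 <= r <= h by rewrite r0; lra.
  have t3 : 0 <= h - r <= h by apply/andP; split; lra.
  have t4 : 0 <= h <= h by rewrite lexx ltW.
  rewrite /T /Y; have [xl|xr] := lattice_support j (ltW h0) xA.
    have [_ ->] := gl _ (xl _ t1); have [_ ->] := gl _ (xl _ t2).
    have [_ ->] := gl _ (xl _ t3); have [_ ->] := gl _ (xl _ t4).
    by rewrite subrr mulr0.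
  have [_ ->] := gr _ (xr _ t1); have [_ ->] := gr _ (xr _ t2).
  have [_ ->] := gr _ (xr _ t3); have [_ ->] := gr _ (xr _ t4).
  by ring.
have tG := chain_test_function chainG suppG.
have := sd _ tG; rewrite (chain_derive1n 2 chainG) => E.
(* Each trapezoid is at most r times the difference of the steps at the ends of its cell, and
these differences telescope. *)
have G1 x : `|G 0%N x| <= r.
  apply: (@le_trans _ _ (r * \sum_(j < n) (g 1%N (x - (s + j%:R * h)) - g 1%N (x - (s + j.+1%:R * h))))); last first.
    by rewrite ler_piMr//; exact: telescope_le1 rg.
  rewrite mulr_sumr.
  apply: (le_trans (ler_norm_sum _ _ _)); apply: ler_sum => j _.
  have := ramp_difference (x - Y 0 j) rg r0.
  have := ramp_difference (x - Y (h - r) j) rg r0.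
  have -> : x - Y 0 j - r = x - Y r j by rewrite /Y; ring.
  have -> : x - Y (h - r) j - r = x - Y h j by rewrite /Y; ring.
  move=> /andP[b1 b2] /andP[a1 a2].
  have m1 : r * g 1%N (x - Y (h - r) j) <= r * g 1%N (x - Y r j).
    by rewrite ler_wpM2l//; apply: (ramp_mono rg); rewrite /Y; lra.
  have -> : s + j%:R * h = Y 0 j by rewrite /Y addr0.
  have -> : s + j.+1%:R * h = Y h j by rewrite /Y -natr1; ring.
  have T0 : 0 <= T j 0%N x by rewrite /T; lra.
  rewrite normrM (ger0_norm T0).
  apply: (@le_trans _ _ (1 * T j 0%N x)); first by rewrite ler_wpM2r.
  rewrite mul1r mulrBr /T; lra.
have nuG := jordan_integral_le nuPN (is_derive_cont (chainG 0%N)) G1.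
have EG : \int[mu]_x (beta x * G 2%N x) =
   (\int[mu]_x (beta x * \sum_(j < n) eps j * g 2%N (x - Y 0 j)) -
    \int[mu]_x (beta x * \sum_(j < n) eps j * g 2%N (x - Y r j))) -
   (\int[mu]_x (beta x * \sum_(j < n) eps j * g 2%N (x - Y (h - r) j)) -
    \int[mu]_x (beta x * \sum_(j < n) eps j * g 2%N (x - Y h j))).
  rewrite -!RintegralB//; try exact: L1B.
  apply: eq_Rintegral => x _; rewrite -!mulrBr; congr (_ * _); rewrite -!sumrB.
  by apply: eq_bigr => j _; rewrite -!mulrBr.
rewrite EG in E.
have S : \sum_(j < n) `|delta j| =
    \sum_(j < n) eps j * beta (Y 0 j) - \sum_(j < n) eps j * beta (Y r j) -
    (\sum_(j < n) eps j * beta (Y (h - r) j) - \sum_(j < n) eps j * beta (Y h j)).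
  rewrite -!sumrB; apply: eq_bigr => j _.
  by rewrite [LHS]normrEsg -/(eps j) -!mulrBr /delta /Y addr0; congr (_ * _); ring.
rewrite [X in X <= _]S; move: E h1 h2 h3 h4 nuG.
rewrite !ler_norml => E /andP[? ?] /andP[? ?] /andP[? ?] /andP[? ?] /andP[? ?].
lra.
Qed.

End lattice.

(** * Discrete bounds for the kernel *)

Section consistency.
Context {R : realType}.
Notation mu := (@lebesgue_measure R).
Implicit Types (beta g : R -> R) (B K s h r : R).

(** All that the analysis of the scheme uses about the kernel: bounds for lattice sums of the
kernel, of its increments and of its second differences, uniform in the position, the
number of cells and the step. *)
Definition lattice_bounds beta B := [/\ continuous beta, L1 beta, 0 <= B &
  [/\ forall n s h, 0 < h <= 1 -> \sum_(j < n) h * `|beta (s + j%:R * h)| <= B,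
     forall n s h t, 0 < h -> 0 <= t <= h ->
       \sum_(j < n) `|beta (s + j%:R * h + t) - beta (s + j%:R * h)| <= B &
     forall n s h r, 0 < h -> 0 <= r -> 2 * r <= h ->
       \sum_(j < n) `|beta (s + j%:R * h) + beta (s + j%:R * h + h) -
         beta (s + j%:R * h + r) - beta (s + j%:R * h + (h - r))| <= r * B]].

Lemma L1_tail g : L1 g -> forall e, 0 < e -> exists A, forall a b, a <= - A -> A <= b ->
  `|\int[mu]_x g x - \int[mu]_(x in `[a, b]) g x| <= e.
Proof.
move=> g1 e e0.
have mg := L1_measurable g1.
have gn1 := L1_norm g1.
pose tr (n : nat) x := (if x \in `[- n%:R, n%:R] then 0 else `|g x|) : R.
have mtr n : measurable_fun [set: R] (tr n).
  have -> : tr n = (fun x => `|g x|) \- (fun x => `|g x|) \_ `[- n%:R, n%:R].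
    by apply/funext => x; rewrite /tr /= patchE; case: ifP => _; rewrite ?subrr ?subr0.
  apply: measurable_funB; first exact: measurableT_comp.
  apply/(measurable_restrictT _ _).1 => //.
  by apply: measurable_funTS; exact: measurableT_comp.
have tr0 n x : 0 <= tr n x by rewrite /tr; case: ifP.
have trle n x : tr n x <= `|g x| by rewrite /tr; case: ifP.
have tr1 n : L1 (tr n).
  by apply: L1_dominated gn1 _ => // x; rewrite ger0_norm.
have tr_cvg : (fun n => \int[mu]_x tr n x) @ \oo --> (0 : R).
  have [|||||i1 _ c1] := @dominated_convergence _ _ _ mu setT measurableT
      (fun n x => (tr n x)%:E) (fun x => 0%E) (fun x => `|g x|%:E).
  - by move=> n; apply/measurable_EFinP; exact: mtr.
  - exact: measurable_cst.
  - apply: aeW => x _; apply: cvg_near_cst; near=> n.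
    rewrite /tr ifT// inE /= in_itv /= -ler_norml.
    by near: n; exact: nbhs_infty_ger.
  - exact: gn1.
  - by apply: aeW => x n _; rewrite lee_fin ger0_norm.
  move: c1; rewrite integral0 => c1; apply: fine_cvg; exact: c1.
have /cvgrPdist_le /(_ _ e0) [n _ /(_ n (leqnn n))] := tr_cvg.
rewrite /= sub0r normrN ger0_norm => [nle|]; last exact: Rintegral_ge0.
exists n%:R => a b an nb.
have gab : L1 (g \_ `[a, b]).
  have : mu.-integrable `[a, b] (EFin \o g) by apply: integrableS g1.
  by move=> /integrable_mkcond => /(_ (measurable_itv _)); rewrite restrict_EFin.
rewrite [X in _ - X]Rintegral_mkcond -RintegralB//.
apply: le_trans nle; apply: norm_int_le => // [|x].
  by apply: measurable_funB => //; exact: L1_measurable gab.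
rewrite patchE /tr; case: ifP => [_|/negbT xab]; first by rewrite subrr normr0; case: ifP.
rewrite subr0; case: ifP => // xn; exfalso; move/negP: xab; apply.
rewrite inE /= in_itv /=; move: xn; rewrite inE /= in_itv /= => /andP[x1 x2].
by rewrite (le_trans an)// (le_trans x2).
Unshelve. all: by end_near. Qed.

(** On every cell the mean of |beta| is attained, so the lattice sum differs from the
integral by at most the variation. *)
Lemma lattice_l1 beta W : continuous beta -> L1 beta ->
  (forall n s h (t : nat -> R), 0 < h -> (forall j, 0 <= t j <= h) ->
  \sum_(j < n) `|beta (s + j%:R * h + t j) - beta (s + j%:R * h)| <= W) ->
  forall n s h, 0 < h <= 1 ->
  \sum_(j < n) h * `|beta (s + j%:R * h)| <= \int[mu]_x `|beta x| + W.
Proof.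
move=> cb b1 var n s h /andP[h0 h1].
have cab : continuous (fun x => `|beta x|).
  by move=> x; apply: continuous_comp; [exact: cb|exact: norm_continuous].
pose F (x : R) := \int[mu]_(t in `[s - 1, x]) `|beta t|.
have dF (x : R) : s - 1 < x -> is_derive x 1 F `|beta x| by exact: primitive_right.
have pick (j : nat) : exists t, 0 <= t <= h /\
    F (s + j.+1%:R * h) - F (s + j%:R * h) = h * `|beta (s + j%:R * h + t)|.
  have j0 : 0 <= j%:R * h by rewrite mulr_ge0// ltW.
  have [||c /andP[c1 c2] e] := @mvt_on _ F (fun x => `|beta x|) (s + j%:R * h) (s + j.+1%:R * h).
  - by move=> x /andP[x1 _]; apply: dF; lra.
  - by rewrite -natr1; lra.
  exists (c - (s + j%:R * h)); split; first by move: c2; rewrite -natr1; lra.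
  rewrite e (_ : s + j%:R * h + _ = c); last by ring.
  by rewrite -natr1; ring.
have [t Ht] := choice pick.
have V := var n s h t h0 (fun j => (Ht j).1).
have F1 : F (s + n%:R * h) - F s <= \int[mu]_x `|beta x|.
  have Fs : 0 <= F s by apply: Rintegral_ge0.
  have Fn : F (s + n%:R * h) <= \int[mu]_x `|beta x|.
    rewrite /F Rintegral_mkcond; apply: le_int; last 1 first.
    - by move=> x; rewrite patchE; case: ifP => //= _; exact: normr_ge0.
    - have : mu.-integrable `[s - 1, s + n%:R * h] (EFin \o (fun x => `|beta x|)).
        by apply: integrableS (L1_norm b1).
      by move=> /integrable_mkcond => /(_ (measurable_itv _)); rewrite restrict_EFin.
    - exact: L1_norm.
  lra.
have tel : F (s + n%:R * h) - F s = \sum_(j < n) h * `|beta (s + j%:R * h + t j)|.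
  rewrite [X in _ - F X](_ : s = s + 0%:R * h); last by rewrite mul0r addr0.
  rewrite -(telescope_sumr (fun j => F (s + j%:R * h)) (leq0n n)) big_mkord.
  by apply: eq_bigr => j _; have [_ ->] := Ht j.
apply: (@le_trans _ _ (\sum_(j < n) h * `|beta (s + j%:R * h + t j)| +
   \sum_(j < n) `|beta (s + j%:R * h + t j) - beta (s + j%:R * h)|)); last first.
  by rewrite -tel lerD.
rewrite -big_split /=; apply: ler_sum => j _.
have := ler_normB (beta (s + j%:R * h + t j)) (beta (s + j%:R * h + t j) - beta (s + j%:R * h)).
rewrite opprB addrCA subrr addr0 => Hb.
have := normr_ge0 (beta (s + j%:R * h + t j) - beta (s + j%:R * h)).
have := ler_wpM2l (ltW h0) Hb; nra.
Qed.

Lemma lattice_bounds_of_weak beta (nu : {charge set (measurableTypeR R) -> \bar R}) :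
  W11 beta -> second_derivative_measure beta nu -> exists B, lattice_bounds beta B.
Proof.
move=> [cb /Lfun1_L1 b1 [w /Lfun1_L1 w1 wd]] snu.
have var := lattice_variation cb w1 wd.
have [M M0 HM] := lattice_second_variation cb snu.
have Hl := lattice_l1 cb b1 var.
have I0 : 0 <= \int[mu]_x `|beta x| by apply: Rintegral_ge0.
have W0 : 0 <= \int[mu]_x `|w x| by apply: Rintegral_ge0.
exists (\int[mu]_x `|beta x| + \int[mu]_x `|w x| + M); split => //.
  by rewrite !addr_ge0.
split.
- by move=> n s h h01; apply: (le_trans (Hl n s h h01)); rewrite lerDl.
- move=> n s h t h0 th; apply: (le_trans (var n s h (fun=> t) h0 (fun=> th))).
  by rewrite -addrA addrCA lerDl addr_ge0.
- move=> n s h r h0 r0 rh; apply: (le_trans (HM n s h r h0 r0 rh)).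
  by rewrite ler_wpM2l// lerDr addr_ge0.
Qed.

End consistency.

(** * Differences and quadrature *)

Section quadrature.
Context {R : realType}.
Notation mu := (@lebesgue_measure R).
Implicit Types (beta g : R -> R) (B K s h r : R).

(** The estimated quantity vanishes for h = 0 and has the derivative
w1 (y + h) + w1 (y - h) - 2 w1 y in h, which is O(h^2). *)
Lemma centered_difference (w w1 w2 w3 : R -> R) K y h : 0 <= h ->
  (forall x : R, is_derive x 1 w (w1 x)) -> (forall x : R, is_derive x 1 w1 (w2 x)) ->
  (forall x : R, is_derive x 1 w2 (w3 x)) -> (forall x, `|w3 x| <= K) ->
  `|w (y + h) - w (y - h) - 2 * h * w1 y| <= 2 * K * h ^+ 3.
Proof.
move=> h0 d0 d1 d2 wK.
pose p (r : R) := w (y + r) - w (y - r) - 2 * r * w1 y.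
have dp (r : R) : is_derive r 1 p (w1 (y + r) + w1 (y - r) - 2 * w1 y).
  have a1 : is_derive r 1 (fun r : R => y + r) 1.
    by apply: is_derive_eq; rewrite ?add0r ?mulr1.
  have a2 : is_derive r 1 (fun r : R => y - r) (- 1).
    by apply: is_derive_eq; rewrite ?add0r ?mulrN ?mulr1.
  have c1 : is_derive r 1 (fun r : R => w (y + r)) (w1 (y + r) * 1).
    exact: (@is_derive1_comp _ w (fun r : R => y + r) r _ _ (d0 _) a1).
  have c2 : is_derive r 1 (fun r : R => w (y - r)) (w1 (y - r) * - 1).
    exact: (@is_derive1_comp _ w (fun r : R => y - r) r _ _ (d0 _) a2).
  apply: is_derive_eq; rewrite /GRing.scale /=; ring.
have [c /andP[c0 ch] e] := mvt dp h0.
have p0 : p 0 = 0 by rewrite /p addr0 !subr0 mulr0 mul0r subrr subr0.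
rewrite -/(p h); move: e; rewrite p0 !subr0 => ->.
have t1 := taylor2 y (y + c) d1 d2 wK.
have t2 := taylor2 y (y - c) d1 d2 wK.
have -> : w1 (y + c) + w1 (y - c) - 2 * w1 y =
  (w1 (y + c) - w1 y - w2 y * (y + c - y)) + (w1 (y - c) - w1 y - w2 y * (y - c - y)).
  by ring.
have K0 : 0 <= K := le_trans (normr_ge0 _) (wK 0).
rewrite normrM (ger0_norm h0) exprSr mulrA; apply: ler_wpM2r => //.
apply: (le_trans (ler_normD _ _)); apply: (le_trans (lerD t1 t2)).
have -> : y + c - y = c by ring.
have -> : y - c - y = - c by ring.
have hc : c ^+ 2 <= h ^+ 2 by rewrite ler_sqr ?nnegrE.
by have := ler_wpM2l K0 hc; rewrite sqrrN; lra.
Qed.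

Lemma summation_by_parts (A W : R -> R) n s h :
  \sum_(j < n) (A (s + j%:R * h + h) - A (s + j%:R * h - h)) * W (s + j%:R * h) =
  - (\sum_(j < n) A (s + j%:R * h) * (W (s + j%:R * h + h) - W (s + j%:R * h - h))) +
  (A (s + n%:R * h) * W (s + n%:R * h - h) + A (s + n%:R * h - h) * W (s + n%:R * h)) -
  (A s * W (s - h) + A (s - h) * W s).
Proof.
elim: n => [|n IH]; first by rewrite !big_ord0 mul0r addr0; ring.
rewrite !big_ord_recr /= IH (_ : s + n.+1%:R * h = s + n%:R * h + h); last first.
  by rewrite -natr1; ring.
by rewrite addrK; ring.
Qed.

Lemma is_derive_big_ord (f df : nat -> R -> R) n (x : R) :
  (forall j, is_derive x 1 (f j) (df j x)) ->
  is_derive x 1 (fun y => \sum_(j < n) f j y) (\sum_(j < n) df j x).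
Proof.
move=> d; elim: n => [|n IH].
  rewrite (_ : (fun _ => _) = cst 0); last by apply/funext => y; rewrite big_ord0.
  by rewrite big_ord0; exact: is_derive_cst.
rewrite (_ : (fun _ => _) = fun y => \sum_(j < n) f j y + f n y); last first.
  by apply/funext => y; rewrite big_ord_recr.
by rewrite big_ord_recr; exact: is_deriveD.
Qed.

(** On a cell the error is the integral of the second difference of radius r over r in
[0, h / 2].  The mean value theorem is applied to the sum over all cells, so that a single
radius r serves for all of them. *)
Lemma trapezoid_rule g n s h D : continuous g -> 0 < h ->
  (forall r, 0 <= r -> 2 * r <= h ->
    `|\sum_(j < n) (g (s + j%:R * h) + g (s + j%:R * h + h) -
        g (s + j%:R * h + r) - g (s + j%:R * h + (h - r)))| <= D) ->
  `|\sum_(j < n) h / 2 * (g (s + j%:R * h) + g (s + j%:R * h + h)) -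
    \int[mu]_(x in `[s, s + n%:R * h]) g x| <= h / 2 * D.
Proof.
move=> cg h0 HD.
pose F (x : R) := \int[mu]_(t in `[s - 1, x]) g t.
have dF (x : R) : s - 1 < x -> is_derive x 1 F (g x) by exact: primitive_right.
pose Y (j : nat) := s + j%:R * h.
have Ys j : s <= Y j by rewrite lerDl mulr_ge0// ltW.
pose f (j : nat) (r : R) := r * (g (Y j) + g (Y j + h)) - (F (Y j + r) - F (Y j)) -
  (F (Y j + h) - F (Y j + (h - r))).
pose df (j : nat) (r : R) := g (Y j) + g (Y j + h) - g (Y j + r) - g (Y j + (h - r)).
have dfj j (r : R) : 0 <= r <= h / 2 -> is_derive r 1 (f j) (df j r).
  move=> /andP[r0 rh].
  have a1 : is_derive r 1 (fun r : R => Y j + r) 1.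
    by apply: is_derive_eq; rewrite ?add0r ?mulr1.
  have a2 : is_derive r 1 (fun r : R => Y j + (h - r)) (- 1).
    by apply: is_derive_eq; rewrite ?add0r ?mulrN ?mulr1.
  have c1 : is_derive r 1 (fun r : R => F (Y j + r)) (g (Y j + r) * 1).
    apply: (@is_derive1_comp _ F (fun r : R => Y j + r) r _ _ _ a1).
    by apply: dF; have := Ys j; lra.
  have c2 : is_derive r 1 (fun r : R => F (Y j + (h - r))) (g (Y j + (h - r)) * - 1).
    apply: (@is_derive1_comp _ F (fun r : R => Y j + (h - r)) r _ _ _ a2).
    by apply: dF; have := Ys j; lra.
  apply: is_derive_eq; rewrite /df /GRing.scale /=; ring.
have h20 : 0 <= h / 2 by rewrite divr_ge0 ?ltW.
have [r rh | c /andP[c0 ch]] := @mvt_on _ (fun r => \sum_(j < n) f j r) (fun r => \sum_(j < n) df j r) 0 (h / 2) _ h20.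
  by apply: is_derive_big_ord => j; exact: dfj.
have -> : \sum_(j < n) f j 0 = 0.
  by apply: big1 => j _; rewrite /f mul0r addr0 subr0; ring.
have -> : \sum_(j < n) f j (h / 2) = \sum_(j < n) h / 2 * (g (Y j) + g (Y j + h)) -
    \sum_(j < n) (F (Y j.+1) - F (Y j)).
  rewrite -sumrB; apply: eq_bigr => j _; rewrite /f.
  have -> : Y j + (h - h / 2) = Y j + h / 2 by field.
  have -> : Y j.+1 = Y j + h by rewrite /Y -natr1; ring.
  ring.
have -> : \sum_(j < n) (F (Y j.+1) - F (Y j)) = \int[mu]_(x in `[s, s + n%:R * h]) g x.
  rewrite -(big_mkord xpredT (fun j => F (Y j.+1) - F (Y j))) telescope_sumr//.
  have gi (a b : R) : mu.-integrable `[a, b] (EFin \o g) by exact: continuous_integrable_itv.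
  have Yn := Ys n.
  rewrite /Y mul0r addr0 /F Rintegral_itvB; last 3 first.
  - exact: gi.
  - rewrite bnd_simp; lra.
  - by rewrite bnd_simp.
  rewrite Rintegral_itv_obnd_cbnd//.
  apply: integrableS (gi s (s + n%:R * h)) => //.
  exact: subset_itv_oc_cc.
rewrite !subr0 => ->.
rewrite normrM (ger0_norm h20) mulrC ler_wpM2l//.
by apply: HD => //; lra.
Qed.

(** Expanding p at the left end y of the cell leaves the second difference of beta, its
increments with a factor of order h, and its values with a factor of order h^2.  Summed
over a lattice, each of the three terms is O(h). *)
Lemma second_difference_product (beta p p1 p2 : R -> R) K (y h r : R) : 0 <= r -> 2 * r <= h ->
  h <= 1 ->
  (forall x : R, is_derive x 1 p (p1 x)) -> (forall x : R, is_derive x 1 p1 (p2 x)) ->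
  (forall x, [/\ `|p x| <= K, `|p1 x| <= K & `|p2 x| <= K]) ->
  `|beta y * p y + beta (y + h) * p (y + h) - beta (y + r) * p (y + r) -
    beta (y + (h - r)) * p (y + (h - r))| <=
  K * `|beta y + beta (y + h) - beta (y + r) - beta (y + (h - r))| +
  K * h * (`|beta (y + h) - beta (y + r)| + `|beta (y + h) - beta (y + (h - r))|) +
  K * h ^+ 2 * (`|beta (y + h)| + `|beta (y + r)| + `|beta (y + (h - r))|).
Proof.
move=> r0 rh h1 d0 d1 bd.
have K0 : 0 <= K by have [h' _ _] := bd 0; exact: le_trans h'.
pose T t := p (y + t) - p y - p1 y * t.
have TK t : 0 <= t <= h -> `|T t| <= K * h ^+ 2.
  move=> /andP[t0 th].
  have := taylor2 y (y + t) d0 d1 (fun x => let: And3 _ _ z := bd x in z).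
  have -> : y + t - y = t by ring.
  move=> /le_trans; apply; rewrite ler_wpM2l// ler_sqr ?nnegrE//; exact: le_trans th.
rewrite (_ : _ - _ = p y * (beta y + beta (y + h) - beta (y + r) - beta (y + (h - r))) +
  p1 y * (r * (beta (y + h) - beta (y + r)) + (h - r) * (beta (y + h) - beta (y + (h - r)))) +
  (beta (y + h) * T h - beta (y + r) * T r - beta (y + (h - r)) * T (h - r))); last first.
  by rewrite /T; ring.
have [pK p1K _] := bd y.
have rr : `|r| <= h by rewrite ger0_norm//; lra.
have hr : `|h - r| <= h by rewrite ger0_norm//; lra.
have h0 : 0 <= h by lra.
apply: (le_trans (ler_normD _ _)); apply: lerD.
  apply: (le_trans (ler_normD _ _)); apply: lerD; first by rewrite normrM ler_wpM2r.
  rewrite normrM -mulrA; apply: ler_pM => //.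
  apply: (le_trans (ler_normD _ _)); rewrite [leRHS]mulrDr !normrM.
  by apply: lerD; rewrite ler_wpM2r.
have b1 : `|beta (y + h) * T h| <= K * h ^+ 2 * `|beta (y + h)|.
  by rewrite normrM mulrC ler_wpM2r// TK// h0 lexx.
have b2 : `|beta (y + r) * T r| <= K * h ^+ 2 * `|beta (y + r)|.
  by rewrite normrM mulrC ler_wpM2r// TK// r0; lra.
have b3 : `|beta (y + (h - r)) * T (h - r)| <= K * h ^+ 2 * `|beta (y + (h - r))|.
  by rewrite normrM mulrC ler_wpM2r// TK//; apply/andP; split; lra.
have := ler_normB (beta (y + h) * T h - beta (y + r) * T r) (beta (y + (h - r)) * T (h - r)).
have := ler_normB (beta (y + h) * T h) (beta (y + r) * T r).
lra.
Qed.

End quadrature.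

(** * Consistency on the infinite lattice *)

Section scheme_consistency.
Context {R : realType}.
Notation mu := (@lebesgue_measure R).
Implicit Types (beta g : R -> R) (B K s h r e : R).

Lemma bounded_sums_vanish (a : nat -> R) B : (forall n, 0 <= a n) ->
  (forall n, \sum_(j < n) a j <= B) ->
  forall e, 0 < e -> exists n0, forall n, (n0 <= n)%N -> a n <= e.
Proof.
move=> a0 aB e e0.
have cs : cvgn (series a).
  apply: nondecreasing_is_cvgn.
    by apply/nondecreasing_seqP => n; rewrite /series /= big_nat_recr //= lerDl.
  by exists B => _ [n _ <-]; rewrite /series /= big_mkord.
have /cvgrPdist_le /(_ e e0) [n0 _ H] := cvg_series_cvg_0 cs.
by exists n0 => n nn0; have := H n nn0; rewrite /= sub0r normrN ger0_norm.
Qed.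

Lemma kernel_decay beta B h e : lattice_bounds beta B -> 0 < h <= 1 -> 0 < e ->
  exists n0, forall n, (n0 <= n)%N -> `|beta (n%:R * h)| <= e /\ `|beta (- (n%:R * h))| <= e.
Proof.
move=> [_ _ _ [B0 _ _]] h01 e0; have /andP[h0 _] := h01.
have he0 : 0 < h * e by rewrite mulr_gt0.
have P := @bounded_sums_vanish (fun j => h * `|beta (j%:R * h)|) B _ _ _ he0.
have [||n1 H1] := P.
- by move=> n; rewrite mulr_ge0// ltW.
- move=> n; apply: le_trans (B0 n 0 h h01).
  by apply: ler_sum => j _; rewrite add0r.
have [||n2 H2] := @bounded_sums_vanish (fun j => h * `|beta (- (j%:R * h))|) B _ _ _ he0.
- by move=> n; rewrite mulr_ge0// ltW.
- move=> n; apply: le_trans (B0 n (h - n%:R * h) h h01).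
  rewrite (reindex_inj rev_ord_inj) /=; apply: ler_sum => j _.
  rewrite natrB//; apply: ler_wpM2l; first exact: ltW.
  by rewrite (_ : - _ = h - n%:R * h + j%:R * h)// -natr1; ring.
exists (maxn n1 n2) => n; rewrite geq_max => /andP[nn1 nn2].
by have := H1 n nn1; have := H2 n nn2; rewrite !ler_pM2l.
Qed.

(** The error splits into the trapezoid error for g = beta w1, the errors of the centered
differences of w, the boundary terms of the summation by parts and the part of the
integral outside the lattice.  The last two vanish as n grows, but at no particular rate,
and are absorbed by e. *)
Lemma scheme_consistency beta B (w w1 w2 w3 : R -> R) K h e : lattice_bounds beta B ->
  (forall x : R, is_derive x 1 w (w1 x)) -> (forall x : R, is_derive x 1 w1 (w2 x)) ->
  (forall x : R, is_derive x 1 w2 (w3 x)) ->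
  (forall x, [/\ `|w x| <= K, `|w1 x| <= K, `|w2 x| <= K & `|w3 x| <= K]) ->
  0 < h <= 1 -> 0 < e -> exists n0, forall n, (n0 <= n)%N ->
  `|\sum_(j < n.*2.+1) (beta (- (n%:R * h) + j%:R * h + h) - beta (- (n%:R * h) + j%:R * h - h)) / 2
       * w (- (n%:R * h) + j%:R * h)
    + \int[mu]_x (beta x * w1 x)| <= 4 * B * K * h ^+ 2 + e.
Proof.
move=> lb d0 d1 d2 bd h01 e0; have [cb b1 B0 [L0 L1' L2]] := lb.
have /andP[h0 h1] := h01.
have K0 : 0 <= K by have [h' _ _ _] := bd 0; exact: le_trans h'.
pose g x := beta x * w1 x.
have cw1 : continuous w1 := is_derive_cont d1.
have cg : continuous g by move=> x; apply: cvgM; [exact: cb|exact: cw1].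
have g1 : L1 g.
  apply: (L1_dominated (continuous_measurable cg) (L1Z K (L1_norm b1))) => x.
  by have [_ ? _ _] := bd x; rewrite normrM mulrC ler_wpM2r.
have e20 : 0 < e / 2 by rewrite divr_gt0.
have [A HA] := L1_tail g1 e20.
pose e' := e / (6 * (K + 1)).
have e'0 : 0 < e' by rewrite divr_gt0// mulr_gt0// ltr_wpDl.
have Ke' : 3 * (K * e') <= e / 2.
  rewrite /e' !mulrA ler_pdivrMr; last by rewrite mulr_gt0// ltr_wpDl.
  lra.
have [n1 H1] := kernel_decay lb h01 e'0.
exists (maxn n1 (Num.truncn (`|A| / h)).+1) => n; rewrite geq_max => /andP[nn1 nA].
have Anh : A <= n%:R * h.
  rewrite (le_trans (ler_norm _))// -ler_pdivrMr//.
  have /andP[_ h'] := truncn_itv (divr_ge0 (normr_ge0 A) (ltW h0)).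
  by rewrite (le_trans (ltW h'))// ler_nat.
set s := - (n%:R * h); set m := n.*2.+1.
have sm : s + m%:R * h = n.+1%:R * h.
  by rewrite /s /m -natr1 -muln2 natrM -[n.+1%:R]natr1; ring.
have [Hn1 Hn2] := H1 n nn1; have [Hn3 Hn4] := H1 n.+1 (leq_trans nn1 (leqnSn n)).
pose Y (j : nat) := s + j%:R * h.
(* Q is the Riemann sum for the integral of beta w1, P / 2 its counterpart with centered
differences of w. *)
pose Q := \sum_(j < m) h * (beta (Y j) * w1 (Y j)).
pose P := \sum_(j < m) beta (Y j) * (w (Y j + h) - w (Y j - h)).
pose bdry := (beta (s + m%:R * h) * w (s + m%:R * h - h) + beta (s + m%:R * h - h) * w (s + m%:R * h)) -
  (beta s * w (s - h) + beta (s - h) * w s).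
have -> : \sum_(j < m) (beta (s + j%:R * h + h) - beta (s + j%:R * h - h)) / 2 * w (s + j%:R * h)
   = 2^-1 * (- P + bdry).
  rewrite /bdry addrA -summation_by_parts mulr_sumr.
  by apply: eq_bigr => j _; ring.
have smh : s + m%:R * h - h = n%:R * h by rewrite sm -natr1; ring.
have sh : s - h = - (n.+1%:R * h) by rewrite /s -natr1; ring.
have bw x y : `|beta x| <= e' -> `|beta x * w y| <= K * e'.
  by move=> hx; have [? _ _ _] := bd y; rewrite normrM mulrC ler_pM.
have bdryE : `|bdry| <= 4 * (K * e').
  rewrite /bdry smh sm sh.
  have := bw (n.+1%:R * h) (n%:R * h) Hn3; have := bw (n%:R * h) (n.+1%:R * h) Hn1.
  have := bw s (- (n.+1%:R * h)) Hn2; have := bw (- (n.+1%:R * h)) s Hn4.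
  rewrite !ler_norml => /andP[? ?] /andP[? ?] /andP[? ?] /andP[? ?].
  by apply/andP; split; lra.
have PQ : `|P / 2 - Q| <= B * K * h ^+ 2.
  rewrite /P /Q mulr_suml -sumrB; apply: (le_trans (ler_norm_sum _ _ _)).
  apply: (@le_trans _ _ (\sum_(j < m) K * h ^+ 2 * (h * `|beta (Y j)|))); last first.
    rewrite -mulr_sumr (_ : B * K * h ^+ 2 = K * h ^+ 2 * B); last by ring.
    apply: ler_wpM2l; first by apply: mulr_ge0 => //; exact: sqr_ge0.
    exact: L0.
  apply: ler_sum => j _.
  have w3K x : `|w3 x| <= K by have [] := bd x.
  have cd := centered_difference (Y j) (ltW h0) d0 d1 d2 w3K.
  have -> : beta (Y j) * (w (Y j + h) - w (Y j - h)) / 2 - h * (beta (Y j) * w1 (Y j)) =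
    beta (Y j) / 2 * (w (Y j + h) - w (Y j - h) - 2 * h * w1 (Y j)) by field.
  rewrite normrM.
  apply: (le_trans (ler_wpM2l (normr_ge0 _) cd)).
  rewrite normrM (ger0_norm (x := 2^-1))// le_eqVlt; apply/orP; left; apply/eqP; by field.
(* Tm and Q differ only in the two end terms. *)
pose Tm := \sum_(j < m) h / 2 * (g (Y j) + g (Y j + h)).
have TQ : Tm - Q = h / 2 * (g (s + m%:R * h) - g s).
  rewrite /Tm /Q -sumrB.
  rewrite [X in _ = _ * (_ - g X)](_ : s = s + 0%:R * h); last by rewrite mul0r addr0.
  rewrite -(telescope_sumr (fun j => g (s + j%:R * h)) (leq0n m)) big_mkord mulr_sumr.
  apply: eq_bigr => k _; rewrite (_ : s + k.+1%:R * h = Y k + h); last by rewrite /Y -natr1; ring.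
  by rewrite -/(Y k) /g; field.
have TE : `|Tm - \int[mu]_(x in `[s, s + m%:R * h]) g x| <= 3 * B * K * h ^+ 2.
  apply: (le_trans (@trapezoid_rule _ g m s h (6 * B * K * h) cg h0 _)); last first.
    by rewrite le_eqVlt; apply/orP; left; apply/eqP; by field.
  move=> r r0 rh.
  apply: (le_trans (ler_norm_sum _ _ _)).
  have sdp y := @second_difference_product _ beta w1 w2 w3 K y h r r0 rh h1 d1 d2
    (fun x => let: And4 _ p q t := bd x in And3 p q t).
  apply: (le_trans (y := \sum_(k < m) (
    K * `|beta (Y k) + beta (Y k + h) - beta (Y k + r) - beta (Y k + (h - r))| +
    K * h * (`|beta (Y k + h) - beta (Y k + r)| + `|beta (Y k + h) - beta (Y k + (h - r))|) +
    K * h ^+ 2 * (`|beta (Y k + h)| + `|beta (Y k + r)| + `|beta (Y k + (h - r))|)))).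
    by apply: ler_sum => k _; exact: (sdp (Y k)).
  rewrite big_split big_split /= -!mulr_sumr !big_split /= /Y.
  have v1 : \sum_(j < m) `|beta (s + j%:R * h + h) - beta (s + j%:R * h + r)| <= B.
    have hr : 0 <= h - r <= h by apply/andP; split; lra.
    apply: le_trans (L1' m (s + r) h (h - r) h0 hr); apply: ler_sum => k _.
    by rewrite (_ : s + k%:R * h + h = s + r + k%:R * h + (h - r)) 1?(_ : s + k%:R * h + r = s + r + k%:R * h)//; ring.
  have v2 : \sum_(j < m) `|beta (s + j%:R * h + h) - beta (s + j%:R * h + (h - r))| <= B.
    have hr : 0 <= r <= h by apply/andP; split; lra.
    apply: le_trans (L1' m (s + (h - r)) h r h0 hr); apply: ler_sum => k _.
    by rewrite (_ : s + k%:R * h + h = s + (h - r) + k%:R * h + r) 1?(_ : s + k%:R * h + (h - r) = s + (h - r) + k%:R * h)//; ring.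
  have v0 t : h * \sum_(j < m) `|beta (s + j%:R * h + t)| <= B.
    rewrite mulr_sumr; apply: le_trans (L0 m (s + t) h h01); apply: ler_sum => k _.
    by rewrite (_ : s + k%:R * h + t = s + t + k%:R * h)//; ring.
  have v3 := L2 m s h r h0 r0 rh.
  have rB : r * B <= h * B by apply: ler_wpM2r => //; lra.
  have Kh0 : 0 <= K * h by rewrite mulr_ge0// ltW.
  have u1 := ler_wpM2l Kh0 v1; have u2 := ler_wpM2l Kh0 v2.
  have u3 := ler_wpM2l Kh0 (v0 h); have u4 := ler_wpM2l Kh0 (v0 r).
  have u5 := ler_wpM2l Kh0 (v0 (h - r)).
  have u6 := ler_wpM2l K0 (le_trans v3 rB).
  rewrite expr2; lra.
have tail : `|\int[mu]_x g x - \int[mu]_(x in `[s, s + m%:R * h]) g x| <= e / 2.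
  apply: HA; first by rewrite lerN2.
  by rewrite sm (le_trans Anh)// ler_wpM2r ?ler_nat// ltW.
have gK x : `|beta x| <= e' -> `|g x| <= K * e'.
  by move=> hx; have [_ ? _ _] := bd x; rewrite /g normrM mulrC ler_pM.
have TQ' : `|Tm - Q| <= K * e'.
  rewrite TQ normrM (ger0_norm (x := h / 2)) ?divr_ge0 ?(ltW h0)//.
  have g2 : `|g (s + m%:R * h) - g s| <= 2 * (K * e').
    apply: (le_trans (ler_normB _ _)).
    have := gK (s + m%:R * h); rewrite sm => /(_ Hn3); have := gK s Hn2; lra.
  apply: (@le_trans _ _ (1 / 2 * (2 * (K * e')))); last lra.
  by apply: ler_pM => //; rewrite ?divr_ge0 ?(ltW h0)// ler_wpM2r.
rewrite -/(g _).
move: bdryE PQ TE tail TQ'; rewrite !ler_norml.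
move=> /andP[? ?] /andP[? ?] /andP[? ?] /andP[? ?] /andP[? ?].
rewrite /g in b1 *; apply/andP; split; lra.
Qed.

End scheme_consistency.

(** * One-sided derivatives and a maximum principle *)

Section increments.
Context {R : realType}.
Implicit Types (f e : R -> R) (T t l a b : R).

Definition has_derivative_in T f t l :=
  d^-1 * (f (t + d) - f t) @[d --> increments T t] --> l.

Lemma incrementsP T t (q : R -> R) l :
  q d @[d --> increments T t] --> l <->
  forall eps, 0 < eps -> exists2 r, 0 < r &
    forall d, d != 0 -> `|d| < r -> 0 <= t + d <= T -> `|l - q d| <= eps.
Proof.
have FF : Filter (increments T t) by exact: within_filter.
split.
  move=> /cvgrPdist_le H eps eps0.
  have /nbhs_ballP [r /= r0 Hr] := H eps eps0.
  exists r => // d d0 dr dT; apply: (Hr d _ d0 dT).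
  by rewrite /ball /= sub0r normrN.
move=> H; apply/cvgrPdist_le => eps eps0; have [r r0 Hr] := H eps eps0.
apply/nbhs_ballP; exists r => //= d; rewrite /ball /= sub0r normrN => dr d0 dT.
exact: Hr.
Qed.

Lemma is_derive_in T f t l : is_derive t 1 f l -> has_derivative_in T f t l.
Proof.
move=> [df dl]; apply/incrementsP => eps eps0.
have : (fun h => h^-1 *: (f (h *: (1 : R) + t) - f t)) @ 0^' --> l.
  by rewrite -dl; exact: df.
move=> /cvgrPdist_le /(_ eps eps0) /nbhs_ballP [r /= r0 Hr].
exists r => // d d0 dr _.
have := Hr d; rewrite /ball /= sub0r normrN => /(_ dr d0).
by rewrite /GRing.scale /= mulr1 (addrC d).
Qed.

(** Only backward increments are used, as at t = T there are no others. *)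
Lemma derivative_in_le T f t l : has_derivative_in T f t l -> 0 < t <= T ->
  (forall d, d < 0 -> 0 <= t + d -> f t <= f (t + d)) -> l <= 0.
Proof.
move=> /incrementsP H /andP[t0 tT] mono.
apply/ler_addgt0Pl => eps eps0; rewrite addr0.
have [r r0 Hr] := H eps eps0.
pose d := - Num.min (r / 2) t.
have d0 : d < 0 by rewrite oppr_lt0 lt_min divr_gt0.
have td : 0 <= t + d by rewrite subr_ge0 ge_min lexx orbT.
have := Hr d; rewrite lt_eqF// td => /(_ isT).
have -> : `|d| < r.
  by rewrite ltr0_norm// opprK; apply: (@le_lt_trans _ _ (r / 2)); [rewrite ge_min lexx | lra].
have -> : t + d <= T by lra.
move=> /(_ isT isT); rewrite ler_norml => /andP[_].
have : d^-1 * (f (t + d) - f t) <= 0.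
  by rewrite mulr_le0_ge0 ?invr_le0 ?(ltW d0)// subr_ge0 mono.
lra.
Qed.

(** Composition with clamp 0 T extends functions from [0, T] to the line, so that continuity
on [0, T] needs no relative topology. *)
Definition clamp a b t : R := Num.max a (Num.min t b).

Lemma clamp_itv a b t : a <= b -> a <= clamp a b t <= b.
Proof. by move=> ab; rewrite /clamp le_max lexx /= ge_max ab ge_min lexx orbT. Qed.

Lemma clamp_id a b t : a <= t <= b -> clamp a b t = t.
Proof. by move=> /andP[t0 tT]; rewrite /clamp min_l// max_r. Qed.

Lemma clamp_lipschitz a b t u : `|clamp a b t - clamp a b u| <= `|t - u|.
Proof.
rewrite /clamp; wlog tu : t u / t <= u.
  by move=> H; have [/H//|/ltW/H] := leP t u; rewrite distrC (distrC t).
have m : Num.max a (Num.min t b) <= Num.max a (Num.min u b).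
  by rewrite ge_max le_max lexx /= le_max le_min !ge_min tu lexx !orbT.
rewrite !ler0_norm ?subr_le0// !opprB.
case: (leP u b) => ?; case: (leP t b) => ?; case: (leP a u) => ?; case: (leP a t) => ?;
  case: (leP a b) => ?; lra.
Qed.

Lemma clamp_continuous T (f : R -> R) :
  (forall t, 0 <= t <= T -> forall eps, 0 < eps -> exists2 r, 0 < r &
    forall t', 0 <= t' <= T -> `|t' - t| < r -> `|f t' - f t| <= eps) ->
  0 <= T -> continuous (fun t => f (clamp 0 T t)).
Proof.
move=> H T0 t; apply/cvgrPdist_le => eps eps0.
have [r r0 Hr] := H _ (clamp_itv t T0) _ eps0.
apply/nbhs_ballP; exists r => //= y; rewrite /ball /= => ty.
rewrite distrC; apply: Hr; first exact: clamp_itv.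
by rewrite distrC (le_lt_trans (clamp_lipschitz _ _ _ _)).
Qed.

Lemma derivative_in_continuous T f (l : R -> R) : 0 <= T ->
  (forall t, 0 <= t <= T -> has_derivative_in T f t (l t)) ->
  continuous (fun t => f (clamp 0 T t)).
Proof.
move=> T0 df; apply: clamp_continuous => // t tT eps eps0.
have /incrementsP /(_ 1 ltr01) [r r0 Hr] := df t tT.
have L0 : 0 < `|l t| + 1 by rewrite ltr_wpDl.
exists (Num.min r (eps / (`|l t| + 1))); first by rewrite lt_min r0 divr_gt0.
move=> t' t'T; rewrite lt_min => /andP[h1 h2].
have [->|ne] := eqVneq t' t; first by rewrite subrr normr0 ltW.
have d0 : t' - t != 0 by rewrite subr_eq0.
have := Hr (t' - t) d0 h1; rewrite (_ : t + (t' - t) = t'); last by ring.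
move=> /(_ t'T) h3.
have : `|(t' - t)^-1 * (f t' - f t)| <= `|l t| + 1.
  have := ler_normB (l t) (l t - (t' - t)^-1 * (f t' - f t)).
  rewrite opprB addrCA subrr addr0; lra.
rewrite normrM normfV ler_pdivrMl ?normr_gt0// => h4; apply: (le_trans h4).
by rewrite -ler_pdivlMr// ltW.
Qed.

(** Let |e_i(t)| e^(-2Lt) be maximal at the index im and the time t0, and A = |e_im(t0)|.  Then
every |e_j(t0)| is at most A, so the slope of |e_im| at t0 is at most L A + delta.  But
|e_im(t)| stays below the barrier A e^(2L(t - t0)) and touches it at t0, so if t0 > 0 its
slope there is at least 2 L A.  Hence A is at most delta / L.  The maximum over i is never
differentiated. *)
Lemma gronwall_max n (e e' : 'I_n -> R -> R) T (L delta : R) : 0 <= T -> 0 < L -> 0 <= delta ->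
  (forall i t, 0 <= t <= T -> has_derivative_in T (e i) t (e' i t)) ->
  (forall i, e i 0 = 0) ->
  (forall i t M, 0 < t <= T -> (forall j, `|e j t| <= M) -> `|e' i t| <= L * M + delta) ->
  forall i t, 0 <= t <= T -> `|e i t| <= delta / L * expR (2 * L * T).
Proof.
move=> T0 L0 delta0 de e0 He.
pose wt t := expR (- (2 * L * t)).
have cG (i : 'I_n) : continuous (fun t => `|e i (clamp 0 T t)| * wt t).
  move=> t; apply: cvgM.
    apply: continuous_comp; last exact: norm_continuous.
    exact: derivative_in_continuous (de i) t.
  apply: (@continuous_comp _ _ _ (fun t : R => - (2 * L * t)) expR); last exact: continuous_expR.
  by apply: cvgN; exact: mulrl_continuous.
have /choice [tm Htm] : forall i, exists c, 0 <= c <= T /\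
    forall t, 0 <= t <= T -> `|e i t| * wt t <= `|e i c| * wt c.
  move=> i; have [c cT Hc] := EVT_max T0 (continuous_subspaceT (cG i)).
  move: cT; rewrite in_itv /= => cT; exists c; split => // t tT.
  by have := Hc t; rewrite in_itv /= tT !clamp_id// => /(_ isT).
move=> i0 t tT.
pose im := [arg max_(i > i0) (`|e i (tm i)| * wt (tm i))%O]%O.
have Him i s : 0 <= s <= T -> `|e i s| * wt s <= `|e im (tm im)| * wt (tm im).
  move=> sT; have [_ H] := Htm i; apply: (le_trans (H s sT)).
  by rewrite /im; case: arg_maxP => // j _ Hj; exact: Hj.
set t0 := tm im in Him *; have [t0T _] := Htm im; rewrite -/t0 in t0T.
have wt0 s : 0 < wt s by exact: expR_gt0.
pose A := `|e im t0|.
have wtE s u : wt s / wt u = expR (2 * L * (u - s)).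
  by rewrite /wt -expRN -expRD; congr expR; ring.
have A_le : A <= delta / L.
  have [t00|t00] := eqVneq t0 0.
    by rewrite /A t00 e0 normr0 divr_ge0// ltW.
  have t0p : 0 < t0 <= T.
    by move: t0T => /andP[h1 ->]; rewrite lt_neqAle eq_sym t00 h1.
  have Aj j : `|e j t0| <= A.
    by have := Him j t0 t0T; rewrite ler_pM2r.
  have slope := He im t0 A t0p Aj.
  (* sg * e im is differentiable, in contrast to |e im|. *)
  pose sg : R := if 0 <= e im t0 then 1 else -1.
  have sgA : sg * e im t0 = A.
    rewrite /sg /A; case: ifPn => [h|]; first by rewrite mul1r ger0_norm.
    by rewrite -ltNge => /ltr0_norm ->; rewrite mulN1r.
  have sg1 : `|sg| = 1 by rewrite /sg; case: ifP; rewrite ?normrN1 ?normr1.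
  pose barrier s := A * expR (2 * L * (s - t0)) - sg * e im s.
  have db : has_derivative_in T barrier t0 (2 * L * A - sg * e' im t0).
    have dx : is_derive t0 1 (fun s => A * expR (2 * L * (s - t0))) (2 * L * A).
      have dl : is_derive t0 1 (fun s : R => 2 * L * (s - t0)) (2 * L).
        by apply: is_derive_eq; rewrite /GRing.scale /= subr0; ring.
      have dc := @is_derive1_comp _ expR (fun s : R => 2 * L * (s - t0)) t0 _ _ (is_derive_expR _) dl.
      rewrite subrr mulr0 expR0 mul1r in dc.
      by apply: is_derive_eq; rewrite /GRing.scale /= mulrC.
    have d1 := is_derive_in T dx; have d2 := de im t0 t0T.
    have FF : Filter (increments T t0) by exact: within_filter.
    rewrite /has_derivative_in [X in X @ _](_ : _ = fun d : R =>
       d^-1 * (A * expR (2 * L * (t0 + d - t0)) - A * expR (2 * L * (t0 - t0))) -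
       sg * (d^-1 * (e im (t0 + d) - e im t0))).
      exact: cvgB d1 (cvgM (cvg_cst sg) d2).
    by apply/funext => d; rewrite /barrier; ring.
  have neg : 2 * L * A - sg * e' im t0 <= 0.
    apply: (derivative_in_le db t0p) => d d0 td.
    rewrite /barrier subrr mulr0 expR0 mulr1 sgA subrr subr_ge0.
    have tdT : 0 <= t0 + d <= T.
      by rewrite td /=; move: t0T => /andP[_]; apply: le_trans; rewrite gerDl ltW.
    apply: (@le_trans _ _ `|e im (t0 + d)|).
      by rewrite (le_trans (ler_norm _))// normrM sg1 mul1r.
    have := Him im _ tdT; rewrite -ler_pdivlMr// => /le_trans; apply.
    by rewrite -[leLHS]mulrA wtE.
  have : sg * e' im t0 <= L * A + delta.
    by apply: le_trans slope; rewrite (le_trans (ler_norm _))// normrM sg1 mul1r.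
  by rewrite ler_pdivlMr//; lra.
have := Him i0 t tT; rewrite -ler_pdivlMr// => /le_trans; apply.
rewrite -[leLHS]mulrA wtE -/A; apply: ler_pM; [exact: normr_ge0|exact: expR_ge0|exact: A_le|].
rewrite ler_expR ler_wpM2l//; first by rewrite mulr_ge0// ltW.
by move: tT t0T => /andP[? ?] /andP[? ?]; lra.
Qed.
End increments.

(** * Picard iteration *)

Section picard.
Context {R : realType}.
Variables (n : nat) (F : ('I_n -> R) -> 'I_n -> R) (L T : R) (y0 : 'I_n -> R).
Hypotheses (L0 : 0 < L) (T0 : 0 < T).
Hypothesis Flip : forall x y D, (forall j, `|x j - y j| <= D) ->
  forall i, `|F x i - F y i| <= L * D.
Implicit Types (Y : 'I_n -> R -> R).
Notation mu := (@lebesgue_measure R).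

Let admissible Y := forall j, continuous (fun s => Y j (clamp 0 T s)).

Let field Y (i : 'I_n) (s : R) : R := F (fun j => Y j (clamp 0 T s)) i.

Let field_continuous Y i : admissible Y -> continuous (field Y i).
Proof.
move=> aY s; apply/cvgrPdist_le => eps eps0.
have eL : 0 < eps / L by rewrite divr_gt0.
near=> t.
have H : forall j : 'I_n, `|Y j (clamp 0 T s) - Y j (clamp 0 T t)| <= eps / L.
  near: t; apply: filter_forall => j.
  by have /cvgrPdist_le /(_ _ eL) := @aY j s.
by have := Flip H i; rewrite mulrC divfK// gt_eqF.
Unshelve. all: by end_near. Qed.

(* Integrals start at -1, so that iterates have two-sided derivatives on [0, T]. *)
Let picard Y i (t : R) : R := y0 i +
  (\int[mu]_(s in `[-1, t]) field Y i s - \int[mu]_(s in `[-1, 0]) field Y i s).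

Let picard0 Y i : picard Y i 0 = y0 i.
Proof. by rewrite /picard subrr addr0. Qed.

Let picard_derive Y i (t : R) : admissible Y -> -1 < t -> is_derive t 1 (picard Y i) (field Y i t).
Proof.
move=> aY t1.
pose G (t : R) := \int[mu]_(s in `[-1, t]) field Y i s.
have d : is_derive t 1 G (field Y i t) := primitive_right (field_continuous (i := i) aY) t1.
rewrite (_ : picard Y i = fun s : R => (y0 i - G 0) + G s).
  by apply: is_derive_eq; rewrite add0r mul1r.
by apply/funext => s; rewrite /picard -/(G 0) -/(G s); ring.
Qed.

Let picard_admissible Y : admissible Y -> admissible (picard Y).
Proof.
move=> aY j; apply: (derivative_in_continuous (l := field Y j) (ltW T0)) => t /andP[t0 _].
by apply: is_derive_in; apply: picard_derive => //; lra.
Qed.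

Let wt (t : R) := expR (2 * L * t).

Let wt_ge1 (t : R) : 0 <= t -> 1 <= wt t.
Proof.
move=> t0; apply: le_trans (expR_ge1Dx _); rewrite lerDl mulr_ge0//.
by rewrite mulr_ge0// ltW.
Qed.

(* The weight e^(2Lt) makes the iteration contract by 1/2 on the whole of [0, T]. *)
Let picard_contract Y Z D : admissible Y -> admissible Z ->
  (forall j t, 0 <= t <= T -> `|Y j t - Z j t| <= D * wt t) ->
  forall j t, 0 <= t <= T -> `|picard Y j t - picard Z j t| <= D / 2 * wt t.
Proof.
move=> aY aZ H j t /andP[t0 tT].
have D0 : 0 <= D.
  have z0 : 0 <= (0 : R) <= T by rewrite lexx ltW.
  have := le_trans (normr_ge0 _) (H j 0 z0).
  by rewrite /wt mulr0 expR0 mulr1.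
have side (Y' Z' : 'I_n -> R -> R) : admissible Y' -> admissible Z' ->
    (forall j t, 0 <= t <= T -> `|Y' j t - Z' j t| <= D * wt t) ->
    picard Y' j t - picard Z' j t <= D / 2 * wt t.
  move=> aY' aZ' H'.
  pose q (s : R) := D / 2 * wt s - (picard Y' j s - picard Z' j s).
  pose q' (s : R) := D * L * wt s - (field Y' j s - field Z' j s).
  have dq (s : R) : 0 <= s <= t -> is_derive s 1 q (q' s).
    move=> /andP[s0 st]; have s1 : -1 < s by lra.
    have dY := picard_derive j aY' s1; have dZ := picard_derive j aZ' s1.
    have dl : is_derive s 1 (fun s : R => 2 * L * s) (2 * L).
      by apply: is_derive_eq; rewrite /GRing.scale /= mulr1.
    have dw : is_derive s 1 wt (wt s * (2 * L)).
      exact: (@is_derive1_comp _ expR (fun s : R => 2 * L * s) s _ _ (is_derive_expR _) dl).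
    by apply: is_derive_eq; rewrite /q' /GRing.scale /=; field.
  have [c /andP[c0 ct] e] := mvt_on dq t0.
  have q0 : q 0 = D / 2 by rewrite /q !picard0 subrr subr0 /wt mulr0 expR0 mulr1.
  have cT : 0 <= c <= T by rewrite c0 (le_trans ct).
  have q'c : 0 <= q' c.
    have := @Flip (fun j => Y' j (clamp 0 T c)) (fun j => Z' j (clamp 0 T c)) (D * wt c).
    rewrite clamp_id// => /(_ (fun j => H' j c cT) j).
    rewrite /q' /field clamp_id// ler_norml => /andP[_].
    by rewrite subr_ge0 mulrCA mulrA.
  rewrite -subr_ge0 -/(q t) -(subrK (q 0) (q t)) e q0 addr_ge0//.
    by rewrite mulr_ge0// subr0.
  by rewrite divr_ge0.
rewrite ler_norml lerNl opprB; apply/andP; split; last exact: side.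
by apply: side => // k s sT; rewrite distrC; exact: H.
Qed.

Theorem picard_lindelof : exists y : 'I_n -> R -> R, (forall i, y i 0 = y0 i) /\
  forall i t, 0 <= t <= T -> has_derivative_in T (y i) t (F (fun j => y j t) i).
Proof.
pose Y k := iter k picard (fun i _ => y0 i).
have aY k : admissible (Y k).
  elim: k => [|k IH]; last exact: picard_admissible.
  by move=> j s; exact: cvg_cst.
pose C := T * \sum_(i < n) `|F y0 i|.
have C0 : 0 <= C by rewrite mulr_ge0 ?(ltW T0)// sumr_ge0.
have step k j t : 0 <= t <= T -> `|Y k.+1 j t - Y k j t| <= C * 2^-1 ^+ k * wt t.
  elim: k j t => [|k IH] j t tT; last first.
    by rewrite exprSr mulrA; exact: (picard_contract (aY k.+1) (aY k) IH).
  have /andP[t0 tT'] := tT.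
  have [|c /andP[c0 ct] e] := @mvt_on _ (picard (Y 0%N) j) (field (Y 0%N) j) 0 t _ t0.
    by move=> s /andP[s0 _]; apply: picard_derive => //; lra.
  rewrite /= -/(Y 0%N) -(picard0 (Y 0%N) j) e subr0 expr0 mulr1.
  apply: (@le_trans _ _ (C * 1)); last by rewrite ler_wpM2l// wt_ge1.
  rewrite mulr1 normrM mulrC; apply: ler_pM => //; first by rewrite ger0_norm.
  by rewrite /field /= (bigD1 j)//= lerDl sumr_ge0.
(* a k bounds the distance of the iterate Y k to the limit, because a k - a k.+1 bounds that
to Y k.+1; the limit is therefore the supremum of the Y k - a k. *)
pose a k := 2 * C * 2^-1 ^+ k * wt T.
have w0 u : 0 <= wt u := expR_ge0 _.
have a0 k : 0 <= a k.
  by apply: mulr_ge0 => //; apply: mulr_ge0; [rewrite mulr_ge0 | rewrite exprn_ge0].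
have aS k : a k.+1 = a k / 2 by rewrite /a exprS; field.
have a_small eps : 0 < eps -> exists k, a k <= eps.
  move=> eps0.
  have c : a k @[k --> \oo] --> (0 : R).
    rewrite -(mul0r (wt T)); apply: cvgM; last exact: cvg_cst.
    by apply: cvg_geometric; rewrite ger0_norm// invf_lt1// ltr1n.
  have /cvgrPdist_le /(_ eps eps0) [k _ /(_ k (leqnn k))] := c.
  by rewrite /= sub0r normrN ger0_norm// => H; exists k.
have wtT t : 0 <= t <= T -> wt t <= wt T.
  by move=> /andP[_ tT]; rewrite /wt ler_expR ler_wpM2l// mulr_ge0// ltW.
have stepa k j t : 0 <= t <= T -> `|Y k.+1 j t - Y k j t| <= a k - a k.+1.
  move=> tT; apply: (le_trans (step k j t tT)).
  rewrite aS (_ : a k - a k / 2 = C * 2^-1 ^+ k * wt T); last by rewrite /a; field.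
  by rewrite ler_wpM2l ?wtT// mulr_ge0// exprn_ge0.
have cauchy k p j t : 0 <= t <= T -> `|Y (k + p)%N j t - Y k j t| <= a k - a (k + p)%N.
  move=> tT; elim: p => [|p IH]; first by rewrite addn0 !subrr normr0.
  rewrite addnS; have := stepa (k + p)%N j t tT.
  have := ler_normD (Y (k + p).+1 j t - Y (k + p)%N j t) (Y (k + p)%N j t - Y k j t).
  rewrite addrA subrK; lra.
have near_each k m j t : 0 <= t <= T -> Y m j t - a m <= Y k j t + a k.
  move=> tT; have [km|mk] := leqP k m.
    have := cauchy k (m - k)%N j t tT; rewrite subnKC// => /(le_trans (ler_norm _)).
    have := a0 m; lra.
  have := cauchy m (k - m)%N j t tT; rewrite subnKC ?(ltnW mk)// ler_norml => /andP[+ _].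
  have := a0 k; lra.
pose y j t := sup (range (fun k => Y k j t - a k)).
have Hy k j t : 0 <= t <= T -> `|y j t - Y k j t| <= a k.
  move=> tT.
  have lo : Y k j t - a k <= y j t.
    apply: ub_le_sup; last by exists k.
    by exists (Y k j t + a k) => _ [m _ <-]; exact: near_each.
  have hi : y j t <= Y k j t + a k.
    apply: ge_sup; first by exists (Y k j t - a k), k.
    by move=> _ [m _ <-]; exact: near_each.
  by rewrite ler_norml; apply/andP; split; lra.
have ay : admissible y.
  move=> j; apply: clamp_continuous (ltW T0) => t tT eps eps0.
  have e30 : 0 < eps / 3 by rewrite divr_gt0.
  have [k ka] := a_small _ e30.
  have /cvgrPdist_le /(_ _ e30) /nbhs_ballP [r /= r0 Hr] := @aY k j t.
  exists r => // t' t'T tt'.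
  have := Hr t'; rewrite /ball /= distrC => /(_ tt'); rewrite !clamp_id//.
  have := Hy k j t tT; have := Hy k j t' t'T.
  rewrite !ler_norml => /andP[? ?] /andP[? ?] /andP[? ?].
  by apply/andP; split; lra.
have fix_y j t : 0 <= t <= T -> picard y j t = y j t.
  move=> tT; apply/eqP; rewrite -subr_eq0 -normr_le0; apply/ler_addgt0Pl => eps eps0.
  rewrite addr0.
  have w1 : 0 < wt T + 1 by rewrite addr_gt0// expR_gt0.
  have ew : 0 < eps / (wt T + 1) by rewrite divr_gt0.
  have [k ka] := a_small _ ew.
  have close i u : 0 <= u <= T -> `|y i u - Y k i u| <= a k * wt u.
    move=> uT; apply: (le_trans (Hy k i u uT)); rewrite ler_peMr// wt_ge1//.
    by case/andP: uT.
  have h1 := picard_contract ay (aY k) close j tT.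
  have h2 := Hy k.+1 j t tT.
  have h3 : a k * (wt T + 1) <= eps by rewrite -ler_pdivlMr.
  have h4 : a k / 2 * wt t <= a k * wt T.
    apply: ler_pM; rewrite ?divr_ge0//; last exact: wtT.
    by have := a0 k; lra.
  have := ler_normB (picard y j t - picard (Y k) j t) (y j t - Y k.+1 j t).
  rewrite (_ : _ - _ - _ = picard y j t - y j t); last by rewrite /=; ring.
  by have := h1; have := a0 k; rewrite aS in h2; lra.
exists (picard y); split; first by move=> i; exact: picard0.
move=> i t tT; have /andP[t0 _] := tT.
rewrite (_ : F _ i = field y i t).
  by apply: is_derive_in; apply: picard_derive => //; lra.
rewrite /field; congr (F _ i); apply/funext => j.
by rewrite clamp_id// fix_y.
Qed.
End picard.

(** * Regularity of the exact solution *)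

Section solution_regularity.
Context {R : realType}.
Notation mu := (@lebesgue_measure R).
Implicit Types (v w f : R -> R) (K s T : R).

Lemma C3_bounded_le v K K' : K <= K' -> C3_bounded v K -> C3_bounded v K'.
Proof.
move=> KK [v1 [v2 [v3 [d0 d1 d2 bd]]]]; exists v1, v2, v3; split => // x.
by have [? ? ? ?] := bd x; split; exact: le_trans KK.
Qed.

Lemma C3_boundedD v w K K' : C3_bounded v K -> C3_bounded w K' ->
  C3_bounded (fun x => v x + w x) (K + K').
Proof.
move=> [v1 [v2 [v3 [d0 d1 d2 bd]]]] [w1 [w2 [w3 [e0 e1 e2 be]]]].
exists (fun x => v1 x + w1 x), (fun x => v2 x + w2 x), (fun x => v3 x + w3 x).
split; [by move=> x; exact: is_deriveD..|].
move=> x; have [? ? ? ?] := bd x; have [? ? ? ?] := be x.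
by split; rewrite (le_trans (ler_normD _ _))// lerD.
Qed.

Lemma C3_boundedZ c v K : C3_bounded v K -> C3_bounded (fun x => c * v x) (`|c| * K).
Proof.
move=> [v1 [v2 [v3 [d0 d1 d2 bd]]]].
exists (fun x => c * v1 x), (fun x => c * v2 x), (fun x => c * v3 x).
split; [by move=> x; exact: is_deriveZ..|].
by move=> x; have [? ? ? ?] := bd x; split; rewrite normrM ler_wpM2l.
Qed.

Lemma C3_bounded_eq v w K : v =1 w -> C3_bounded v K -> C3_bounded w K.
Proof. by move=> /funext ->. Qed.

Lemma square_L1D v w : measurable_fun setT v -> measurable_fun setT w ->
  L1 (fun x => v x ^+ 2) -> L1 (fun x => w x ^+ 2) -> L1 (fun x => (v x + w x) ^+ 2).
Proof.
move=> mv mw v2 w2.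
apply: (L1_dominated _ (L1Z 2 (L1D v2 w2))).
  by apply: measurable_funX; exact: measurable_funD.
move=> x; rewrite ger0_norm ?sqr_ge0//.
by have := sqr_ge0 (v x - w x); nra.
Qed.

Lemma square_L1Z c v : L1 (fun x => v x ^+ 2) -> L1 (fun x => (c * v x) ^+ 2).
Proof. by move=> v2; under eq_fun do rewrite exprMn; exact: L1Z. Qed.

Lemma Hs_L2 s v : Hs s v -> [/\ continuous v, measurable_fun setT v & L1 (fun x => v x ^+ 2)].
Proof. by move=> [cv v2 _]; split => //; [exact: Lfun_measurable v2|exact: Lfun2_L1]. Qed.

Lemma Hs_C3 s v : 7 / 2 < s -> Hs s v -> exists K, C3_bounded v K.
Proof.
move=> s72 Hv; have [cv mv v2] := Hs_L2 Hv; have [_ _ fin] := Hv.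
have [A A0 HA] := sobolev_embedding s72.
have [eta [eta0 h]] : exists eta, 0 < eta /\ (Hs_norm s v < eta%:E)%E.
  have N0 : (0 <= Hs_norm s v)%E by rewrite /Hs_norm poweR_ge0.
  exists (fine (Hs_norm s v) + 1); split; first by rewrite ltr_wpDl// fine_ge0.
  by rewrite EFinD fineK ?ge0_fin_numE// lteDl// ge0_fin_numE.
by exists (A * eta); exact: HA.
Qed.

(** The embedding turns convergence of the difference quotients in the Sobolev norm into
convergence in C^3, uniformly in x. *)
Lemma C1_Hs_local s T (u ut : R -> R -> R) t : 7 / 2 < s -> C1_Hs s T u ut -> 0 <= t <= T ->
  (exists K r, 0 < r /\ forall t', 0 <= t' <= T -> `|t' - t| < r ->
     C3_bounded (u t') K /\ forall x, `|u t' x - u t x| <= K * `|t' - t|) /\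
  forall x, has_derivative_in T (fun t => u t x) t (ut t x).
Proof.
move=> s72 Hu tT; have [Hut Hutt cv _] := Hu t tT.
have [A A0 HA] := sobolev_embedding s72.
have FF : Filter (increments T t) by exact: within_filter.
have key eta : 0 < eta -> exists2 r, 0 < r & forall d, d != 0 -> `|d| < r -> 0 <= t + d <= T ->
    C3_bounded (fun x => d^-1 * (u (t + d) x - u t x) - ut t x) (A * eta).
  move=> eta0; have := cvge0_near_lt FF cv eta0 => /nbhs_ballP [r /= r0 Hr].
  exists r => // d d0 dr dT.
  have [c1 m1 q1] := Hs_L2 Hut; have [c2 m2 q2] := Hs_L2 Hutt.
  have [Hd _ _ _] := Hu (t + d) dT; have [c3 m3 q3] := Hs_L2 Hd.
  have E : (fun x => d^-1 * (u (t + d) x - u t x) - ut t x) =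
      (fun x => d^-1 * (u (t + d) x + - 1 * u t x) + - 1 * ut t x).
    by apply/funext => x; ring.
  apply: HA => //.
  - move=> x; apply: cvgB; last exact: c2.
    by apply: cvgMl_tmp; apply: cvgB; [exact: c3|exact: c1].
  - rewrite (_ : (fun x => _ ^+ 2) = fun x => (d^-1 * (u (t + d) x + - 1 * u t x) + - 1 * ut t x) ^+ 2); last first.
      by apply/funext => x; rewrite (congr1 (fun g => g x) E).
    have m1' : measurable_fun setT (fun x => - 1 * u t x) by exact: measurable_funM.
    have m2' : measurable_fun setT (fun x => - 1 * ut t x) by exact: measurable_funM.
    apply: square_L1D => //; last exact: square_L1Z.
      by apply: measurable_funM => //; exact: measurable_funD.
    by apply: square_L1Z; apply: square_L1D => //; exact: square_L1Z.
  - by apply: Hr => //; rewrite /ball /= sub0r normrN.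
split; last first.
  move=> x; apply/incrementsP => eps eps0.
  have [|r r0 Hr] := key (eps / A); first by rewrite divr_gt0.
  exists r => // d d0 dr dT.
  have [? [? [? [_ _ _ /(_ x) [h _ _ _]]]]] := Hr d d0 dr dT.
  by move: h; rewrite distrC [leRHS]mulrC divfK// gt_eqF.
have [K1 HK1] := Hs_C3 s72 Hut; have [K2 HK2] := Hs_C3 s72 Hutt.
have K10 : 0 <= K1 by have [? [? [? [_ _ _ /(_ 0) [h _ _ _]]]]] := HK1; exact: le_trans h.
have K20 : 0 <= K2 by have [? [? [? [_ _ _ /(_ 0) [h _ _ _]]]]] := HK2; exact: le_trans h.
have [r r0 Hr] := key 1 ltr01.
exists (K1 + (K2 + A)), (Num.min r 1); split; first by rewrite lt_min r0 ltr01.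
move=> t' t'T; rewrite lt_min => /andP[h1 h2].
have [->|ne] := eqVneq t' t.
  split; first by apply: C3_bounded_le HK1; rewrite lerDl addr_ge0// ltW.
  by move=> x; rewrite !subrr normr0 mulr0.
have d0 : t' - t != 0 by rewrite subr_eq0.
have := Hr (t' - t) d0 h1; rewrite (_ : t + (t' - t) = t'); last by ring.
move=> /(_ t'T); rewrite mulr1 => q.
have p := C3_boundedD q HK2.
have E x : (t' - t) * ((t' - t)^-1 * (u t' x - u t x) - ut t x + ut t x) = u t' x - u t x.
  by rewrite subrK mulVKf.
split.
  apply: (@C3_bounded_le _ (K1 + `|t' - t| * (A + K2))).
    rewrite lerD2l (addrC K2) ler_piMl ?addr_ge0// ltW//.
  apply: C3_bounded_eq (C3_boundedD HK1 (C3_boundedZ (t' - t) p)) => x.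
  by rewrite E addrC subrK.
move=> x; have [? [? [? [_ _ _ /(_ x) [h _ _ _]]]]] := p.
rewrite -E normrM mulrC ler_wpM2r//; apply: (le_trans h); lra.
Qed.

(** Compactness of [0, T], by the supremum of the times up to which one constant works. *)
Lemma uniform_on_segment T (P : R -> R -> Prop) : 0 <= T ->
  (forall t K K', K <= K' -> P t K -> P t K') ->
  (forall t, 0 <= t <= T -> exists K r, 0 < r /\
     forall t', 0 <= t' <= T -> `|t' - t| < r -> P t' K) ->
  exists K, forall t, 0 <= t <= T -> P t K.
Proof.
move=> T0 mono loc.
pose S := [set t | 0 <= t <= T /\ exists K, forall t', 0 <= t' <= t -> P t' K].
have S0 : S 0.
  split; first by rewrite lexx.
  have [|K [r [r0 HK]]] := loc 0; first by rewrite lexx.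
  exists K => t' /andP[h1 h2]; have -> : t' = 0 by apply/eqP; rewrite eq_le h2.
  by apply: HK; rewrite ?lexx// subrr normr0.
have supS : has_sup S by split; [exists 0 | exists T => t [/andP[]]].
have sT : 0 <= sup S <= T.
  rewrite ub_le_sup//=; last by case: supS.
  by apply: ge_sup; [exists 0|move=> t [/andP[]]].
have [K [r [r0 HK]]] := loc _ sT.
have [t [tT [K' HK']] st] := sup_adherent r0 supS.
have st' : t <= sup S by apply: ub_le_sup => //; [case: supS | split => //; exists K'].
pose m := Num.min T (sup S + r / 2).
have Sm : S m.
  have m0 : 0 <= m by rewrite le_min T0 /=; move/andP: sT => [? _]; lra.
  split; first by rewrite m0 ge_min lexx.
  exists (Num.max K K') => t' /andP[h1 h2].
  have t'T : 0 <= t' <= T by rewrite h1 (le_trans h2)// ge_min lexx.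
  have t's : t' <= sup S + r / 2 by rewrite (le_trans h2)// ge_min lexx orbT.
  have [h|h] := leP t' t.
    by apply: (mono _ K'); [rewrite le_max lexx orbT|apply: HK'; rewrite h1].
  apply: (mono _ K); first by rewrite le_max lexx.
  by apply: HK => //; rewrite ltr_norml; apply/andP; split; lra.
have mT : m = T.
  have : m <= sup S by apply: ub_le_sup => //; case: supS.
  by rewrite /m; case: (leP T (sup S + r / 2)) => // _ h; exfalso; lra.
by have [_] := Sm; rewrite mT.
Qed.

(** If |v x| > eps, then |v| > eps / 2 on the interval of radius rho about x, which contributes
a fixed amount to the integral of v^2.  Far out the tail of the integral is smaller. *)
Lemma L2_decay_right v K : C3_bounded v K -> L1 (fun x => v x ^+ 2) ->
  forall eps, 0 < eps -> exists X, forall x, X <= x -> `|v x| <= eps.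
Proof.
move=> [v1 [v2 [v3 [d0 _ _ bd]]]] L2 eps eps0.
have v1K x : `|v1 x| <= K by have [] := bd x.
have K0 : 0 <= K := le_trans (normr_ge0 _) (v1K 0).
have cv : continuous v := is_derive_cont d0.
have c2 : continuous (fun x => v x ^+ 2).
  rewrite (_ : (fun x => _) = fun x => v x * v x); last by apply/funext => x; rewrite expr2.
  by move=> x; apply: cvgM; exact: cv.
pose rho := eps / (2 * (K + 1)).
have rho0 : 0 < rho by rewrite divr_gt0// mulr_gt0// ltr_wpDl.
have Krho : K * rho <= eps / 2.
  rewrite /rho mulrA ler_pdivrMr ?mulr_gt0 ?ltr_wpDl//; lra.
pose e' := rho * (eps / 2) ^+ 2 / 2.
have e'0 : 0 < e' by rewrite divr_gt0// mulr_gt0// exprn_gt0// divr_gt0.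
have [A HA] := L1_tail L2 e'0.
pose B := `|A|; have AB : A <= B := ler_norm A.
exists (B + rho) => x Bx; rewrite leNgt; apply/negP => big.
pose F (y : R) := \int[mu]_(z in `[- B - 1, y]) v z ^+ 2.
have B0 : 0 <= B := normr_ge0 A.
have [||c /andP[c1 c2'] e] := @mvt_on _ F (fun z => v z ^+ 2) (x - rho) (x + rho).
- move=> y /andP[y1 y2]; apply: primitive_right => //; lra.
- lra.
have f1 : `|\int[mu]_z v z ^+ 2 - F (x - rho)| <= e' by apply: HA; lra.
have f2 : `|\int[mu]_z v z ^+ 2 - F (x + rho)| <= e' by apply: HA; lra.
have f3 : `|F (x + rho) - F (x - rho)| <= 2 * e'.
  by move: f1 f2; rewrite !ler_norml => /andP[? ?] /andP[? ?]; apply/andP; split; lra.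
have vc : eps / 2 < `|v c|.
  have h : `|v x - v c| <= K * `|x - c| by exact: mvt_bound d0 v1K.
  have h2 : `|x - c| <= rho by rewrite ler_norml; apply/andP; split; lra.
  have h3 := ler_wpM2l K0 h2.
  have := ler_normD (v x - v c) (v c); rewrite subrK; lra.
have sq : (eps / 2) ^+ 2 < v c ^+ 2.
  rewrite -(real_normK (num_real (v c))) ltr_sqr ?nnegrE//.
  by rewrite divr_ge0// ltW.
move: f3; rewrite e (_ : x + rho - (x - rho) = 2 * rho); last by ring.
rewrite ger0_norm; last by rewrite mulr_ge0 ?sqr_ge0// mulr_ge0// ltW.
have := ltr_pM2l rho0 ((eps / 2) ^+ 2) (v c ^+ 2); rewrite sq /e' => h.
have q0 : 0 <= rho * (eps / 2) ^+ 2 by rewrite mulr_ge0 ?sqr_ge0// ltW.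
by move: h; lra.
Qed.

Lemma C3_bounded_reflect v K c : C3_bounded v K -> C3_bounded (fun x => v (c - x)) K.
Proof.
move=> [v1 [v2 [v3 [d0 d1 d2 bd]]]].
have comp (g g' : R -> R) : (forall x : R, is_derive x 1 g (g' x)) ->
    forall x : R, is_derive x 1 (fun x => g (c - x)) (- g' (c - x)).
  move=> dg x.
  have a : is_derive x 1 (fun x : R => c - x) (- 1).
    by apply: is_derive_eq; rewrite ?add0r ?mulrN ?mulr1.
  have := @is_derive1_comp _ g (fun x : R => c - x) x _ _ (dg _) a.
  by rewrite mulrN1.
exists (fun x => - v1 (c - x)), (fun x => v2 (c - x)), (fun x => - v3 (c - x)); split.
- exact: comp.
- move=> x; have := comp _ _ d1 x => h; apply: is_derive_eq; exact: opprK.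
- exact: comp.
- by move=> x; have [? ? ? ?] := bd (c - x); rewrite !normrN.
Qed.

Lemma L2_decay v K : C3_bounded v K -> L1 (fun x => v x ^+ 2) ->
  forall eps, 0 < eps -> exists X, forall x, X <= `|x| -> `|v x| <= eps.
Proof.
move=> bv v2 eps eps0.
have [X1 H1] := L2_decay_right bv v2 eps0.
have [r2 _] := integral_reflection 0 v2.
have [X2 H2] := L2_decay_right (C3_bounded_reflect 0 bv) r2 eps0.
exists (Num.max X1 X2) => x; rewrite ge_max => /andP[h1 h2].
have [x0|x0] := leP 0 x; first by apply: H1; move: h1; rewrite ger0_norm.
have := H2 (- x); rewrite sub0r opprK; apply.
by move: h2; rewrite ltr0_norm.
Qed.

Lemma continuous_bounded (g : R -> R) K : 0 <= K -> continuous g ->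
  exists2 B, 0 <= B & forall y, `|y| <= K -> `|g y| <= B.
Proof.
move=> K0 cg.
have cn : continuous (fun y => `|g y|).
  by move=> y; apply: continuous_comp; [exact: cg|exact: norm_continuous].
have [|c _ Hc] := EVT_max _ (continuous_subspaceT cn) (a := - K) (b := K); first by lra.
exists `|g c| => // y yK; apply: Hc.
by rewrite in_itv /= -ler_norml.
Qed.

Lemma class_C_derivatives m f : (3 < m)%N -> class_C m f ->
  exists f1 f2 f3 : R -> R, [/\ forall x : R, is_derive x 1 f (f1 x),
    forall x : R, is_derive x 1 f1 (f2 x), forall x : R, is_derive x 1 f2 (f3 x) & continuous f3].
Proof.
move=> m3 [df _].
have D k : (k <= 3)%N -> forall x : R, is_derive x 1 (f^`(k)%classic) (f^`(k.+1)%classic x).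
  move=> k3 x; apply: DeriveDef; first exact: df (leq_ltn_trans k3 m3) x.
  by rewrite derive1nS derive1E.
exists f^`(1)%classic, f^`(2)%classic, f^`(3)%classic.
split; [exact: D 0%N isT|exact: D 1%N isT|exact: D 2%N isT|].
exact: is_derive_cont (D 3%N isT).
Qed.

Lemma C3_bounded_comp m f K : (3 < m)%N -> class_C m f -> 0 <= K ->
  exists K', forall v, C3_bounded v K -> C3_bounded (fun x => f (v x)) K'.
Proof.
move=> m3 /(class_C_derivatives m3) [f1 [f2 [f3 [e0 e1 e2 c3]]]] K0.
have [B0 B00 H0] := continuous_bounded K0 (is_derive_cont e0).
have [B1 B10 H1] := continuous_bounded K0 (is_derive_cont e1).
have [B2 B20 H2] := continuous_bounded K0 (is_derive_cont e2).
have [B3 B30 H3] := continuous_bounded K0 c3.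
pose B := B0 + B1 + B2 + B3.
have Bs : [/\ 0 <= B, B0 <= B, B1 <= B, B2 <= B & B3 <= B] by rewrite /B; split; lra.
case: Bs => Bp b0 b1 b2 b3.
exists (B + B * K + (B * (K * K) + B * K) + (B * (K * (K * K)) + 3 * (B * (K * K)) + B * K)).
move=> v [v1 [v2 [v3 [d0 d1 d2 bd]]]].
have comp (g g' : R -> R) (x : R) : (forall x : R, is_derive x 1 g (g' x)) ->
    is_derive x 1 (fun x => g (v x)) (g' (v x) * v1 x).
  by move=> dg; exact: (@is_derive1_comp _ g v x _ _ (dg _) (d0 x)).
exists (fun x => f1 (v x) * v1 x), (fun x => f2 (v x) * (v1 x * v1 x) + f1 (v x) * v2 x),
  (fun x => f3 (v x) * (v1 x * (v1 x * v1 x)) + 3 * (f2 (v x) * (v1 x * v2 x)) + f1 (v x) * v3 x).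
split.
- by move=> x; exact: comp.
- move=> x; have c1 := comp _ _ x e1; have h1 := d1 x.
  by apply: is_derive_eq; rewrite /GRing.scale /=; ring.
- move=> x; have c1 := comp _ _ x e1; have c2 := comp _ _ x e2; have h1 := d1 x; have h2 := d2 x.
  by apply: is_derive_eq; rewrite /GRing.scale /=; ring.
move=> x; have [h0 h1 h2 h3] := bd x.
have g0 : `|f (v x)| <= B := le_trans (H0 _ h0) b0.
have g1 : `|f1 (v x)| <= B := le_trans (H1 _ h0) b1.
have g2 : `|f2 (v x)| <= B := le_trans (H2 _ h0) b2.
have g3 : `|f3 (v x)| <= B := le_trans (H3 _ h0) b3.
have pm (a b A' B' : R) : `|a| <= A' -> `|b| <= B' -> `|a * b| <= A' * B'.
  by move=> ha hb; rewrite normrM ler_pM.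
have t1 := pm _ _ _ _ g1 h1; have t2 := pm _ _ _ _ g2 (pm _ _ _ _ h1 h1).
have t3 := pm _ _ _ _ g1 h2; have t4 := pm _ _ _ _ g3 (pm _ _ _ _ h1 (pm _ _ _ _ h1 h1)).
have t5 := pm _ _ _ _ g2 (pm _ _ _ _ h1 h2); have t6 := pm _ _ _ _ g1 h3.
have p1 : 0 <= B * K by rewrite mulr_ge0.
have p2 : 0 <= B * (K * K) by rewrite mulr_ge0// mulr_ge0.
have p3 : 0 <= B * (K * (K * K)) by rewrite mulr_ge0// mulr_ge0// mulr_ge0.
split.
- lra.
- lra.
- apply: (le_trans (ler_normD _ _)); lra.
- apply: (le_trans (ler_normD _ _)).
  have := ler_normD (f3 (v x) * (v1 x * (v1 x * v1 x))) (3 * (f2 (v x) * (v1 x * v2 x))).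
  have : `|3 * (f2 (v x) * (v1 x * v2 x))| <= 3 * (B * (K * K)) by rewrite normrM ger0_norm// ler_wpM2l.
  lra.
Qed.

(** The second-order Taylor remainder of w is uniform in space, so it survives integration
against beta. *)
Lemma convolution_derive (beta w w1 w2 : R -> R) K (x : R) : continuous beta -> L1 beta ->
  (forall x : R, is_derive x 1 w (w1 x)) -> (forall x : R, is_derive x 1 w1 (w2 x)) ->
  (forall x, [/\ `|w x| <= K, `|w1 x| <= K & `|w2 x| <= K]) ->
  is_derive x 1 (convolution beta w) (\int[mu]_z (beta z * w1 (x - z))).
Proof.
move=> cb b1 d0 d1 bd.
have K0 : 0 <= K by have [h _ _] := bd 0; exact: le_trans h.
have mb := continuous_measurable cb.
have int (g g' : R -> R) y : (forall x : R, is_derive x 1 g (g' x)) -> (forall x, `|g x| <= K) ->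
    L1 (fun z => beta z * g (y - z)).
  move=> dg gK; have mg := continuous_measurable (is_derive_cont dg).
  apply: (L1_dominated _ (L1Z K (L1_norm b1))); last first.
    by move=> z; rewrite normrM mulrC ler_wpM2r.
  apply: measurable_funM => //; apply: (measurableT_comp mg).
  exact: measurable_reflection.
have convE y : convolution beta w y = \int[mu]_z (beta z * w (y - z)).
  have i1 : L1 (fun z => beta z * w (y - z)) by apply: int d0 _ => z; have [] := bd z.
  have [_ <-] := integral_reflection y i1.
  apply: eq_Rintegral => z _; congr (_ * w _); ring.
apply: (@is_derive_quadratic _ _ _ (K * \int[mu]_z `|beta z|)) => d.
have i0 y : L1 (fun z => beta z * w (y - z)) by apply: int d0 _ => z; have [] := bd z.
have i1 y : L1 (fun z => beta z * w1 (y - z)) by apply: int d1 _ => z; have [] := bd z.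
rewrite !convE -RintegralB// -RintegralZl// -RintegralB//; last 2 first.
- exact: L1B.
- exact: L1Z.
have -> : K * \int[mu]_z `|beta z| * d ^+ 2 = \int[mu]_z (K * d ^+ 2 * `|beta z|).
  by rewrite RintegralZl//; [ring|exact: L1_norm].
apply: norm_int_le.
- by apply: L1_measurable; apply: L1B; [exact: L1B|exact: L1Z].
- by apply: L1Z; exact: L1_norm.
- move=> z.
  have w2K y : `|w2 y| <= K by have [] := bd y.
  have := taylor2 (x - z) (x + d - z) d0 d1 w2K.
  rewrite (_ : x + d - z - (x - z) = d); last by ring.
  move=> h.
  rewrite (_ : _ - _ = beta z * (w (x + d - z) - w (x - z) - w1 (x - z) * d)); last by ring.
  by rewrite normrM mulrC ler_wpM2r.
Qed.

End solution_regularity.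

(** * Consistency of the finite system *)

Section truncated_scheme.
Context {R : realType}.
Notation mu := (@lebesgue_measure R).
Implicit Types (beta w : R -> R) (B K h x : R).

Lemma cidxE N (k : 'I_(N.*2.+1)) : (cidx k)%:~R = k%:R - N%:R :> R.
Proof. by rewrite /cidx intrB. Qed.

(** With j in reversed order, the differences x_i - x_j form an increasing block of lattice
points. *)
Lemma grid_sub h N (i j : 'I_(N.*2.+1)) :
  grid h (cidx i - cidx (rev_ord j)) = (i%:R - N.*2%:R) * h + j%:R * h.
Proof.
rewrite /grid intrB !cidxE /= subSS natrB; last by rewrite -ltnS.
ring.
Qed.

Lemma scheme_weightE h beta k : 0 < h ->
  h * Dgrid h beta k = (beta (grid h k + h) - beta (grid h k - h)) / 2.
Proof.
move=> h0; rewrite /Dgrid (_ : grid h (k + 1) = grid h k + h); last first.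
  by rewrite /grid intrD; ring.
rewrite (_ : grid h (k - 1) = grid h k - h); last by rewrite /grid intrB; ring.
by field; rewrite gt_eqF.
Qed.

Lemma centered_variation beta B s h n : lattice_bounds beta B -> 0 < h ->
  \sum_(j < n) `|(beta (s + j%:R * h + h) - beta (s + j%:R * h - h)) / 2| <= B.
Proof.
move=> [_ _ _ [_ var _]] h0.
have hh : 0 <= h <= h by rewrite lexx ltW.
have v1 := var n s h h h0 hh; have v2 := var n (s - h) h h h0 hh.
apply: (@le_trans _ _ (2^-1 * (\sum_(j < n) `|beta (s + j%:R * h + h) - beta (s + j%:R * h)| +
  \sum_(j < n) `|beta (s - h + j%:R * h + h) - beta (s - h + j%:R * h)|))); last lra.
rewrite -big_split /= mulr_sumr; apply: ler_sum => j _.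
rewrite (_ : s - h + j%:R * h + h = s + j%:R * h); last by ring.
rewrite (_ : s - h + j%:R * h = s + j%:R * h - h); last by ring.
rewrite normrM (ger0_norm (x := 2^-1))// mulrC ler_wpM2l//.
apply: le_trans (ler_normD _ _); rewrite le_eqVlt; apply/orP; left; apply/eqP; congr `|_|; ring.
Qed.

Lemma scheme_weight_sum beta B h N (i : 'I_(N.*2.+1)) : lattice_bounds beta B -> 0 < h ->
  \sum_(j < N.*2.+1) `|h * Dgrid h beta (cidx i - cidx j)| <= B.
Proof.
move=> lb h0; rewrite (reindex_inj rev_ord_inj) /=.
apply: le_trans (@centered_variation beta B ((i%:R - N.*2%:R) * h) h N.*2.+1 lb h0).
by apply: ler_sum => j _; rewrite scheme_weightE// grid_sub.
Qed.

(** The finite sum is a block of consecutive terms of the bi-infinite one; on the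
discarded terms the argument of w has left [-N h, N h]. *)
Lemma truncated_scheme_consistency beta B (w w1 w2 w3 : R -> R) K h eta N (i : 'I_(N.*2.+1)) :
  lattice_bounds beta B ->
  (forall x : R, is_derive x 1 w (w1 x)) -> (forall x : R, is_derive x 1 w1 (w2 x)) ->
  (forall x : R, is_derive x 1 w2 (w3 x)) ->
  (forall x, [/\ `|w x| <= K, `|w1 x| <= K, `|w2 x| <= K & `|w3 x| <= K]) ->
  0 < h <= 1 -> 0 <= eta -> (forall y, N%:R * h <= `|y| -> `|w y| <= eta) ->
  `|\sum_(j < N.*2.+1) h * Dgrid h beta (cidx i - cidx j) * w (grid h (cidx j)) -
    \int[mu]_z (beta z * w1 (grid h (cidx i) - z))| <= 4 * B * K * h ^+ 2 + B * eta.
Proof.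
move=> lb d0 d1 d2 bd h01 eta0 weta; have /andP[h0 h1] := h01.
have B0 : 0 <= B by have [] := lb.
apply/ler_addgt0Pr => e e0.
set x := grid h (cidx i).
pose om (z : R) := w (x - z).
have refl (g g' : R -> R) : (forall x : R, is_derive x 1 g (g' x)) ->
    forall z : R, is_derive z 1 (fun z => g (x - z)) (- g' (x - z)).
  move=> dg z.
  have a : is_derive z 1 (fun z : R => x - z) (- 1).
    by apply: is_derive_eq; rewrite ?add0r ?mulrN ?mulr1.
  by have := @is_derive1_comp _ g (fun z : R => x - z) z _ _ (dg _) a; rewrite mulrN1.
have o1 := refl _ _ d0.
have o2 (z : R) : is_derive z 1 (fun z => - w1 (x - z)) (w2 (x - z)).
  by have h' := refl _ _ d1 z; apply: is_derive_eq; exact: opprK.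
have o3 := refl _ _ d2.
have ob z : [/\ `|w (x - z)| <= K, `|- w1 (x - z)| <= K, `|w2 (x - z)| <= K & `|- w3 (x - z)| <= K].
  by rewrite !normrN.
have [n0 Hn] := scheme_consistency lb o1 o2 o3 ob h01 e0.
(* Large enough for scheme_consistency and for the block of all x_i - x_j to fit. *)
pose n := (n0 + N.*2)%N.
have := Hn n (leq_addr _ _); set s := - (n%:R * h).
have -> : \int[mu]_z (beta z * - w1 (x - z)) = - \int[mu]_z (beta z * w1 (x - z)).
  have [cb b1 _ _] := lb.
  have i1 : L1 (fun z => beta z * w1 (x - z)).
    apply: (L1_dominated _ (L1Z K (L1_norm b1))); last first.
      by move=> z; have [_ ? _ _] := bd (x - z); rewrite normrM mulrC ler_wpM2r.
    apply: measurable_funM; first exact: continuous_measurable.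
    apply: measurableT_comp; first exact: continuous_measurable (is_derive_cont d1).
    exact: measurable_reflection.
  rewrite -mulN1r -RintegralZl//; apply: eq_Rintegral => z _; ring.
pose F l := (beta (s + l%:R * h + h) - beta (s + l%:R * h - h)) / 2 * w (x - (s + l%:R * h)).
pose A l := (beta (s + l%:R * h + h) - beta (s + l%:R * h - h)) / 2.
rewrite -/(\sum_(j < n.*2.+1) F j).
pose p := (n0 + i)%N; pose q := (p + N.*2.+1)%N.
have iN : (i <= N.*2)%N by rewrite -ltnS.
have pq : (p <= q)%N by rewrite leq_addr.
have qm : (q <= n.*2.+1)%N.
  by rewrite /q /p /n; move: iN; lia.
have xE : x = (i%:R - N%:R) * h by rewrite /x /grid cidxE.
have nE : n%:R = n0%:R + N.*2%:R :> R by rewrite /n natrD.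
have N2 : N.*2%:R = 2 * N%:R :> R by rewrite -muln2 natrM mulrC.
have block : \sum_(p <= l < q) F l =
    \sum_(j < N.*2.+1) h * Dgrid h beta (cidx i - cidx j) * w (grid h (cidx j)).
  rewrite /q -{1}[p]add0n (addnC p) big_addn addnK big_mkord.
  rewrite [RHS](reindex_inj rev_ord_inj) /=; apply: eq_bigr => j _.
  have jE : s + (j + p)%:R * h = (i%:R - N.*2%:R) * h + j%:R * h.
    by rewrite /s /p nE !natrD; ring.
  rewrite /F scheme_weightE// grid_sub jE; congr (_ * w _).
  rewrite xE /grid cidxE /= subSS natrB; last by rewrite -ltnS.
  by rewrite N2; ring.
have outside l : (l < p)%N || (q <= l)%N -> `|F l| <= eta * `|A l|.
  move=> hl; rewrite /F normrM mulrC ler_wpM2r//; apply: weta.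
  have Nh : 0 <= N%:R * h by rewrite mulr_ge0// ltW.
  have {hl} [lp|ql] := orP hl.
    have l1 : l%:R + 1 <= n0%:R + i%:R :> R by rewrite -natrD natr1 ler_nat.
    have := ler_wpM2r (ltW h0) l1; rewrite ler_normr xE /s nE N2 => l2.
    by apply/orP; left; lra.
  have l1 : n0%:R + i%:R + (2 * N%:R + 1) <= l%:R :> R.
    by rewrite -N2 natr1 -!natrD ler_nat.
  have := ler_wpM2r (ltW h0) l1; rewrite ler_normr xE /s nE N2 => l2.
  by apply/orP; right; lra.
have split_sum (G : nat -> R) : \sum_(l < n.*2.+1) G l =
    \sum_(0 <= l < p) G l + \sum_(p <= l < q) G l + \sum_(q <= l < n.*2.+1) G l.
  by rewrite -(big_mkord xpredT G) (big_cat_nat (leq0n q) qm) (big_cat_nat (leq0n p) pq).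
have rest : `|\sum_(0 <= l < p) F l + \sum_(q <= l < n.*2.+1) F l| <= B * eta.
  apply: (le_trans (ler_normD _ _)).
  apply: (@le_trans _ _ (\sum_(0 <= l < p) eta * `|A l| + \sum_(q <= l < n.*2.+1) eta * `|A l|)).
    apply: lerD; apply: (le_trans (ler_norm_sum _ _ _)); apply: ler_sum_nat => l /andP[l1 l2].
      by apply: outside; rewrite l2.
    by apply: outside; rewrite l1 orbT.
  rewrite -!mulr_sumr -mulrDr mulrC ler_wpM2r//.
  apply: le_trans (@centered_variation beta B s h n.*2.+1 lb h0).
  rewrite (split_sum (fun l => `|A l|)) addrAC lerDl.
  exact: sumr_ge0.
rewrite split_sum block; move: rest; rewrite !ler_norml => /andP[? ?] /andP[? ?].
by apply/andP; split; lra.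
Qed.

End truncated_scheme.

(** * Convergence *)

Section clamped_scheme.
Context {R : realType}.
Implicit Types (f beta : R -> R) (B h T : R).

(** f is only locally Lipschitz; f \o sym_clamp r is globally Lipschitz, and agrees with f
along solutions bounded by r. *)
Definition sym_clamp (r : R) : R -> R := clamp (- r) r.

Lemma sym_clamp_id r y : `|y| <= r -> sym_clamp r y = y.
Proof. by rewrite ler_norml; exact: clamp_id. Qed.

Lemma clamped_lipschitz f f1 r : 0 <= r -> (forall x : R, is_derive x 1 f (f1 x)) ->
  continuous f1 -> exists2 Lf, 0 <= Lf & forall y z,
    `|f (sym_clamp r y) - f (sym_clamp r z)| <= Lf * `|y - z|.
Proof.
move=> r0 df cf1; have [Lf Lf0 H] := continuous_bounded r0 cf1.
exists Lf => // y z.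
wlog : y z / sym_clamp r y <= sym_clamp r z.
  move=> W; have [/W//|/ltW/W] := leP (sym_clamp r y) (sym_clamp r z).
  by rewrite distrC (distrC z).
move=> yz; rewrite distrC (distrC y).
have [c /andP[c1 c2] e] := mvt df yz.
have cr : `|c| <= r.
  have rr : - r <= r by lra.
  have /andP[? _] := clamp_itv y rr; have /andP[_ ?] := clamp_itv z rr.
  by rewrite ler_norml; apply/andP; split; [exact: le_trans c1|exact: le_trans c2 _].
rewrite e normrM; apply: ler_pM => //; first exact: H.
exact: clamp_lipschitz.
Qed.

Definition scheme_field h beta f N (x : 'I_(N.*2.+1) -> R) (i : 'I_(N.*2.+1)) : R :=
  - \sum_(j < N.*2.+1) h * Dgrid h beta (cidx i - cidx j) * f (x j).

Lemma scheme_field_lipschitz beta B h f Lf N : lattice_bounds beta B -> 0 < h -> 0 <= Lf ->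
  (forall y z, `|f y - f z| <= Lf * `|y - z|) ->
  forall (x y : 'I_(N.*2.+1) -> R) D, (forall j, `|x j - y j| <= D) ->
  forall i, `|scheme_field h beta f x i - scheme_field h beta f y i| <= (B * Lf + 1) * D.
Proof.
move=> lb h0 Lf0 flip x y D xyD i.
have D0 : 0 <= D := le_trans (normr_ge0 _) (xyD i).
rewrite /scheme_field -opprD normrN -sumrB.
apply: (le_trans (ler_norm_sum _ _ _)).
apply: (@le_trans _ _ ((\sum_(j < N.*2.+1) `|h * Dgrid h beta (cidx i - cidx j)|) * (Lf * D))).
  rewrite mulr_suml; apply: ler_sum => j _; rewrite -mulrBr normrM ler_wpM2l//.
  by apply: (le_trans (flip _ _)); rewrite ler_wpM2l.
apply: (@le_trans _ _ (B * (Lf * D))).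
  by apply: ler_wpM2r; [rewrite mulr_ge0 | exact: scheme_weight_sum].
lra.
Qed.

(** Two solutions are continuous on [0, T], hence bounded by a common r, and so they solve the
same globally Lipschitz system; gronwall_max with delta = 0 applies to their difference. *)
Lemma lattice_solution_unique T h beta f f1 phi B N (v w : 'I_(N.*2.+1) -> R -> R) :
  0 <= T -> 0 < h -> lattice_bounds beta B ->
  (forall x : R, is_derive x 1 f (f1 x)) -> continuous f1 ->
  lattice_solution T h beta f phi v -> lattice_solution T h beta f phi w ->
  forall i t, 0 <= t <= T -> v i t = w i t.
Proof.
move=> T0 h0 lb df cf1 [v0 dv] [w0 dw].
have bounded (z : 'I_(N.*2.+1) -> R -> R) : (forall i t, 0 <= t <= T ->
    has_derivative_in T (z i) t (scheme_field h beta f (fun j => z j t) i)) ->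
    exists r, forall i t, 0 <= t <= T -> `|z i t| <= r.
  move=> dz.
  have /choice [r Hr] : forall i, exists r, forall t, 0 <= t <= T -> `|z i t| <= r.
    move=> i; have cz := derivative_in_continuous T0 (dz i).
    have cn : continuous (fun t => `|z i (clamp 0 T t)|).
      by move=> t; apply: continuous_comp; [exact: cz|exact: norm_continuous].
    have [c _ Hc] := EVT_max T0 (continuous_subspaceT cn).
    exists `|z i (clamp 0 T c)| => t tT.
    by have := Hc t; rewrite in_itv /= tT clamp_id// => /(_ isT).
  exists (\sum_i `|r i|) => i t tT; apply: (le_trans (Hr i t tT)).
  by rewrite (le_trans (ler_norm _))// (bigD1 i)//= lerDl sumr_ge0.
have [r1 H1] := bounded v dv; have [r2 H2] := bounded w dw.
pose r := Num.max `|r1| `|r2|.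
have r0 : 0 <= r by rewrite le_max normr_ge0.
have vr i t : 0 <= t <= T -> `|v i t| <= r.
  by move=> tT; rewrite (le_trans (H1 i t tT))// le_max ler_norm.
have wr i t : 0 <= t <= T -> `|w i t| <= r.
  by move=> tT; rewrite (le_trans (H2 i t tT))// le_max ler_norm orbT.
have [Lf Lf0 flip] := clamped_lipschitz r0 df cf1.
have B0 : 0 <= B by have [] := lb.
have L0 : 0 < B * Lf + 1 by rewrite ltr_wpDl// mulr_ge0.
have clampE (z : 'I_(N.*2.+1) -> R -> R) t i : (forall j, `|z j t| <= r) ->
   scheme_field h beta f (fun j => z j t) i = scheme_field h beta (f \o sym_clamp r) (fun j => z j t) i.
  by move=> zr; congr (- _); apply: eq_bigr => j _ /=; rewrite sym_clamp_id.
move=> i t tT; apply/eqP; rewrite -subr_eq0 -normr_le0.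
have := @gronwall_max _ _ (fun i t => v i t - w i t)
  (fun i t => scheme_field h beta f (fun j => v j t) i - scheme_field h beta f (fun j => w j t) i)
  T (B * Lf + 1) 0 T0 L0 (lexx 0).
rewrite !mul0r; apply => //.
- move=> j u uT; have FF : Filter (increments T u) by exact: within_filter.
  rewrite /has_derivative_in [X in X @ _](_ : _ = fun d : R =>
     d^-1 * (v j (u + d) - v j u) - d^-1 * (w j (u + d) - w j u)).
    by apply: cvgB; [exact: dv|exact: dw].
  by apply/funext => d; ring.
- by move=> j; rewrite v0 w0 subrr.
- move=> j u M /andP[u0 uT] vwM; rewrite addr0.
  have uT' : 0 <= u <= T by rewrite ltW.
  rewrite !clampE; [|by move=> k; exact: wr|by move=> k; exact: vr].
  exact: (scheme_field_lipschitz lb h0 Lf0 flip).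
Qed.

End clamped_scheme.

Theorem theorem5p3 (R : realType) (s T : R) (f beta phi : R -> R)
    (nu : {charge set (measurableTypeR R) -> \bar R}) (u : R -> R -> R)
    (hs : 7 / 2 < s) (hT : 0 < T)
    (hf : class_C (Num.truncn s).+1 f) (hf0 : f 0 = 0)
    (hbeta : W11 beta) (hnu : second_derivative_measure beta nu)
    (hphi : Hs s phi) (hu : ivp_solution s T beta f phi u) :
  exists h0 eps0 C : R, [/\ 0 < h0, 0 < eps0, 0 < C &
    forall h eps : R, 0 < h <= h0 -> 0 < eps <= eps0 ->
      exists N : nat, [/\ (0 < N)%N,
        exists v, lattice_solution T h beta f phi (N:=N) v &
        forall v, lattice_solution T h beta f phi (N:=N) v ->
          forall (i : 'I_(N.*2.+1)) (t : R), 0 <= t <= T ->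
            `|u t (grid h (cidx i)) - v i t| <= C * (h ^+ 2 + eps)]].
Proof.
have [ut [hC1 heq hu0]] := hu.
have T0 : 0 <= T := ltW hT.
have m3 : (3 < (Num.truncn s).+1)%N.
  rewrite ltnS -(ler_nat R); have s0 : 0 <= s by lra.
  have /andP[_ h'] := truncn_itv s0.
  rewrite leNgt -natr1; apply/negP => h''; have : (Num.truncn s < 3)%N by rewrite -(ltr_nat R); lra.
  rewrite -ltnS => h3; have h4 : (Num.truncn s).+1%:R <= 3 :> R by rewrite ler_nat.
  lra.
have [f1 [f2 [f3 [df0 df1 df2 _]]]] := class_C_derivatives m3 hf.
have cf1 := is_derive_cont df1.
have [B lb] := lattice_bounds_of_weak hbeta hnu.
have [cb b1 B0 _] := lb.
have [K0' HK0] : exists K, forall t, 0 <= t <= T -> C3_bounded (u t) K.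
  apply: (uniform_on_segment T0) => [t K K'|t tT]; first exact: C3_bounded_le.
  have [[K [r [r0 H]]] _] := C1_Hs_local hs hC1 tT.
  by exists K, r; split => // t' t'T tt'; have [] := H t' t'T tt'.
have K0 : 0 <= K0'.
  have z0 : 0 <= (0 : R) <= T by rewrite lexx.
  have [? [? [? [_ _ _ /(_ 0) [h _ _ _]]]]] := HK0 0 z0; exact: le_trans h.
have u_le t x : 0 <= t <= T -> `|u t x| <= K0'.
  by move=> tT; have [? [? [? [_ _ _ /(_ x) []]]]] := HK0 t tT.
have [K HK] := C3_bounded_comp m3 hf K0.
have Kp : 0 <= K.
  have z0 : 0 <= (0 : R) <= T by rewrite lexx.
  by have [? [? [? [_ _ _ /(_ 0) [h _ _ _]]]]] := HK _ (HK0 0 z0); exact: le_trans h.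
pose r := K0' + 1.
have r0 : 0 <= r by rewrite addr_ge0.
have [Lf Lf0 flip] := clamped_lipschitz r0 df0 cf1.
(* The term 1 makes L positive. *)
pose L := B * Lf + 1.
have L0 : 0 < L by rewrite ltr_wpDl// mulr_ge0.
pose C := (4 * B * K + B * Lf) / L * expR (2 * L * T) + 1.
have C0 : 0 < C.
  by rewrite ltr_wpDl// mulr_ge0 ?expR_ge0// divr_ge0 ?(ltW L0)// addr_ge0 ?mulr_ge0.
(* For these h and eps the error bound is at most 1, the margin between r and K0'. *)
pose h0 := Num.min 1 (1 / (2 * C)); pose eps0 := 1 / (2 * C).
have e0 : 0 < eps0 by rewrite divr_gt0// mulr_gt0.
exists h0, eps0, C; split => //; first by rewrite lt_min ltr01.
move=> h eps /andP[hp hh0] /andP[epsp epse].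
have h1 : h <= 1 by rewrite (le_trans hh0)// ge_min lexx.
have hC : h <= 1 / (2 * C) by rewrite (le_trans hh0)// ge_min lexx orbT.
have small : C * (h ^+ 2 + eps) <= 1.
  have hh : h ^+ 2 <= h by rewrite expr2 ler_piMl// ltW.
  have : h ^+ 2 + eps <= 1 / C.
    rewrite (_ : 1 / C = 1 / (2 * C) + 1 / (2 * C)); last by field; rewrite gt_eqF.
    by apply: lerD => //; exact: le_trans hC.
  by rewrite ler_pdivlMr// mulrC.
(* Near a given time, u stays within eps / 2 of a function that decays. *)
have [X HX] : exists X, forall t, 0 <= t <= T -> forall x, X <= `|x| -> `|u t x| <= eps.
  apply: (uniform_on_segment T0) => [t X X' XX' H x xX'|t tT]; first exact: H (le_trans XX' xX').
  have [[K1 [r1 [r10 H]]] _] := C1_Hs_local hs hC1 tT.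
  have e2 : 0 < eps / 2 by rewrite divr_gt0.
  have [Hut _ _ _] := hC1 t tT; have [_ _ u2] := Hs_L2 Hut.
  have [X HX] := L2_decay (HK0 t tT) u2 e2.
  have K1p : 0 < `|K1| + 1 by rewrite ltr_wpDl.
  exists X, (Num.min r1 (eps / (2 * (`|K1| + 1)))); split.
    by rewrite lt_min r10 divr_gt0// mulr_gt0.
  move=> t' t'T; rewrite lt_min => /andP[h2 h3] x xX.
  have [_ /(_ x) h4] := H t' t'T h2; have h5 := HX x xX.
  have h6 : K1 * `|t' - t| <= eps / 2.
    have h7 : K1 * `|t' - t| <= (`|K1| + 1) * `|t' - t|.
      by rewrite ler_wpM2r//; have := ler_norm K1; lra.
    apply: (le_trans h7); rewrite mulrC -ler_pdivlMr//; apply: (le_trans (ltW h3)).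
    by rewrite le_eqVlt; apply/orP; left; apply/eqP; field; rewrite gt_eqF.
  have := ler_normD (u t' x - u t x) (u t x); rewrite subrK; lra.
pose N := (Num.truncn (`|X| / h)).+1.
have NX : X <= N%:R * h.
  rewrite (le_trans (ler_norm _))// -ler_pdivrMr//.
  by have /andP[_ /ltW] := truncn_itv (divr_ge0 (normr_ge0 X) (ltW hp)).
have fu t x : 0 <= t <= T -> sym_clamp r (u t x) = u t x.
  by move=> tT; apply: sym_clamp_id; rewrite (le_trans (u_le t x tT))// lerDl.
exists N.
suff [y y_sol err] : exists2 y, lattice_solution T h beta f phi (N:=N) y &
    forall i t, 0 <= t <= T -> `|u t (grid h (cidx i)) - y i t| <= C * (h ^+ 2 + eps).
  split => //; first by exists y.
  move=> v v_sol i t tT.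
  by rewrite (lattice_solution_unique T0 hp lb df0 cf1 v_sol y_sol)//; exact: err.
have [y [y0 dy]] := picard_lindelof (fun i => phi (grid h (cidx i))) L0 hT
  (scheme_field_lipschitz (N := N) lb hp Lf0 flip).
(* The consistency error, with f(u) of size at most Lf eps outside [-N h, N h]. *)
pose delta := 4 * B * K * h ^+ 2 + B * (Lf * eps).
have delta0 : 0 <= delta.
  by rewrite addr_ge0// !mulr_ge0// ?sqr_ge0// ltW.
have err i t : 0 <= t <= T -> `|u t (grid h (cidx i)) - y i t| <= C * (h ^+ 2 + eps).
  move=> tT.
  have := @gronwall_max _ _ (fun i t => u t (grid h (cidx i)) - y i t)
    (fun i t => ut t (grid h (cidx i)) - scheme_field h beta (f \o sym_clamp r) (fun j => y j t) i)
    T L delta T0 L0 delta0.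
  move=> /(_ _ _ _ i t tT) H; apply: (le_trans (H _ _ _)).
  - move=> j t' t'T; have FF : Filter (increments T t') by exact: within_filter.
    rewrite /has_derivative_in [X in X @ _](_ : _ = fun d : R =>
       d^-1 * (u (t' + d) (grid h (cidx j)) - u t' (grid h (cidx j))) - d^-1 * (y j (t' + d) - y j t')).
      have [_ du] := C1_Hs_local hs hC1 t'T.
      by apply: cvgB; [exact: (du (grid h (cidx j)))|exact: dy].
    by apply/funext => d; ring.
  - by move=> j; rewrite hu0 y0 subrr.
  - move=> j t' M t'T yM; have /andP[t'0 t'T2] := t'T.
    have t'T' : 0 <= t' <= T by rewrite ltW.
    have [w1 [w2 [w3 [d0 d1 d2 bd]]]] := HK _ (HK0 t' t'T').
    set x := grid h (cidx j).
    have dconv : is_derive x 1 (convolution beta (f \o u t')) (\int[lebesgue_measure]_z (beta z * w1 (x - z))).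
      by apply: (@convolution_derive _ _ _ _ w2 K) => // z; have [? ? ? _] := bd z.
    have [_ Heq] := heq t' x t'T.
    have utE : ut t' x = - \int[lebesgue_measure]_z (beta z * w1 (x - z)).
      by apply/eqP; rewrite -addr_eq0 -Heq derive1E; have [_ ->] := dconv.
    have decay z : N%:R * h <= `|z| -> `|f (u t' z)| <= Lf * eps.
      move=> zN; have := flip (u t' z) 0.
      rewrite /= (fu _ _ t'T') sym_clamp_id ?normr0// hf0 !subr0 => h2.
      by apply: (le_trans h2); rewrite ler_wpM2l// (HX t' t'T')// (le_trans NX).
    have h01 : 0 < h <= 1 by rewrite hp.
    have Le0 : 0 <= Lf * eps by rewrite mulr_ge0// ltW.
    have cons := truncated_scheme_consistency j lb d0 d1 d2 bd h01 Le0 decay.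
    have stab := scheme_field_lipschitz (N := N) lb hp Lf0 flip yM j.
    have uE : scheme_field h beta (f \o sym_clamp r) (fun k => u t' (grid h (cidx k))) j =
       - \sum_(k < N.*2.+1) h * Dgrid h beta (cidx j - cidx k) * f (u t' (grid h (cidx k))).
      by congr (- _); apply: eq_bigr => k _ /=; rewrite fu.
    rewrite utE; move: cons stab; rewrite uE -/x -/L -/delta.
    set S := \sum_(k < _) _; set I := \int[_]_z _; set G := scheme_field _ _ _ _ _.
    rewrite !ler_norml => /andP[? ?] /andP[? ?]; apply/andP; split; lra.
  have q0 : 0 <= h ^+ 2 + eps by rewrite addr_ge0 ?sqr_ge0// ltW.
  have E0 : 0 <= L^-1 * expR (2 * L * T) by rewrite mulr_ge0 ?expR_ge0// invr_ge0 ltW.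
  have dle : delta <= (4 * B * K + B * Lf) * (h ^+ 2 + eps).
    have p1 : 0 <= 4 * B * K * eps by rewrite !mulr_ge0// ltW.
    have p2 : 0 <= B * Lf * h ^+ 2 by apply: mulr_ge0; [exact: mulr_ge0|exact: sqr_ge0].
    by rewrite /delta; lra.
  have := ler_wpM2r E0 dle; rewrite mulrA => /le_trans; apply.
  rewrite (_ : C * _ = (4 * B * K + B * Lf) * (h ^+ 2 + eps) * (L^-1 * expR (2 * L * T)) + (h ^+ 2 + eps)).
    by rewrite lerDl.
  by rewrite /C; ring.
(* The error bound keeps y in [-r, r], so that y solves the system with f itself. *)
have y_sol : lattice_solution T h beta f phi y.
  split => // i t tT; have := dy i t tT.
  rewrite /scheme_field (eq_bigr (fun j => h * Dgrid h beta (cidx i - cidx j) * f (y j t))) //.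
  move=> j _ /=; rewrite sym_clamp_id//.
  have := ler_normD (y j t - u t (grid h (cidx j))) (u t (grid h (cidx j))).
  rewrite subrK distrC; have := err j t tT; have := u_le t (grid h (cidx j)) tT; rewrite /r; lra.
by exists y.
Qed.
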